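(* There is a polynomial-time algorithm that, given a bipartite graph $G=(A\cup B,E)$ in which every node has a strict ranking of its neighbors, and a cost function $c:E\to\mathbb{R}$, computes a popular max-matching $M$ of $G$ minimizing $c(M)=\sum_{e\in M}c(e)$ over all popular max-matchings of $G$.
   Context: Each node's ranking of its neighbors extends to matchings: node $u$ prefers matching $M$ to matching $N$ if either $u$ is matched in $M$ and unmatched in $N$, or $u$ is matched in both and prefers its partner in $M$ to its partner in $N$. Let $\phi(M,N)$ be the number of nodes preferring $M$ to $N$, and $\Delta(M,N)=\phi(M,N)-\phi(N,M)$. A maximum matching $M$ of $G$ (a matching of maximum cardinality) is a popular max-matching if $\Delta(M,N)\ge 0$ for every maximum matching $N$ of $G$. *)

(* Defs.v *)
From HB Require Import structures.
From mathcomp Require Import all_boot all_order all_algebra.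
From mathcomp Require Import reals.

Set Implicit Arguments.
Unset Strict Implicit.
Unset Printing Implicit Defensive.

Import Order.TTheory GRing.Theory Num.Theory.

(* A bipartite graph (A u B, E) with A = {0, ..., nA - 1}, B = {0, ..., nB - 1}.
   The strict ranking of a node is the list of its neighbours, each listed
   exactly once, in order of decreasing preference. *)
Record instance := Instance {
  nA : nat;
  nB : nat;
  edges : {set 'I_nA * 'I_nB};
  prefA : 'I_nA -> seq 'I_nB;
  prefB : 'I_nB -> seq 'I_nA;
  prefA_uniq : forall a, uniq (prefA a);
  prefB_uniq : forall b, uniq (prefB b);
  prefA_edges : forall a b, (b \in prefA a) = ((a, b) \in edges);
  prefB_edges : forall a b, (a \in prefB b) = ((a, b) \in edges)
}.

Definition edge (G : instance) : finType := ('I_(nA G) * 'I_(nB G))%type.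
Definition node (G : instance) : finType := ('I_(nA G) + 'I_(nB G))%type.

Definition gsize (G : instance) : nat := nA G + nB G + #|edges G|.

Definition joined (G : instance) (M : {set edge G}) (u v : node G) : bool :=
  match u, v with
  | inl a, inr b => (a, b) \in M
  | inr b, inl a => (a, b) \in M
  | _, _ => false
  end.

(* Position of v in u's list; only meaningful when v is a neighbour of u. *)
Definition rank (G : instance) (u v : node G) : nat :=
  match u, v with
  | inl a, inr b => index b (prefA a)
  | inr b, inl a => index a (prefB b)
  | _, _ => 0
  end.

Definition matching (G : instance) (M : {set edge G}) : Prop :=
  M \subset edges G /\
  {in M &, forall e f, e.1 = f.1 \/ e.2 = f.2 -> e = f}.

Definition max_matching (G : instance) (M : {set edge G}) : Prop :=
  matching M /\ forall N : {set edge G}, matching N -> #|N| <= #|M|.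

Definition matched (G : instance) (M : {set edge G}) (u : node G) : bool :=
  [exists v, joined M u v].

Definition prefers (G : instance) (u : node G) (M N : {set edge G}) : bool :=
  (matched M u && ~~ matched N u) ||
  [exists v, exists w, [&& joined M u v, joined N u w & rank u v < rank u w]].

Definition phi (G : instance) (M N : {set edge G}) : nat :=
  #|[set u : node G | prefers u M N]|.

Definition Delta (G : instance) (M N : {set edge G}) : int :=
  ((phi M N)%:Z - (phi N M)%:Z)%R.

Definition popular_max_matching (G : instance) (M : {set edge G}) : Prop :=
  max_matching M /\
  forall N : {set edge G}, max_matching N -> (0 <= Delta M N)%R.

Definition cost (R : realType) (G : instance) (c : edge G -> R)
    (M : {set edge G}) : R :=
  (\sum_(e in M) c e)%R.

Definition min_cost_popular_max_matching (R : realType) (G : instance)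
    (c : edge G -> R) (M : {set edge G}) : Prop :=
  popular_max_matching M /\
  forall N : {set edge G}, popular_max_matching N -> (cost c M <= cost c N)%R.

(* Real RAM, programmed by while-programs.  The memory consists of integer
   arrays and of real arrays; arrays are named by numbers fixed in the program
   and have two computed indices.  Each assignment and each test costs one unit
   of time; a program is a fixed finite object, so charging for the size of the
   expressions would only change a constant factor.
   Integers and reals can only be added, subtracted and compared.  There is no
   unit-cost multiplication, so the bit-length of integers (and of the integer
   coefficients expressing the reals in terms of the input reals) grows by O(1)
   per time unit; there is no rounding and no conversion between reals and
   integers. *)
Inductive iexp : Type :=
| ICst of nat
| IGet of nat & iexp & iexp
| IAdd of iexp & iexp
| ISub of iexp & iexp.

Inductive rexp : Type :=
| RGet of nat & iexp & iexp
| RAdd of rexp & rexp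
| RSub of rexp & rexp.

Inductive test : Type :=
| ILe of iexp & iexp
| RLe of rexp & rexp.

Inductive program : Type :=
| Skip
| ISet of nat & iexp & iexp & iexp
| RSet of nat & iexp & iexp & rexp
| Seq of program & program
| If of test & program & program
| While of test & program.

Record state (R : Type) := State {
  ints : nat -> nat -> nat -> nat;
  rels : nat -> nat -> nat -> R
}.

Definition update (T : Type) (m : nat -> nat -> nat -> T) (x i j : nat) (v : T)
    : nat -> nat -> nat -> T :=
  fun x' i' j' => if [&& x' == x, i' == i & j' == j] then v else m x' i' j'.

Definition set_int (R : Type) (s : state R) (x i j v : nat) : state R :=
  State (update (ints s) x i j v) (rels s).

Definition set_real (R : Type) (s : state R) (x i j : nat) (v : R) : state R :=
  State (ints s) (update (rels s) x i j v).

Fixpoint ieval (R : Type) (s : state R) (e : iexp) : nat :=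
  match e with
  | ICst k => k
  | IGet x i j => ints s x (ieval s i) (ieval s j)
  | IAdd e1 e2 => ieval s e1 + ieval s e2
  | ISub e1 e2 => ieval s e1 - ieval s e2
  end.

Fixpoint reval (R : realType) (s : state R) (e : rexp) : R :=
  match e with
  | RGet x i j => rels s x (ieval s i) (ieval s j)
  | RAdd e1 e2 => (reval s e1 + reval s e2)%R
  | RSub e1 e2 => (reval s e1 - reval s e2)%R
  end.

Definition teval (R : realType) (s : state R) (b : test) : bool :=
  match b with
  | ILe e1 e2 => ieval s e1 <= ieval s e2
  | RLe e1 e2 => (reval s e1 <= reval s e2)%R
  end.

(* exec P s t s': started in state s, P halts after t time units in state s'. *)
Inductive exec (R : realType) : program -> state R -> nat -> state R -> Prop :=
| exec_skip s : exec Skip s 1 s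
| exec_iset s x i j e :
    exec (ISet x i j e) s 1 (set_int s x (ieval s i) (ieval s j) (ieval s e))
| exec_rset s x i j e :
    exec (RSet x i j e) s 1 (set_real s x (ieval s i) (ieval s j) (reval s e))
| exec_seq P Q s t s' t' s'' :
    exec P s t s' -> exec Q s' t' s'' -> exec (Seq P Q) s (t + t') s''
| exec_if b P Q s t s' :
    exec (if teval s b then P else Q) s t s' -> exec (If b P Q) s t.+1 s'
| exec_while_stop b P s : ~~ teval s b -> exec (While b P) s 1 s
| exec_while_loop b P s t s' t' s'' :
    teval s b -> exec P s t s' -> exec (While b P) s' t' s'' ->
    exec (While b P) s (t + t').+1 s''.

(* Input: |A| and |B| in cells (0,0) and (0,1) of integer array 0; the degrees
   of the nodes of A and their preference lists in integer arrays 1 and 2, those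
   of B in integer arrays 3 and 4; the costs of the edges in real array 0.
   All other cells, including the costs of non-edges, are 0. *)
Definition input_ints (G : instance) (x i j : nat) : nat :=
  match x with
  | 0 => nth 0 [:: nA G; nB G] j * (i == 0)
  | 1 => oapp (fun a => size (prefA a)) 0 (insub i : option 'I_(nA G)) * (j == 0)
  | 2 => oapp (fun a => nth 0 (map val (prefA a)) j) 0
           (insub i : option 'I_(nA G))
  | 3 => oapp (fun b => size (prefB b)) 0 (insub i : option 'I_(nB G)) * (j == 0)
  | 4 => oapp (fun b => nth 0 (map val (prefB b)) j) 0
           (insub i : option 'I_(nB G))
  | _ => 0
  end.

Definition input_reals (R : realType) (G : instance) (c : edge G -> R)
    (x i j : nat) : R :=
  match x, (insub i : option 'I_(nA G)), (insub j : option 'I_(nB G)) with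
  | 0, Some a, Some b => if (a, b) \in edges G then c (a, b) else 0%R
  | _, _, _ => 0%R
  end.

Definition input (R : realType) (G : instance) (c : edge G -> R) : state R :=
  State (input_ints G) (input_reals c).

(* Output: the incidence matrix of the computed edge set, in integer array 5. *)
Definition output (R : realType) (G : instance) (s : state R) : {set edge G} :=
  [set e : edge G | ints s 5 e.1 e.2 == 1].

(* Main.v *)
Require Import Defs.
From HB Require Import structures.
From mathcomp Require Import all_boot all_order all_algebra.
From mathcomp Require Import reals.
From mathcomp Require Import boolp zify ring lra.
Import Order.TTheory GRing.Theory Num.Theory.

Set Implicit Arguments.
Unset Strict Implicit.
Unset Printing Implicit Defensive.

(* A popular max-matching M is certified by levels l : A -> {0, ..., top}: with
   half-votes wt in {-1, 0, 1}, every edge (a, b) must satisfy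
   wt a b <= l (M b) - l a, where unmatched a have level top and unmatched b count
   as level 0.  Summing over a maximum matching gives popularity, and a level
   missed by l gives a vertex cover of size #|M|; conversely the longest simple
   alternating paths yield such levels.

   A certified matching is a stable matching in the multigraph in which each a
   proposes along its list once per level, and each b prefers higher levels.
   A proposal vector gives the current position of each a; a vector is settled
   when nobody is rejected.  Settled vectors are closed under pointwise minimum,
   so there is a least one J(a, i) in which a has reached position i, and it is
   stable as soon as some stable vector has a at position >= i.  Stable vectors
   are closed under pointwise maximum; hence they correspond to the sets of
   nodes (a, i) closed under the arcs (a, i) -> (a', i') for
   i' <= J(a, i)(a'), and the cost is modular on these sets.

   A closed set of minimum weight is found by push-relabel, without source and
   sink: once no node of positive excess has height below the number of nodes,
   the nodes above a gap in the heights form an optimal set. *)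

(** * A structured language with bounded quantifiers *)

(** Costs are reals and the machine only adds, subtracts and compares, so the optimisation must be
    strongly polynomial: the number of steps may not depend on the costs. Push-relabel has this
    property, and since the arcs are uncapacitated, no number standing for infinity is ever formed.

    Stable vectors alone could not define J(a, i), because none may reach (a, i). A settled one
    always does: the vector with everybody at the last position is settled. The least settled vector
    then decides by itself whether a stable one exists.

    Integral levels come from a parity argument. An exchange along a path deprives at most one node
    of its partner, while edge weights count twice in the vote; so popularity forces the weight of
    the exchange itself to be at most 0, and longest paths are well-behaved.

    Every loop has its count fixed in advance. Rounds after completion change nothing that matters,
    so a decreasing potential proves completion while the running time is read off the program
    text. *)

Inductive htest : Type :=
| TBase of test
| TAnd of htest & htest
| TNot of htest
| TEx of nat & htest.

(** Only counted loops are offered, so that a polynomial time bound can be computed from the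
    syntax. *)
Inductive cmd : Type :=
| CSet of nat & iexp & iexp & iexp
| CRSet of nat & iexp & iexp & rexp
| CSeq of cmd & cmd
| CIf of htest & cmd & cmd
| CFor of nat & nat & cmd.

Fixpoint heval (R : realType) (k : nat) (s : state R) (t : htest) : bool :=
  match t with
  | TBase b => teval s b
  | TAnd t1 t2 => heval k s t1 && heval k s t2
  | TNot t1 => ~~ heval k s t1
  | TEx l t1 =>
      has (fun i => heval k.+2 (set_int s k.+1 0 0 i) t1)
          (iota 0 (ints s l 0 0))
  end.

(** After a loop the variable [x] is set to the limit, as the compiled [While] leaves it. *)
Fixpoint run (R : realType) (c : cmd) (s : state R) : state R :=
  match c with
  | CSet x i j e => set_int s x (ieval s i) (ieval s j) (ieval s e)
  | CRSet x i j e => set_real s x (ieval s i) (ieval s j) (reval s e)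
  | CSeq c1 c2 => run c2 (run c1 s)
  | CIf t c1 c2 => if heval 100 s t then run c1 s else run c2 s
  | CFor l x c1 =>
      set_int (foldl (fun s' i => run c1 (set_int s' x 0 0 i)) s
                     (iota 0 (ints s l 0 0)))
              x 0 0 (ints s l 0 0)
  end.

Definition cell (x : nat) : iexp := IGet x (ICst 0) (ICst 0).
Definition assign (x : nat) (e : iexp) : program := ISet x (ICst 0) (ICst 0) e.
Definition incr (x : nat) : program := assign x (IAdd (cell x) (ICst 1)).

Fixpoint compile_test (k : nat) (t : htest) : program :=
  match t with
  | TBase b => If b (assign k (ICst 1)) (assign k (ICst 0))
  | TAnd t1 t2 =>
      Seq (compile_test k t1)
          (If (ILe (ICst 1) (cell k)) (compile_test k t2) Skip)
  | TNot t1 => Seq (compile_test k t1) (assign k (ISub (ICst 1) (cell k)))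
  | TEx l t1 =>
      Seq (assign k (ICst 0)) (Seq (assign k.+1 (ICst 0))
        (While (ILe (IAdd (cell k.+1) (ICst 1)) (cell l))
          (Seq (Seq (compile_test k.+2 t1)
            (If (ILe (ICst 1) (cell k.+2)) (assign k (ICst 1)) Skip))
            (incr k.+1))))
  end.

Fixpoint compile (c : cmd) : program :=
  match c with
  | CSet x i j e => ISet x i j e
  | CRSet x i j e => RSet x i j e
  | CSeq c1 c2 => Seq (compile c1) (compile c2)
  | CIf t c1 c2 =>
      Seq (compile_test 100 t)
          (If (ILe (ICst 1) (cell 100)) (compile c1) (compile c2))
  | CFor l x c1 =>
      Seq (assign x (ICst 0))
        (While (ILe (IAdd (cell x) (ICst 1)) (cell l))
          (Seq (compile c1) (incr x)))
  end.

(* Tests compiled at level k (even, at least 100) may read the arrays below 100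
   and the quantified variables, which are the cells (0,0) of the odd arrays
   below k; the even arrays from 100 on hold the results of subtests. *)
Fixpoint iexp_below (k : nat) (e : iexp) : bool :=
  match e with
  | ICst _ => true
  | IGet x i j =>
      if x < 100 then iexp_below k i && iexp_below k j
      else [&& odd x, x < k, if i is ICst 0 then true else false
             & if j is ICst 0 then true else false]
  | IAdd e1 e2 | ISub e1 e2 => iexp_below k e1 && iexp_below k e2
  end.

Fixpoint rexp_below (k : nat) (e : rexp) : bool :=
  match e with
  | RGet _ i j => iexp_below k i && iexp_below k j
  | RAdd e1 e2 | RSub e1 e2 => rexp_below k e1 && rexp_below k e2
  end.

Definition test_below (k : nat) (b : test) : bool :=
  match b with
  | ILe e1 e2 => iexp_below k e1 && iexp_below k e2
  | RLe e1 e2 => rexp_below k e1 && rexp_below k e2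
  end.

Fixpoint htest_wf (ls : seq nat) (k : nat) (t : htest) : bool :=
  match t with
  | TBase b => test_below k b
  | TAnd t1 t2 => htest_wf ls k t1 && htest_wf ls k t2
  | TNot t1 => htest_wf ls k t1
  | TEx l t1 => [&& l \in ls, l < 100 & htest_wf ls k.+2 t1]
  end.

Fixpoint iwrites (c : cmd) : seq nat :=
  match c with
  | CSet x _ _ _ => [:: x]
  | CRSet _ _ _ _ => [::]
  | CSeq c1 c2 | CIf _ c1 c2 => iwrites c1 ++ iwrites c2
  | CFor _ x c1 => x :: iwrites c1
  end.

Fixpoint rwrites (c : cmd) : seq nat :=
  match c with
  | CSet _ _ _ _ => [::]
  | CRSet x _ _ _ => [:: x]
  | CSeq c1 c2 | CIf _ c1 c2 => rwrites c1 ++ rwrites c2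
  | CFor _ _ c1 => rwrites c1
  end.

(** [ls] lists the arrays that hold loop limits. None of them is written, so a limit stays constant
    while its loop runs and a bound on it taken at the start remains valid. *)
Fixpoint cmd_wf (ls : seq nat) (c : cmd) : bool :=
  match c with
  | CSet x i j e =>
      [&& x < 100, x \notin ls, iexp_below 100 i, iexp_below 100 j
        & iexp_below 100 e]
  | CRSet x i j e => [&& iexp_below 100 i, iexp_below 100 j & rexp_below 100 e]
  | CSeq c1 c2 => cmd_wf ls c1 && cmd_wf ls c2
  | CIf t c1 c2 => [&& htest_wf ls 100 t, cmd_wf ls c1 & cmd_wf ls c2]
  | CFor l x c1 =>
      [&& x < 100, l < 100, l \in ls, x \notin ls, x \notin iwrites c1
        & cmd_wf ls c1]
  end.

(** Simulation relation between the compiled state [s1] and the structured state [s]: the scratch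
    arrays that hold results of tests are left unconstrained. *)
Definition agree (R : realType) (k : nat) (s1 s : state R) : Prop :=
  [/\ forall x i j, x < 100 -> ints s1 x i j = ints s x i j,
      forall x, odd x -> x < k -> ints s1 x 0 0 = ints s x 0 0
    & forall x i j, rels s1 x i j = rels s x i j].

(** * Correctness and running time of the compilation *)

Section Compile.
Variable R : realType.
Implicit Types (s : state R).

Lemma agree_refl k s : agree k s s.
Proof. by split. Qed.

Definition keeps k s1 s : Prop :=
  (forall x i j, x < k -> ints s1 x i j = ints s x i j) /\
  (forall x i j, rels s1 x i j = rels s x i j).

Lemma keeps_refl k s : keeps k s s.
Proof. by split. Qed.

Lemma keeps_trans k s2 s1 s3 : keeps k s1 s2 -> keeps k s2 s3 -> keeps k s1 s3.
Proof.
move=> [h1 h2] [h3 h4]; split=> x i j; first by move=> xk; rewrite h1 // h3.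
by rewrite h2.
Qed.

Lemma keepsS k1 k2 s1 s : k1 <= k2 -> keeps k2 s1 s -> keeps k1 s1 s.
Proof. by move=> kk [h1 h2]; split=> // x i j xk; apply: h1; apply: leq_trans kk. Qed.

Lemma keeps_set_ge k s1 s x i j v :
  k <= x -> keeps k s1 s -> keeps k (set_int s1 x i j v) s.
Proof.
move=> kx [h1 h2]; split=> // y i' j' yk /=; rewrite /update.
by case: eqP => [yx|_ /=]; [move: yk; rewrite yx ltnNge kx | exact: h1].
Qed.

Lemma keeps_agree k s1 s2 s : 100 <= k -> keeps k s2 s1 -> agree k s1 s -> agree k s2 s.
Proof.
move=> k100 [h1 h2] [h3 h4 h5]; split=> x.
- by move=> i j x100; rewrite h1 ?h3 //; apply: leq_trans k100.
- by move=> ox xk; rewrite h1 ?h4.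
- by move=> i j; rewrite h2.
Qed.

Lemma agree_set k s1 s x i j v :
  agree k s1 s -> agree k (set_int s1 x i j v) (set_int s x i j v).
Proof.
move=> [h1 h2 h3]; split=> // y; rewrite /= /update.
  by move=> i' j' yk; case: ifP => // _; apply: h1.
by move=> oy yk; case: ifP => // _; apply: h2.
Qed.

Lemma agree_setr k s1 s x i j v :
  agree k s1 s -> agree k (set_real s1 x i j v) (set_real s x i j v).
Proof.
by move=> [h1 h2 h3]; split=> // y i' j' /=; rewrite /update; case: ifP.
Qed.

Lemma ieval_agree k s1 s e :
  agree k s1 s -> iexp_below k e -> ieval s1 e = ieval s e.
Proof.
move=> ag; elim: e => //= [x i IHi j IHj|e1 I1 e2 I2|e1 I1 e2 I2].
- case: ltnP => [x100 /andP[ik jk]|x100 /and4P[ox xk]].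
    by rewrite IHi // IHj //; case: ag => h _ _; apply: h.
  case: i {IHi} => // -[|//] _; case: j {IHj} => // -[|//] _ /=.
  by case: ag => _ h _; apply: h.
- by case/andP=> /I1-> /I2->.
- by case/andP=> /I1-> /I2->.
Qed.

Lemma reval_agree k s1 s e :
  agree k s1 s -> rexp_below k e -> reval s1 e = reval s e.
Proof.
move=> ag; elim: e => //= [x i j /andP[ik jk]|e1 I1 e2 I2|e1 I1 e2 I2].
- by rewrite !(ieval_agree ag) //; case: ag.
- by case/andP=> /I1-> /I2->.
- by case/andP=> /I1-> /I2->.
Qed.

Lemma teval_agree k s1 s b :
  agree k s1 s -> test_below k b -> teval s1 b = teval s b.
Proof.
by move=> ag; case: b => e1 e2 /= /andP[h1 h2];
   rewrite ?(ieval_agree ag h1) ?(ieval_agree ag h2) // (reval_agree ag h1)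
           (reval_agree ag h2).
Qed.

Lemma get_set s x v : ints (set_int s x 0 0 v) x 0 0 = v.
Proof. by rewrite /= /update !eqxx. Qed.

Lemma get_set_neq s x y i j i' j' v :
  y != x -> ints (set_int s x i j v) y i' j' = ints s y i' j'.
Proof. by rewrite /= /update => /negbTE->. Qed.

Definition within (B : nat) (ls : seq nat) s : Prop :=
  forall l, l \in ls -> ints s l 0 0 <= B.

(* b bounds the loop limits. *)
Fixpoint test_time (t : htest) (b : {poly nat}) : {poly nat} :=
  (match t with
  | TBase _ => 2%:P
  | TAnd t1 t2 => test_time t1 b + test_time t2 b + 2%:P
  | TNot t1 => test_time t1 b + 1
  | TEx _ t1 => b * (test_time t1 b + 4%:P) + 3%:P
  end)%R.

Fixpoint cmd_time (c : cmd) (b : {poly nat}) : {poly nat} :=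
  (match c with
  | CSet _ _ _ _ | CRSet _ _ _ _ => 1
  | CSeq c1 c2 => cmd_time c1 b + cmd_time c2 b
  | CIf t c1 c2 => test_time t b + cmd_time c1 b + cmd_time c2 b + 1
  | CFor _ _ c1 => b * (cmd_time c1 b + 2%:P) + 2%:P
  end)%R.


Lemma hornerDn (p q : {poly nat}) (g : nat) :
  (p + q).[g]%R = (p.[g]%R + q.[g]%R)%N.
Proof. exact: hornerD. Qed.

Lemma hornerMn (p q : {poly nat}) (g : nat) :
  (p * q).[g]%R = (p.[g]%R * q.[g]%R)%N.
Proof. exact: hornerM. Qed.

Definition exec_le P s (T : nat) s' := exists2 t, exec P s t s' & t <= T.

Lemma exec_le_weak P s T T' s' : T <= T' -> exec_le P s T s' -> exec_le P s T' s'.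
Proof. by move=> le [t ex tT]; exists t => //; apply: leq_trans le. Qed.

Lemma exec_le_skip s : exec_le Skip s 1 s.
Proof. by exists 1 => //; constructor. Qed.

Lemma exec_le_iset s x i j e :
  exec_le (ISet x i j e) s 1 (set_int s x (ieval s i) (ieval s j) (ieval s e)).
Proof. by exists 1 => //; constructor. Qed.

Lemma exec_le_rset s x i j e :
  exec_le (RSet x i j e) s 1 (set_real s x (ieval s i) (ieval s j) (reval s e)).
Proof. by exists 1 => //; constructor. Qed.

Lemma exec_le_seq P Q s T s' T' s'' :
  exec_le P s T s' -> exec_le Q s' T' s'' -> exec_le (Seq P Q) s (T + T') s''.
Proof.
move=> [t ex tT] [t' ex' tT']; exists (t + t'); last exact: leq_add.
exact: exec_seq ex ex'.
Qed.

Lemma exec_le_if b P Q s T s' :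
  exec_le (if teval s b then P else Q) s T s' -> exec_le (If b P Q) s T.+1 s'.
Proof. by move=> [t ex tT]; exists t.+1 => //; constructor. Qed.

(** Induction on the number of remaining rounds. Each round pays [T] for the body and 1 for the
    test; the last 1 is the failing test. *)
Lemma exec_le_count x l P T m (I : nat -> state R -> Prop) s :
  ints s x 0 0 = 0 -> I 0 s ->
  (forall i s1, i <= m -> I i s1 -> ints s1 l 0 0 = m) ->
  (forall i s1, i < m -> I i s1 -> ints s1 x 0 0 = i ->
    exists s2, [/\ exec_le P s1 T s2, I i.+1 s2 & ints s2 x 0 0 = i.+1]) ->
  exists s', exec_le (While (ILe (IAdd (cell x) (ICst 1)) (cell l)) P) s
                     (m * T.+1 + 1) s' /\ I m s'.
Proof.
move=> x0 I0 Il Istep.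
suff H d i s1 : i + d = m -> I i s1 -> ints s1 x 0 0 = i ->
  exists s', exec_le (While (ILe (IAdd (cell x) (ICst 1)) (cell l)) P) s1
                     (d * T.+1 + 1) s' /\ I m s'.
  by apply: (H m 0 s).
elim: d i s1 => [|d IH] i s1 idm Ii xi.
  move: xi Ii; rewrite addn0 in idm; rewrite idm => xi Im; exists s1; split => //.
  exists 1 => //; apply: exec_while_stop.
  by rewrite /= xi (Il m) // addn1 ltnn.
have lim : i < m by lia.
have [s2 [[t ex tT] I2 x2]] := Istep i s1 lim Ii xi.
have [|s' [[t' ex' tT'] I']] := IH i.+1 s2 _ I2 x2; first by lia.
exists s'; split=> //; exists (t + t').+1; last by rewrite mulSn; lia.
apply: exec_while_loop ex ex'.
by rewrite /= xi (Il i) //; lia.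
Qed.

(** A quantifier never stops early: its loop keeps in cell [k] whether some index tried so far is a
    witness, which is the [has] over an initial segment of the range. *)
Lemma exec_test (b : {poly nat}) (g : nat) ls t k s1 s :
  all (fun l => l < 100) ls -> 100 <= k -> ~~ odd k ->
  htest_wf ls k t -> agree k s1 s -> within (b.[g])%R ls s ->
  exists s1', [/\ exec_le (compile_test k t) s1 ((test_time t b).[g])%R s1',
    keeps k s1' s1 & ints s1' k 0 0 = heval k s t].
Proof.
move=> /allP ls100; elim: t k s1 s => [tb|t1 IH1 t2 IH2|t1 IH1|l t1 IH1] k s1 s k100 ko /=.
- move=> wf ag _; rewrite -(teval_agree ag wf) hornerC.
  exists (set_int s1 k 0 0 (teval s1 tb)); split.
  + by apply: exec_le_if; case: teval; apply: exec_le_iset.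
  + by apply: keeps_set_ge => //; apply: keeps_refl.
  + by rewrite get_set.
- case/andP=> wf1 wf2 ag wi; have [s2 [ex2 ke2 v2]] := IH1 k s1 s k100 ko wf1 ag wi.
  rewrite !hornerDn hornerC.
  case: (boolP (heval k s t1)) v2 => /= h1 v2.
    have [s3 [ex3 ke3 v3]] := IH2 k s2 s k100 ko wf2 (keeps_agree k100 ke2 ag) wi.
    exists s3; split=> //; last exact: keeps_trans ke3 ke2.
    rewrite -addnA; apply: exec_le_seq ex2 _.
    apply: (@exec_le_weak _ _ ((test_time t2 b).[g])%R.+1); first by rewrite addn2.
    by apply: exec_le_if; rewrite /= v2.
  exists s2; split=> //; rewrite -addnA; apply: exec_le_seq ex2 _.
  apply: (@exec_le_weak _ _ 2); first by rewrite leq_addl.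
  by apply: exec_le_if; rewrite /= v2; apply: exec_le_skip.
- move=> wf ag wi; have [s2 [ex2 ke2 v2]] := IH1 k s1 s k100 ko wf ag wi.
  exists (set_int s2 k 0 0 (1 - ints s2 k 0 0)); split.
  + rewrite hornerDn hornerC; apply: exec_le_seq ex2 _; exact: exec_le_iset.
  + exact: keeps_set_ge.
  + by rewrite get_set v2; case: heval.
- case/and3P=> lls l100 wf ag wi; rewrite hornerDn hornerMn hornerDn !hornerC.
  set m := ints s l 0 0; set T := ((test_time t1 b).[g])%R.
  pose I i s2 := keeps k s2 s1 /\ ints s2 k 0 0 =
     has (fun i => heval k.+2 (set_int s k.+1 0 0 i) t1) (iota 0 i).
  pose s2 := set_int (set_int s1 k 0 0 0) k.+1 0 0 0.
  have [||||s' [ex' [ke' v']]] := @exec_le_count k.+1 l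
    (Seq (Seq (compile_test k.+2 t1)
            (If (ILe (ICst 1) (cell k.+2)) (assign k (ICst 1)) Skip))
            (incr k.+1)) (T + 3) m I s2.
  + by rewrite get_set.
  + split; first by do 2!(apply: keeps_set_ge => //); apply: keeps_refl.
    by rewrite get_set_neq ?get_set // neq_ltn ltnSn.
  + move=> i s3 _ [ke3 _]; case: (keeps_agree k100 ke3 ag) => ag3 _ _.
    by rewrite ag3.
  + move=> i s3 im [ke3 v3] xi.
    have [ag3 ag3o ag3r] := keeps_agree k100 ke3 ag.
    have k1ne x : x < 100 -> x != k.+1.
      by move=> x100; rewrite neq_ltn (leq_trans x100) // ltnW.
    have ag3' : agree k.+2 s3 (set_int s k.+1 0 0 i).
      split=> // x; first by move=> i' j' x100; rewrite get_set_neq ?k1ne // ag3.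
      case: (eqVneq x k.+1) => [->|xk]; first by rewrite get_set.
      move=> ox xk2; rewrite get_set_neq // ag3o //.
      move: xk2; rewrite ltnS leq_eqVlt (negbTE xk) /= ltnS leq_eqVlt => /orP[/eqP xk'|//].
      by rewrite xk' (negbTE ko) in ox.
    have k100' : 100 <= k.+2 by rewrite ltnW // ltnW.
    have ko' : ~~ odd k.+2 by rewrite /= negbK.
    have [|s4 [ex4 ke4 v4]] := IH1 k.+2 s3 (set_int s k.+1 0 0 i) k100' ko' wf ag3'.
      by move=> l' l'ls; rewrite get_set_neq ?k1ne ?ls100 //; apply: wi.
    pose s5 := if 1 <= ints s4 k.+2 0 0 then set_int s4 k 0 0 1 else s4.
    have kv : ints s4 k 0 0 = ints s3 k 0 0 by case: ke4 => h _; rewrite h.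
    have kx : ints s4 k.+1 0 0 = i by case: ke4 => h _; rewrite h.
    exists (set_int s5 k.+1 0 0 i.+1); split.
    * have -> : T + 3 = (T + 2) + 1 by rewrite -addnA.
      apply: (@exec_le_seq _ _ _ _ s5).
        apply: exec_le_seq ex4 _; apply: exec_le_if; rewrite /s5 /=.
        by case: ifP => _; [apply: exec_le_iset | apply: exec_le_skip].
      have -> : i.+1 = ieval s5 (IAdd (cell k.+1) (ICst 1)).
        rewrite /= addn1 /s5; case: ifP => _; rewrite ?get_set_neq ?kx //.
        by rewrite neq_ltn ltnSn orbT.
      exact: exec_le_iset.
    * split.
        apply: keeps_set_ge => //; rewrite /s5.
        have ke43 : keeps k s4 s1.
          by apply: keeps_trans ke3; apply: keepsS ke4; apply: ltnW.
        by case: ifP => // _; apply: keeps_set_ge.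
      rewrite get_set_neq; last by rewrite neq_ltn ltnSn.
      rewrite -[i.+1]addn1 iotaD has_cat /= orbF add0n /s5 v4.
      case: heval => /=; first by rewrite /update !eqxx orbT.
      by rewrite kv v3 orbF.
    * by rewrite get_set.
  exists s'; split=> //.
  apply: (@exec_le_weak _ _ (1 + (1 + (m * (T + 3).+1 + 1)))).
    have mb : m <= (b.[g])%R by apply: wi.
    have h : m * (T + 3).+1 <= b.[g]%R * (T + 4) by rewrite addn4 addn3 leq_mul2r mb orbT.
    have aux u v : u <= v -> 1 + (1 + (u + 1)) <= v + 3 by lia.
    exact: aux h.
  apply: exec_le_seq; first exact: exec_le_iset.
  apply: exec_le_seq; first exact: exec_le_iset.
  exact: ex'.
Qed.

Lemma run_frame c s x i j : x \notin iwrites c -> ints (run c s) x i j = ints s x i j.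
Proof.
elim: c s => [y i' j' e|y i' j' e|c1 I1 c2 I2|t c1 I1 c2 I2|l y c I1] s //=.
- by rewrite inE => xy; rewrite /update (negbTE xy).
- by rewrite mem_cat negb_or => /andP[h1 h2]; rewrite I2 // I1.
- by rewrite mem_cat negb_or => /andP[h1 h2]; case: ifP => _; [apply: I1|apply: I2].
- rewrite inE negb_or => /andP[xy h]; rewrite {1}/update (negbTE xy) /=.
  move: (iota 0 _) => r; elim: r s => //= a r IH s; rewrite IH I1 //=.
  by rewrite /update (negbTE xy).
Qed.

Lemma run_framer c s x i j : x \notin rwrites c -> rels (run c s) x i j = rels s x i j.
Proof.
elim: c s => [y i' j' e|y i' j' e|c1 I1 c2 I2|t c1 I1 c2 I2|l y c I1] s //=.
- by rewrite inE => xy; rewrite /update (negbTE xy).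
- by rewrite mem_cat negb_or => /andP[h1 h2]; rewrite I2 // I1.
- by rewrite mem_cat negb_or => /andP[h1 h2]; case: ifP => _; [apply: I1|apply: I2].
- by move=> h; move: (iota 0 _) => r; elim: r s => //= a r IH s; rewrite IH I1.
Qed.

Lemma iwrites_wf ls c x : cmd_wf ls c -> x \in ls -> x \notin iwrites c.
Proof.
move=> wf xls; elim: c wf => [y i' j' e|y i' j' e|c1 I1 c2 I2|t c1 I1 c2 I2|l y c I1] //=.
- by case/and5P=> _ y1 _ _ _; rewrite inE; apply: contraNneq y1 => <-.
- by case/andP=> /I1 h1 /I2 h2; rewrite mem_cat negb_or h1.
- by case/and3P=> _ /I1 h1 /I2 h2; rewrite mem_cat negb_or h1.
- case/and5P=> _ _ _ yls /andP[_ /I1 h]; rewrite inE negb_or h andbT.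
  by apply: contraNneq yls => <-.
Qed.

Lemma exec_compile (b : {poly nat}) (g : nat) ls c s1 s :
  all (fun l => l < 100) ls -> cmd_wf ls c ->
  agree 100 s1 s -> within (b.[g])%R ls s ->
  exists s1', exec_le (compile c) s1 ((cmd_time c b).[g])%R s1' /\
              agree 100 s1' (run c s).
Proof.
move=> ls100.
elim: c s1 s => [x i j e|x i j e|c1 I1 c2 I2|t c1 I1 c2 I2|l x c I1] s1 s /=.
- case/and5P=> _ _ wi wj we ag _; rewrite -!(ieval_agree ag) //.
  eexists; split; last by apply: agree_set ag.
  by rewrite hornerC; apply: exec_le_iset.
- case/and3P=> wi wj we ag _; rewrite -!(ieval_agree ag) // -(reval_agree ag) //.
  eexists; split; last by apply: agree_setr ag.
  by rewrite hornerC; apply: exec_le_rset.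
- case/andP=> wf1 wf2 ag wi; have [s2 [ex2 ag2]] := I1 _ _ wf1 ag wi.
  have [|s3 [ex3 ag3]] := I2 _ _ wf2 ag2.
    by move=> l lls; rewrite run_frame ?(iwrites_wf wf1) //; apply: wi.
  by exists s3; split=> //; rewrite hornerDn; apply: exec_le_seq ex2 ex3.
- case/and3P=> wft wf1 wf2 ag wi.
  have [//|//|s2 [ex2 ke2 v2]] := exec_test ls100 _ _ wft ag wi.
  have ag2 := keeps_agree (leqnn _) ke2 ag.
  rewrite !hornerDn hornerC -!addnA.
  case: (heval 100 s t) v2 => v2.
    have [s3 [ex3 ag3]] := I1 _ _ wf1 ag2 wi; exists s3; split=> //.
    apply: exec_le_seq ex2 _; apply: (@exec_le_weak _ _ ((cmd_time c1 b).[g])%R.+1).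
      by rewrite -addn1 leq_add2l leq_addl.
    by apply: exec_le_if; rewrite [teval _ _]/= v2.
  have [s3 [ex3 ag3]] := I2 _ _ wf2 ag2 wi; exists s3; split=> //.
  apply: exec_le_seq ex2 _; apply: (@exec_le_weak _ _ ((cmd_time c2 b).[g])%R.+1).
    by rewrite -addn1 leq_addl.
  by apply: exec_le_if; rewrite [teval _ _]/= v2.
- case/and5P=> x100 l100 lls xls /andP[xc wf] ag wi.
  rewrite hornerDn hornerMn hornerDn !hornerC.
  set m := ints s l 0 0; set T := ((cmd_time c b).[g])%R.
  (* The structured loop after [i] rounds; [I] compares the compiled loop with it. *)
  pose F i := foldl (fun s' i => run c (set_int s' x 0 0 i)) s (iota 0 i).
  pose I i s2 := agree 100 s2 (set_int (F i) x 0 0 i).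
  have lx : l != x by apply: contraNneq xls => <-.
  have Fl i l' : l' \in ls -> ints (F i) l' 0 0 = ints s l' 0 0.
    move=> l'ls; rewrite /F; elim: (iota 0 i) s {ag wi m F I} => //= a r IH s.
    rewrite IH run_frame ?(iwrites_wf wf) // get_set_neq //.
    by apply: contraNneq xls => <-.
  have [||||s' [ex' ag']] := @exec_le_count x l
      (Seq (compile c) (incr x)) (T + 1) m I (set_int s1 x 0 0 0).
  + by rewrite get_set.
  + exact: agree_set.
  + move=> i s3 _ [h _ _]; rewrite h // get_set_neq //; exact: Fl.
  + move=> i s3 im ag3 xi.
    have [|s4 [ex4 ag4]] := I1 s3 (set_int (F i) x 0 0 i) wf ag3.
      move=> l' l'ls; rewrite get_set_neq; last by apply: contraNneq xls => <-.
      by rewrite Fl //; apply: wi.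
    have x4 : ints s4 x 0 0 = i.
      by case: ag4 => h _ _; rewrite h // run_frame // get_set.
    exists (set_int s4 x 0 0 i.+1); split; last by rewrite get_set.
      apply: exec_le_seq ex4 _.
      have -> : i.+1 = ieval s4 (IAdd (cell x) (ICst 1)) by rewrite /= x4 addn1.
      exact: exec_le_iset.
    rewrite /I [F i.+1](_ : _ = run c (set_int (F i) x 0 0 i)); first exact: agree_set.
    by rewrite /F -[i.+1]addn1 iotaD foldl_cat.
  exists s'; split=> //.
  apply: (@exec_le_weak _ _ (1 + (m * (T + 1).+1 + 1))).
    have mb : m <= (b.[g])%R by apply: wi.
    have h : m * (T + 1).+1 <= b.[g]%R * (T + 2) by rewrite addn2 addn1 leq_mul2r mb orbT.
    have aux u v : u <= v -> 1 + (u + 1) <= v + 2 by lia.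
    exact: aux h.
  by apply: exec_le_seq ex'; apply: exec_le_iset.
Qed.

Lemma foldl_iota_ind (T : Type) (I : nat -> T -> Prop) (f : T -> nat -> T) (z : T) m :
  I 0 z -> (forall i z', i < m -> I i z' -> I i.+1 (f z' i)) ->
  I m (foldl f z (iota 0 m)).
Proof.
move=> I0 IS; suff H j : j <= m -> I j (foldl f z (iota 0 j)) by apply: H.
elim: j => // j IH jm; rewrite -[j.+1]addn1 iotaD foldl_cat /= add0n addn1.
by apply: IS => //; apply: IH; apply: ltnW.
Qed.

Lemma run_for l x c s (I : nat -> state R -> Prop) (Q : state R -> Prop) :
  I 0 s ->
  (forall i s', i < ints s l 0 0 -> I i s' -> I i.+1 (run c (set_int s' x 0 0 i))) ->
  (forall s', I (ints s l 0 0) s' -> Q (set_int s' x 0 0 (ints s l 0 0))) ->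
  Q (run (CFor l x c) s).
Proof. by move=> I0 IS IQ; apply: IQ; apply: foldl_iota_ind. Qed.

End Compile.

(** * Stable proposal vectors *)

Section Proposals.
(* Man a < n proposes along the positions 0, ..., K - 1, the last of which means
   that he stays alone; E a k is the woman at position k (n if there is none),
   and W a k measures the proposal for her, smaller being better. *)
Variables (n K : nat) (E W : nat -> nat -> nat).

(** Women remember: a proposal competes with all proposals up to the current positions, not only
    with those still maintained. A position without a woman is always left, except the last one. *)
Definition rejected (q : nat -> nat) (a : nat) : Prop :=
  q a < K.-1 /\ (n <= E a (q a) \/
    exists a' k', [/\ a' < n, k' <= q a', E a' k' = E a (q a)
                    & W a' k' < W a (q a)]).

Definition settled (q : nat -> nat) : Prop :=
  forall a, a < n -> q a < K /\ ~ rejected q a.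

Definition engaged (q : nat -> nat) (b : nat) : Prop :=
  exists2 a, a < n & E a (q a) = b.

(** A settled vector need not arise from a run of proposals, so the man who made a woman her best
    proposal may have left it without cause. Stability rules this out: a woman once proposed to
    stays engaged. *)
Definition stable (q : nat -> nat) : Prop :=
  settled q /\
  forall a k, a < n -> k <= q a -> E a k < n -> engaged q (E a k).

Definition below (q q' : nat -> nat) : Prop := forall a, a < n -> q a <= q' a.

Hypothesis Elast : forall a, a < n -> E a K.-1 = n.
Hypothesis Winj : forall a a' k k', a < n -> a' < n -> k < K -> k' < K ->
  E a k < n -> E a k = E a' k' -> W a k = W a' k' -> a = a' /\ k = k'.

Lemma settled_matched q a : settled q -> a < n -> (E a (q a) < n) = (q a < K.-1).
Proof.
move=> st an; have [qK nr] := st a an.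
apply/idP/idP => [lt|lt].
  rewrite ltn_neqAle; apply/andP; split; last by case: K qK.
  by apply: contraTneq lt => ->; rewrite Elast // ltnn.
by rewrite ltnNge; apply/negP => h; apply: nr; split=> //; left.
Qed.

Lemma settled_best q a a' k' : settled q -> a < n -> a' < n -> k' <= q a' ->
  E a' k' = E a (q a) -> E a (q a) < n -> W a (q a) <= W a' k'.
Proof.
move=> st an a'n k'q eE En; rewrite leqNgt; apply/negP => lt.
have [_ nr] := st a an; apply: nr; split; first by rewrite -settled_matched.
by right; exists a', k'.
Qed.

Lemma settled_inj q a a' : settled q -> a < n -> a' < n ->
  E a (q a) = E a' (q a') -> E a (q a) < n -> a = a'.
Proof.
move=> st an a'n eE En; have En' : E a' (q a') < n by rewrite -eE.
have [] // := Winj an a'n (st a an).1 (st a' a'n).1 En eE.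
by apply/eqP; rewrite eqn_leq !(settled_best st) // -eE.
Qed.

Lemma stable_best q a k : stable q -> a < n -> k <= q a -> E a k < n ->
  exists a', [/\ a' < n, E a' (q a') = E a k & W a' (q a') <= W a k].
Proof.
move=> [st en] an kq En; have [a' a'n e'] := en a k an kq En.
by exists a'; split=> //; apply: settled_best; rewrite // e'.
Qed.

(* A man whose proposal k was given up without a better one being made could
   return to k, and the vector would still be settled. *)
Lemma least_stable q : settled q -> (forall q', settled q' -> below q q') -> stable q.
Proof.
move=> st least; split=> // a k.
(* Strong induction on the score: a better proposal to the same woman may itself have been given
   up. *)
move: {2}(W a k).+1 (ltnSn (W a k)) => w; elim: w a k => // w IH a k Ww an kq En.
case: (ltnP k (q a)) => [lt|ge]; last first.
  by exists a => //; congr (E a _); apply/eqP; rewrite eqn_leq kq ge.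
pose q' x := if x == a then k else q x.
have q'q x : q' x <= q x by rewrite /q'; case: eqP => // ->.
suff [a' [k' [a'n k'q' eE lW]]] : exists a' k', [/\ a' < n, k' <= q' a',
    E a' k' = E a k & W a' k' < W a k].
  rewrite -eE; apply: IH => //; last by rewrite eE.
    exact: leq_trans lW _.
  exact: leq_trans (q'q _).
apply: contrapT => no; suff /(_ a an) : below q q' by rewrite /q' eqxx leqNgt lt.
apply: least => x xn; split; first exact: leq_ltn_trans (q'q x) (st x xn).1.
case: (eqVneq x a) => [->|xa].
  rewrite /rejected; have -> : q' a = k by rewrite /q' eqxx.
  by case=> _ [|//]; rewrite leqNgt En.
rewrite /rejected; have -> : q' x = q x by rewrite /q' (negbTE xa).
move=> [lK h]; have [_ nr] := st x xn; apply: nr; split=> //.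
case: h => [h|[a' [k' [a'n k'q' eE lW]]]]; [by left|right; exists a', k'; split=> //].
exact: leq_trans (q'q _).
Qed.

Definition men_in (q : nat -> nat) : {set 'I_n} := [set a : 'I_n | q a < K.-1].
Definition women_in (q : nat -> nat) : {set 'I_n.+1} :=
  [set inord (E a (q a)) | a : 'I_n in men_in q].

Lemma inordE (b b' : nat) : b < n -> b' < n -> inord b = inord b' :> 'I_n.+1 -> b = b'.
Proof. by move=> h h' /(congr1 val); rewrite /= !inordK // ltnW. Qed.

Lemma card_women q : settled q -> #|women_in q| = #|men_in q|.
Proof.
move=> st; apply: card_in_imset => a a'; rewrite !inE => h h' e.
have En : E a (q a) < n by rewrite settled_matched.
have En' : E a' (q a') < n by rewrite settled_matched.
by apply/ord_inj/(settled_inj st) => //; apply: (inordE En En' e).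
Qed.

Lemma women_engaged q b : settled q -> b < n ->
  engaged q b <-> inord b \in women_in q.
Proof.
move=> st bn; split=> [[a an e]|/imsetP[a]].
  apply/imsetP; exists (Ordinal an); last by rewrite /= e.
  by rewrite inE /= -settled_matched // e.
rewrite inE -settled_matched // => En e; exists a => //.
by apply: inordE; rewrite ?e.
Qed.

(** Women held in [q] have been proposed to within [p], hence are held in [p]; men matched in [p]
    are matched in [q]. As matched men and held women are equal in number, both inclusions are
    equalities, and engagement passes from [p] to [q]. *)
Lemma settled_below_stable q p : settled q -> stable p -> below q p ->
  stable q /\ men_in q = men_in p.
Proof.
move=> sq [sp ep] qp.
have sub : women_in q \subset women_in p.
  apply/subsetP => b /imsetP[a]; rewrite inE -settled_matched // => En ->.
  by apply: (women_engaged sp En).1; apply: ep => //; apply: qp.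
have msub : men_in p \subset men_in q.
  by apply/subsetP => a; rewrite !inE; apply: leq_ltn_trans; apply: qp.
have eqW : women_in q = women_in p.
  by apply/eqP; rewrite eqEcard sub !card_women // subset_leq_card.
split; last first.
  by apply/esym/eqP; rewrite eqEcard msub -(card_women sq) -(card_women sp) eqW leqnn.
split=> // a k an kq En; apply: (women_engaged sq En).2; rewrite eqW.
by apply: (women_engaged sp En).1; apply: ep => //; apply: leq_trans (qp _ an).
Qed.

(* The men who prefer p' to p get, in p', women who are held in p by such men
   again; counting shows that these are all of their p-partners. *)
Lemma stable_swap p p' a : stable p -> stable p' -> a < n -> p' a < p a ->
  exists a', [/\ a' < n, E a' (p' a') = E a (p a) & W a (p a) < W a' (p' a')].
Proof.
move=> [sp ep] sp' an lt.
pose X : {set 'I_n} := [set x : 'I_n | p' x < p x].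
have XE' (x : 'I_n) : x \in X -> E x (p' x) < n.
  rewrite inE => h; rewrite settled_matched //; last by case: sp'.
  by apply: (leq_trans h); have := (sp x (ltn_ord x)).1; case: K.
have holder (x : 'I_n) : x \in X -> exists2 y : 'I_n, y \in X &
    E y (p y) = E x (p' x) /\ W y (p y) < W x (p' x).
  move=> xX; have En := XE' x xX; move: (xX); rewrite inE => ltx.
  have [y [yn eE lW]] := stable_best (conj sp ep) (ltn_ord x) (ltnW ltx) En.
  have lW' : W y (p y) < W x (p' x).
    rewrite ltn_neqAle lW andbT; apply/eqP => eW.
    have Eyn : E y (p y) < n by rewrite eE.
    have [yx pe] := Winj yn (ltn_ord x) (sp y yn).1 (sp'.1 x (ltn_ord x)).1 Eyn eE eW.
    by move: ltx; rewrite -pe yx ltnn.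
  (* Otherwise the proposal of [y] at [p y] would also count in [p'] and reject [x] there. *)
  exists (Ordinal yn) => //; rewrite inE /= ltnNge; apply/negP => le.
  by move: lW'; rewrite ltnNge (settled_best sp'.1).
pose Y' : {set 'I_n.+1} := [set inord (E x (p' x)) | x : 'I_n in X].
pose Y : {set 'I_n.+1} := [set inord (E x (p x)) | x : 'I_n in X].
have sub : Y' \subset Y.
  apply/subsetP => _ /imsetP[x xX ->]; have [y yX [<- _]] := holder x xX.
  exact: imset_f.
have cY' : #|Y'| = #|X|.
  apply: card_in_imset => x y xX yX e; apply/ord_inj/(settled_inj sp'.1) => //.
    by apply: inordE => //; apply: XE'.
  exact: XE'.
have YY : Y' = Y by apply/eqP; rewrite eqEcard sub cY' leq_imset_card.
have aX : Ordinal an \in X by rewrite inE.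
have : inord (E a (p a)) \in Y' by rewrite YY; apply/imsetP; exists (Ordinal an).
case/imsetP=> x xX e; have [y yX [eE lW]] := holder x xX.
have En := XE' x xX; have Ean : E a (p a) <= n.
  case: (ltnP (E a (p a)) n) => [/ltnW //|ge].
  have [pK nr] := sp a an; case: (ltnP (p a) K.-1) => [l|g].
    by case: nr; split=> //; left.
  have -> : p a = K.-1 by move: g pK; lia.
  by rewrite Elast.
have eE2 : E a (p a) = E x (p' x).
  by move/(congr1 val): e; rewrite /= !inordK // ltnS ltnW.
have ya : a = y by apply: (settled_inj sp) => //; rewrite ?eE // eE2.
by exists x; split; rewrite // ya.
Qed.

(** A rejecting proposal made within [p] contradicts [p]. One made within [p'] contradicts [p']: if
    [p' a < p a], then by [stable_swap] the woman holds in [p'] a man scoring even worse than [a],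
    who would be rejected. *)
Lemma max_not_rejected p p' a : stable p -> stable p' -> a < n -> p' a <= p a ->
  ~ rejected (fun a => maxn (p a) (p' a)) a.
Proof.
move=> sp sp' an pa; rewrite /rejected (maxn_idPl pa) => -[lK h].
have En : E a (p a) < n by rewrite settled_matched //; case: sp.
case: h => [|[a' [k' [a'n]]]]; first by rewrite leqNgt En.
rewrite leq_max => /orP[] k'p eE lW.
  by move: lW; rewrite ltnNge (settled_best sp.1).
case: (ltnP (p' a) (p a)) => [lt|ge].
  have [x [xn eE' lW']] := stable_swap sp sp' an lt.
  move: (ltn_trans lW lW'); rewrite ltnNge (settled_best sp'.1) ?eE' //.
have pp : p' a = p a by apply/eqP; rewrite eqn_leq pa ge.
by move: lW; rewrite -pp ltnNge (settled_best sp'.1) ?pp.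
Qed.

(** If her holder [x] in [p] moves on in [p'], she holds in [p'] some [y] at least as good. Should
    [y] move on in [p], his proposal there could not beat [x]; equal scores then identify [y] with
    [x], who would be ahead in both vectors. *)
Lemma max_engaged p p' a k : stable p -> stable p' -> a < n -> k <= p a -> E a k < n ->
  engaged (fun a => maxn (p a) (p' a)) (E a k).
Proof.
move=> sp sp' an kp En; have [x xn eE] := sp.2 a k an kp En; rewrite -eE in En *.
case: (leqP (p' x) (p x)) => h; first by exists x => //; rewrite (maxn_idPl h).
have [y [yn eE' lW]] := stable_best sp' xn (ltnW h) En.
exists y => //; case: (leqP (p y) (p' y)) => h'; first by rewrite eE'.
have En' : E y (p' y) < n by rewrite eE'.
have := settled_best sp.1 xn yn (ltnW h') eE' En; rewrite leq_eqVlt ltnNge lW orbF.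
move=> /eqP eW.
have [] := Winj xn yn (sp.1 x xn).1 (sp'.1 y yn).1 En (esym eE') eW.
by move=> xy pe; move: h'; rewrite -pe xy ltnn.
Qed.

Lemma stable_max p p' : stable p -> stable p' -> stable (fun a => maxn (p a) (p' a)).
Proof.
move=> sp sp'.
have maxC : (fun a => maxn (p a) (p' a)) = (fun a => maxn (p' a) (p a)).
  by apply: funext => x; rewrite maxnC.
split=> [a an|a k an].
  split; first by rewrite gtn_max (sp.1 a an).1 (sp'.1 a an).1.
  case: (leqP (p' a) (p a)) => h; first exact: max_not_rejected.
  by rewrite maxC; apply: max_not_rejected => //; apply: ltnW.
rewrite leq_max => /orP[] kp En; first exact: max_engaged.
by rewrite maxC; apply: max_engaged.
Qed.

Lemma stable_eq p p' : (forall a, a < n -> p a = p' a) -> stable p -> stable p'.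
Proof.
move=> e sp; split=> [a an|a k an].
  rewrite -e //; split; first exact: (sp.1 a an).1.
  move=> [lK h]; apply: (sp.1 a an).2; split; first by rewrite e.
  rewrite e //; case: h => [h|[a' [k' [a'n kp eE lW]]]]; [by left|right; exists a', k'].
  by rewrite e.
rewrite -e // => kp En; have [x xn eE] := sp.2 a k an kp En.
by exists x => //; rewrite -e.
Qed.

(** * Stable vectors as closed sets of nodes *)

Section Nodes.
Local Open Scope ring_scope.
Variables (R : realType) (C : nat -> nat -> R).
Variables (J : nat -> nat -> nat) (ok : nat -> bool).
Hypothesis n_gt0 : (0 < n)%N.
Hypothesis K_gt0 : (0 < K)%N.

Let m := (n * K)%N.
Definition man (v : nat) := (v %/ K)%N.
Definition pos (v : nat) := (v %% K)%N.

Hypothesis J_settled : forall v, (v < m)%N -> settled (J v).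
Hypothesis J_ge : forall v, (v < m)%N -> (pos v <= J v (man v))%N.
Hypothesis J_least : forall v q, (v < m)%N -> settled q ->
  (pos v <= q (man v))%N -> below (J v) q.
Hypothesis okP : forall v, (v < m)%N -> ok v <-> stable (J v).

Definition arc (u v : nat) : bool := ok u && (pos v <= J u (man v))%N.
(** Cost of advancing one position. Positions up to [J 0] are passed by every stable vector and
    nodes outside [ok] by none, so neither contributes to a choice. *)
Definition gain (v : nat) : R :=
  if ok v && (J 0 (man v) < pos v)%N then C (man v) (pos v) - C (man v) (pos v).-1
  else 0.
Definition vcost (q : nat -> nat) : R := \sum_(a < n) C a (q a).

Definition arc_closed (X : pred nat) : Prop :=
  forall u v, (u < m)%N -> (v < m)%N -> X u -> arc u v -> X v.

Lemma m_gt0 : (0 < m)%N. Proof. by rewrite muln_gt0 n_gt0. Qed.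

(** Node 0 is man 0 at position 0, which every vector has reached. *)
Lemma J0_below q : settled q -> below (J 0) q.
Proof. by move=> sq; apply: J_least; rewrite ?m_gt0 // /pos mod0n. Qed.

Lemma J0_stable : stable (J 0).
Proof. by apply: least_stable; [apply: J_settled m_gt0 | apply: J0_below]. Qed.

Lemma node_lt a i : (a < n)%N -> (i < K)%N -> (a * K + i < m)%N.
Proof.
move=> an iK; apply: (@leq_trans (a.+1 * K)); last by rewrite leq_mul2r an orbT.
by rewrite mulSn addnC ltn_add2r.
Qed.

Lemma man_node a i : (i < K)%N -> man (a * K + i) = a.
Proof. by move=> iK; rewrite /man divnMDl // divn_small // addn0. Qed.

Lemma pos_node a i : (i < K)%N -> pos (a * K + i) = i.
Proof. by move=> iK; rewrite /pos modnMDl modn_small. Qed.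

Lemma man_lt v : (v < m)%N -> (man v < n)%N.
Proof. by move=> vm; rewrite /man ltn_divLR. Qed.

Lemma ok_below v q : (v < m)%N -> stable q -> (pos v <= q (man v))%N -> ok v.
Proof.
move=> vm sq pq; apply/okP => //.
by case: (@settled_below_stable (J v) q (J_settled vm) sq (J_least vm sq.1 pq)).
Qed.

Lemma telescope_range (f : nat -> R) i j : (i <= j)%N -> (j < K)%N ->
  \sum_(0 <= k < K) (if (i < k <= j)%N then f k - f k.-1 else 0) = f j - f i.
Proof.
move=> ij jK; rewrite -big_mkcond /=.
rewrite (@big_cat_nat _ _ _ i.+1) //=; last by apply: leq_trans jK.
rewrite big_nat_cond big1 ?add0r; last by move=> k /andP[/andP[_ h1] /andP[h2 _]]; lia.
rewrite (@big_cat_nat _ _ _ j.+1) //= [X in _ + X]big_nat_cond.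
rewrite [X in _ + X]big1 ?addr0; last by move=> k /andP[/andP[h1 _] /andP[_ h2]]; lia.
rewrite big_nat_cond (eq_bigl (fun k => (i.+1 <= k < j.+1) && true)%N); last by move=> k; lia.
rewrite -big_nat_cond big_add1 /= telescope_sumr //.
Qed.

(** For each man, the nodes that count form the interval from [J 0 a] to [q a], along which the
    gains telescope. *)
Lemma gain_sum q (X : pred nat) : below (J 0) q -> (forall a, (a < n)%N -> (q a < K)%N) ->
  (forall a i, (a < n)%N -> (i < K)%N -> (J 0 a < i)%N ->
     X (a * K + i)%N && ok (a * K + i)%N = (i <= q a)%N) ->
  \sum_(0 <= v < m | X v) gain v = vcost q - vcost (J 0).
Proof.
move=> J0q qK hX; rewrite big_mkcond /= /m big_nat_mul /vcost -sumrB big_mkord.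
apply: eq_bigr => a _; have an := ltn_ord a.
rewrite -(telescope_range (C a) (J0q a an) (qK a an)).
rewrite -{1}[(a * K)%N]add0n big_addn mulSn addnK !big_nat.
apply: eq_bigr => i /andP[_ iK]; rewrite [(i + a * K)%N]addnC /gain man_node // pos_node //.
case: (ltnP (J 0 a) i) => [lt|ge]; last by rewrite andbF; case: ifP.
by rewrite -hX // andbT; case: (X _) => //=; case: ifP.
Qed.

Definition nodes_of (q : nat -> nat) : pred nat :=
  fun v => ok v && (pos v <= q (man v))%N.

(** Once [q] has reached [u], minimality puts [J u] below [q]; so [q] has reached every node that
    [J u] has. *)
Lemma nodes_of_closed q : stable q -> arc_closed (nodes_of q).
Proof.
move=> sq u v um vm /andP[oku pu] /andP[_ pv].
have h : (pos v <= q (man v))%N.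
  by apply: leq_trans pv _; apply: (J_least um sq.1 pu); apply: man_lt.
by rewrite /nodes_of h andbT; apply: ok_below h.
Qed.

Lemma nodes_of_gain q : stable q ->
  \sum_(0 <= v < m | nodes_of q v) gain v = vcost q - vcost (J 0).
Proof.
move=> sq; apply: gain_sum; first exact: J0_below sq.1.
  by move=> a an; case: (sq.1 a an).
move=> a i an iK lt; rewrite /nodes_of man_node // pos_node //.
case: (leqP i (q a)) => h; rewrite ?andbF //= andbT andbb.
by apply: (@ok_below _ q) => //; rewrite ?node_lt // pos_node // man_node.
Qed.

(** A closed set may contain nodes outside [ok]; they have no gain and no outgoing arcs, and the
    join skips them. The maximum is built node by node, as the program does. *)
Definition join (X : pred nat) (i : nat) : nat -> nat :=
  foldl (fun q v a => if ok v && X v then maxn (q a) (J v a) else q a) (J 0) (iota 0 i).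

Lemma joinS (X : pred nat) i a : join X i.+1 a =
  if ok i && X i then maxn (join X i a) (J i a) else join X i a.
Proof. by rewrite /join -[i.+1]addn1 iotaD foldl_cat. Qed.

Lemma join_stable (X : pred nat) i : (i <= m)%N -> stable (join X i).
Proof.
elim: i => [|i IH] im; first exact: J0_stable.
have si := IH (ltnW im); case: (boolP (ok i && X i)) => h.
  apply: (@stable_eq (fun a => maxn (join X i a) (J i a))).
    by move=> a _; rewrite joinS h.
  by apply: stable_max => //; apply/okP => //; case/andP: h.
by apply: stable_eq si => a _; rewrite joinS (negbTE h).
Qed.

Lemma join_ge (X : pred nat) i v a : (v < i)%N -> ok v -> X v -> (J v a <= join X i a)%N.
Proof.
elim: i => // i IH; rewrite ltnS leq_eqVlt => /orP[/eqP -> oki Xi|vi okv Xv].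
  by rewrite joinS oki Xi leq_maxr.
by rewrite joinS; have := IH vi okv Xv; case: ifP => // _ h; rewrite leq_max h.
Qed.

Lemma join_reached (X : pred nat) i a : join X i a = J 0 a \/
  exists v, [/\ (v < i)%N, ok v, X v & join X i a = J v a].
Proof.
elim: i => [|i IH]; first by left.
have w : join X i a = J 0 a \/
    exists v, [/\ (v < i.+1)%N, ok v, X v & join X i a = J v a].
  by case: IH => [|[v [vi okv Xv e]]]; [left|right; exists v; rewrite ltnW].
rewrite joinS; case: ifP => // /andP[oki Xi].
case: (leqP (J i a) (join X i a)) => h; first by [].
by right; exists i; rewrite ltnSn.
Qed.

(** If the join has reached (a, i) beyond [J 0], its value at [a] is attained by a single [J u] with
    [u] in [X]; this gives an arc from [u] to (a, i), which closedness pulls into [X]. *)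
Lemma join_gain (X : pred nat) : arc_closed X ->
  \sum_(0 <= v < m | X v) gain v = vcost (join X m) - vcost (J 0).
Proof.
move=> clX; have sj := join_stable X (leqnn m).
apply: gain_sum; first exact: J0_below sj.1.
  by move=> a an; case: (sj.1 a an).
move=> a i an iK lt; have vm := node_lt an iK.
apply/andP/idP => [[Xv okv]|le].
  have := join_ge a vm okv Xv; apply: leq_trans.
  by have := J_ge vm; rewrite man_node // pos_node.
have okv : ok (a * K + i)%N.
  by apply: (@ok_below _ (join X m)) => //; rewrite pos_node // man_node.
split=> //; case: (join_reached X m a) => [e|[u [um oku Xu e]]].
  by move: lt; rewrite ltnNge -e le.
by apply: (clX u) => //; rewrite /arc oku man_node // pos_node // -e.
Qed.

Lemma join_optimal (X : pred nat) : arc_closed X ->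
  (forall X', arc_closed X' ->
     \sum_(0 <= v < m | X v) gain v <= \sum_(0 <= v < m | X' v) gain v) ->
  forall q, stable q -> vcost (join X m) <= vcost q.
Proof.
move=> clX opt q sq; have := opt _ (nodes_of_closed sq).
by rewrite join_gain // nodes_of_gain // lerD2r.
Qed.

End Nodes.
End Proposals.

(** * Minimum-weight closed sets by push-relabel *)

Section PushRelabel.
Local Open Scope ring_scope.
Variables (R : realType) (V : finType) (arc : rel V) (w : V -> R).
Implicit Types (e : V -> R) (g : V -> V -> R) (h : V -> nat).

Let N := #|V|.

(* The flow g runs along the arcs, which have infinite capacity; node v has
   supply - w v, and e v is what is left there. *)
Record preflow e g h : Prop := Preflow {
  pf_e : forall v, e v = - w v + \sum_u g u v - \sum_u g v u;
  pf_ge0 : forall u v, 0 <= g u v;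
  pf_arc : forall u v, 0 < g u v -> arc u v;
  pf_h : forall u v, arc u v -> (h u <= (h v).+1)%N;
  pf_hr : forall u v, 0 < g u v -> (h v <= (h u).+1)%N;
  pf_neg : forall v, e v < 0 -> h v = 0%N;
  pf_max : forall v, (h v <= N)%N
}.

(** A node that has climbed to height [N] is frozen and may keep its excess; it ends up above the
    gap. *)
Definition active e h (u : V) : bool := (h u < N)%N && (0 < e u).
Definition residual g (u v : V) : bool := arc u v || (0 < g v u).
Definition admissible g h (u v : V) : bool := (h u == (h v).+1) && residual g u v.

Definition upd (T : Type) (f : V -> T) (u : V) (x : T) : V -> T :=
  fun v => if v == u then x else f v.

(** The second sum counts the flow arcs that can be emptied by pushing back downhill. Its factor
    [N.+1] outweighs the height at most [N] of a node made positive by a saturating push. A relabel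
    adds 1 to the first sum and at most [2 * N] to the second, which the last factor exceeds by
    1. *)
Definition potential e g h : nat :=
  (\sum_(v | (0 < e v)%R) h v
   + N.+1 * \sum_u \sum_v ((0 < g u v)%R && (h u < h v))
   + (2 * N * N.+1 + 2) * \sum_v (N - h v))%N.


Lemma active_sumE e h : (\sum_(v | (0 < e v)%R) h v = \sum_v (0 < e v)%R * h v)%N.
Proof. by rewrite big_mkcond; apply: eq_bigr => v _; case: ifP; rewrite ?mul1n. Qed.

Lemma sum_eqb (u : V) (k : nat) : (\sum_v (v == u) * k = k)%N.
Proof.
by rewrite (bigD1 u) //= eqxx mul1n big1 ?addn0 // => v /negbTE->.
Qed.

Lemma residualP e g h u v : preflow e g h -> residual g u v -> (h u <= (h v).+1)%N.
Proof. by move=> pf /orP[/(pf_h pf)|/(pf_hr pf)]. Qed.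

(** Without an admissible arc, every residual neighbour of [u] is at least as high as [u], so one
    more unit of height is allowed. *)
Lemma relabel_preflow e g h u : preflow e g h -> active e h u ->
  (forall v, ~~ admissible g h u v) -> preflow e g (upd h u (h u).+1).
Proof.
move=> pf /andP[hN eu] na.
have res x y : residual g x y -> (upd h u (h u).+1 x <= (upd h u (h u).+1 y).+1)%N.
  move=> r; have := residualP pf r; rewrite /upd.
  case: (eqVneq x u) => [xu|_]; case: (eqVneq y u) => [yu|_] //.
    by have := na y; rewrite xu /admissible -xu r andbT => /eqP; lia.
  by rewrite yu; lia.
split; try by case: pf.
- by move=> x y a; apply: res; rewrite /residual a.
- by move=> x y a; apply: res; rewrite /residual a orbT.
- move=> v ev; rewrite /upd; case: eqP => [vu|_]; last exact: (pf_neg pf).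
  by move: ev; rewrite vu => ev; have := lt_trans ev eu; rewrite ltxx.
- by move=> v; rewrite /upd; case: eqP => // _; apply: (pf_max pf).
Qed.

Lemma relabel_potential e g h u : preflow e g h -> active e h u ->
  (potential e g (upd h u (h u).+1) < potential e g h)%N.
Proof.
move=> pf /andP[hN eu]; rewrite /potential.
set h' := upd h u (h u).+1.
have h'E v : h' v = (h v + (v == u))%N.
  by rewrite /h' /upd; case: eqP => [->|_]; rewrite ?addn1 ?addn0.
have -> : (\sum_(v | (0 < e v)%R) h' v = (\sum_(v | (0 < e v)%R) h v).+1)%N.
  rewrite !active_sumE -addn1 -(sum_eqb u 1) -big_split; apply: eq_bigr => v _ /=.
  by rewrite h'E; case: eqP => [->|_]; rewrite ?eu ?mul1n // !addn0.
have S : (\sum_v (N - h v) = (\sum_v (N - h' v)).+1)%N.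
  rewrite (bigD1 u) //= [in RHS](bigD1 u) //= h'E eqxx.
  rewrite -[in RHS]addSn; congr (_ + _)%N; first by lia.
  by apply: eq_bigr => v vu; rewrite h'E (negbTE vu) addn0.
rewrite S.
(* Only pairs with [u] as an end can change, at most [N] for each role of [u]. *)
have P : (\sum_x \sum_y ((0 < g x y)%R && (h' x < h' y))
          <= \sum_x \sum_y ((0 < g x y)%R && (h x < h y)) + 2 * N)%N.
  have -> : (2 * N = \sum_(x : V) \sum_(y : V) ((x == u) + (y == u)))%N.
    under eq_bigr => x _ do rewrite big_split /=.
    rewrite big_split /= mul2n -addnn; congr (_ + _)%N.
      under eq_bigr => x _ do rewrite sum_nat_const.
      by rewrite -big_distrr /= -big_mkcond /= big_pred1_eq muln1.
    under eq_bigr => x _ do rewrite -big_mkcond /= big_pred1_eq.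
    by rewrite sum1_card.
  rewrite -big_split /=; apply: leq_sum => x _.
  rewrite -big_split /=; apply: leq_sum => y _.
  case: (0 < g x y) => //=; rewrite !h'E.
  by case: (x == u); case: (y == u); rewrite /= ?addn0 ?addn1; lia.
move: P; set A := (\sum_x _)%N; set B := (\sum_x _)%N; set D := (\sum_v _)%N.
move=> P; have := leq_mul (leqnn N.+1) P; nia.
Qed.


(** Both kinds of push are treated together: forward along [arc u v] the flow gains [d], backward
    the flow from [v] to [u] loses [d]. Since [d] is at most the excess of [u], no new deficit
    arises. *)
Lemma push_preflow e g h u v x y (t d : R) e' g' : preflow e g h ->
  h u = (h v).+1 -> 0 < d -> d <= e u ->
  [/\ x = u, y = v, t = d & arc u v] \/ [/\ x = v, y = u, t = - d & d <= g v u] ->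
  (forall z, e' z = e z + d *+ (z == v) - d *+ (z == u)) ->
  (forall z z', g' z z' = g z z' + t *+ ((z == x) && (z' == y))) ->
  preflow e' g' h.
Proof.
move=> pf huv d0 deu ca e'E g'E.
have uv : u != v by apply: contra_eq_neq huv => ->; lia.
have pos z z' : 0 < g' z z' -> 0 < g z z' \/ [/\ z = u, z' = v & arc u v].
  rewrite g'E; case: (boolP ((z == x) && (z' == y))) => [/andP[/eqP-> /eqP->]|_].
    by case: ca => -[-> -> -> ?]; [right|left; lra].
  by rewrite mulr0n addr0; left.
split.
- move=> z; rewrite e'E (pf_e pf).
  have -> : \sum_u0 g' u0 z = \sum_u0 g u0 z + t *+ (z == y).
    under eq_bigr => i _ do rewrite g'E.
    rewrite big_split /=; congr (_ + _).
    rewrite (bigD1 x) //= eqxx /= big1 ?addr0 // => i /negbTE ->.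
    by rewrite mulr0n.
  have -> : \sum_u0 g' z u0 = \sum_u0 g z u0 + t *+ (z == x).
    under eq_bigr => i _ do rewrite g'E.
    rewrite big_split /=; congr (_ + _).
    rewrite (bigD1 y) //= eqxx andbT big1 ?addr0 // => i /negbTE ->.
    by rewrite andbF mulr0n.
  by case: ca => -[-> -> -> _]; rewrite ?mulNrn; ring.
- move=> z z'; rewrite g'E.
  have := pf_ge0 pf z z'; case: (boolP ((z == x) && (z' == y))) => [/andP[/eqP-> /eqP->]|_].
    by case: ca => -[-> -> -> ?]; rewrite mulr1n; lra.
  by rewrite mulr0n addr0.
- by move=> z z' /pos[/(pf_arc pf)|[-> ->]].
- exact: (pf_h pf).
- by move=> z z' /pos[/(pf_hr pf)|[-> -> _]] //; rewrite huv; lia.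
- move=> z; rewrite e'E; case: (eqVneq z u) => [->|zu].
    by rewrite (negbTE uv) mulr0n mulr1n addr0 subr_lt0 ltNge deu.
  rewrite mulr0n subr0; case: (z == v) => ez; apply: (pf_neg pf).
    by apply: le_lt_trans ez; rewrite mulr1n lerDl ltW.
  by move: ez; rewrite mulr0n addr0.
- exact: (pf_max pf).
Qed.

(** Emptying [u] removes [h u] from the first sum, while [v] adds at most [h v], one less. New flow
    only runs downhill, where the second sum does not count it. *)
Lemma push_all_potential e g h u v e' g' : preflow e g h -> h u = (h v).+1 ->
  0 < e u -> e' u = 0 -> (forall z, z != u -> z != v -> e' z = e z) ->
  (forall x y, (h x < h y)%N -> 0 < g' x y -> 0 < g x y) ->
  (potential e' g' h < potential e g h)%N.
Proof.
move=> pf huv eu e'u e'E g'E; rewrite /potential ltn_add2r.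
have uv : u != v by apply: contra_eq_neq huv => ->; lia.
have A : (\sum_(z | (0 < e' z)%R) h z + h u <= \sum_(z | (0 < e z)%R) h z + h v)%N.
  rewrite !active_sumE -(sum_eqb u (h u)) -(sum_eqb v (h v)) -!big_split /=.
  apply: leq_sum => z _; case: (eqVneq z u) => [->|zu].
    by rewrite e'u ltxx eu (negbTE uv); lia.
  case: (eqVneq z v) => [->|zv]; last by rewrite e'E.
  by case: (0 < e' v); lia.
have B : (\sum_x \sum_y ((0 < g' x y)%R && (h x < h y))
          <= \sum_x \sum_y ((0 < g x y)%R && (h x < h y)))%N.
  apply: leq_sum => x _; apply: leq_sum => y _.
  case: ltnP => hxy; rewrite ?andbF // !andbT.
  by case: (boolP (0 < g' x y)) => // /(g'E _ _ hxy) ->.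
move: A B; rewrite huv; set X := (\sum_(z | _) _)%N; set Y := (\sum_(z | _) _)%N.
set X' := (\sum_x _)%N; set Y' := (\sum_x _)%N => A B.
by have := leq_mul (leqnn N.+1) B; lia.
Qed.

Lemma push_sat_potential e g h u v e' g' : preflow e g h -> h u = (h v).+1 ->
  (forall z, z != v -> 0 < e' z -> 0 < e z) ->
  0 < g v u -> (forall x y, g' x y = if (x == v) && (y == u) then 0 else g x y) ->
  (potential e' g' h < potential e g h)%N.
Proof.
move=> pf huv e'E gvu g'E; rewrite /potential ltn_add2r.
have A : (\sum_(z | (0 < e' z)%R) h z <= \sum_(z | (0 < e z)%R) h z + h v)%N.
  rewrite !active_sumE -(sum_eqb v (h v)) -!big_split /=.
  apply: leq_sum => z _; case: (eqVneq z v) => [->|zv].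
    by case: (0 < e' v); lia.
  by case: (boolP (0 < e' z)) => // /(e'E _ zv) ->; rewrite addn0.
have B : (\sum_x \sum_y ((0 < g x y)%R && (h x < h y))
          = (\sum_x \sum_y ((0 < g' x y)%R && (h x < h y))).+1)%N.
  rewrite (bigD1 v) //= [in RHS](bigD1 v) //= -addSn; congr (_ + _)%N.
    rewrite (bigD1 u) //= [in RHS](bigD1 u) //= -addSn; congr (_ + _)%N.
      by rewrite g'E !eqxx ltxx gvu huv ltnSn.
    by apply: eq_bigr => y /negbTE yu; rewrite g'E yu andbF.
  by apply: eq_bigr => x /negbTE xv; apply: eq_bigr => y _; rewrite g'E xv.
rewrite B; have := pf_max pf v; move: A.
set X := (\sum_(z | _) _)%N; set Y := (\sum_(z | _) _)%N; set Z := (\sum_x _)%N.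
by rewrite mulnS; move: (N.+1 * Z)%N => q; lia.
Qed.

Definition closed_set (X : pred V) : Prop := forall u v, X u -> arc u v -> X v.

(** Flow conservation summed over [Y]; flow inside [Y] cancels. *)
Lemma weight_of_set e g h (Y : pred V) : preflow e g h ->
  \sum_(v | Y v) w v = - \sum_(v | Y v) e v
    + \sum_(v | Y v) \sum_(u | ~~ Y u) g u v - \sum_(v | Y v) \sum_(u | ~~ Y u) g v u.
Proof.
move=> pf.
have -> : \sum_(v | Y v) e v = - (\sum_(v | Y v) w v) + \sum_(v | Y v) \sum_u g u v
   - \sum_(v | Y v) \sum_u g v u.
  by rewrite -!sumrN -!big_split /=; apply: eq_bigr => v _; rewrite (pf_e pf).
have s1 : \sum_(v | Y v) \sum_u g u v =
    \sum_(v | Y v) \sum_(u | Y u) g u v + \sum_(v | Y v) \sum_(u | ~~ Y u) g u v.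
  by rewrite -big_split /=; apply: eq_bigr => v _; rewrite (bigID Y).
have s2 : \sum_(v | Y v) \sum_u g v u =
    \sum_(v | Y v) \sum_(u | Y u) g v u + \sum_(v | Y v) \sum_(u | ~~ Y u) g v u.
  by rewrite -big_split /=; apply: eq_bigr => v _; rewrite (bigID Y).
by rewrite s1 s2 [in \sum_(v | Y v) \sum_(u | Y u) g u v]exchange_big /=; ring.
Qed.

Lemma gap_closed e g h k : preflow e g h -> (forall v, h v != k) ->
  closed_set (fun v => (k < h v)%N).
Proof.
by move=> pf gap u v ku /(pf_h pf); have := gap v; have := gap u; lia.
Qed.

(** Complementary slackness. A closed set has no outflow, so it weighs at least minus its total
    excess. No flow climbs across the gap, so the upper side weighs at most minus its own total
    excess. That excess is the largest possible: deficits sit at height 0, and nothing below the gap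
    has positive excess. *)
Lemma gap_optimal e g h k : preflow e g h -> (forall v, ~~ active e h v) ->
  (k <= N)%N -> (forall v, h v != k) ->
  forall Y, closed_set Y -> \sum_(v | (k < h v)%N) w v <= \sum_(v | Y v) w v.
Proof.
move=> pf na kN gap Y clY.
rewrite (weight_of_set (fun v => (k < h v)%N) pf) (weight_of_set Y pf).
set X := (fun v => (k < h v)%N).
have z1 : \sum_(v | (k < h v)%N) \sum_(u | ~~ (k < h u)%N) g u v = 0.
  apply: big1 => v kv; apply: big1 => u ku.
  apply/eqP; rewrite eq_le (pf_ge0 pf) andbT leNgt; apply/negP => /(pf_hr pf).
  by have := gap u; lia.
have z2 : \sum_(v | Y v) \sum_(u | ~~ Y u) g v u = 0.
  apply: big1 => v Yv; apply: big1 => u Yu.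
  apply/eqP; rewrite eq_le (pf_ge0 pf) andbT leNgt; apply/negP => /(pf_arc pf) a.
  by move: Yu; rewrite (clY _ _ Yv a).
have p1 : 0 <= \sum_(v | (k < h v)%N) \sum_(u | ~~ (k < h u)%N) g v u.
  by apply: sumr_ge0 => v _; apply: sumr_ge0 => u _; apply: (pf_ge0 pf).
have p2 : 0 <= \sum_(v | Y v) \sum_(u | ~~ Y u) g u v.
  by apply: sumr_ge0 => v _; apply: sumr_ge0 => u _; apply: (pf_ge0 pf).
have p3 : \sum_(v | Y v) e v <= \sum_(v | (k < h v)%N) e v.
  rewrite big_mkcond [leRHS]big_mkcond; apply: ler_sum => v _.
  case: ltnP => kv.
    have e0 : 0 <= e v.
      by rewrite leNgt; apply/negP => /(pf_neg pf) h0; move: kv; rewrite h0.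
    by case: ifP.
  case: ifP => // _; have := na v; rewrite /active (_ : (h v < N)%N) /= -?leNgt //.
  by have := gap v; lia.
by rewrite z1 z2; lra.
Qed.

(** Pigeonhole: [N] nodes cannot occupy [N.+1] heights. So some height up to [N] is always a gap. *)
Lemma gap_top h : (forall k, (k < N)%N -> exists v, h v = k) -> forall v, h v != N.
Proof.
move=> hit v; apply/eqP => hv.
have : (size (iota 0 N.+1) <= size (codom h))%N.
  apply: uniq_leq_size; first exact: iota_uniq.
  move=> k; rewrite mem_iota /= add0n ltnS leq_eqVlt => /orP[/eqP->|/hit[x <-]].
    by rewrite -hv codom_f.
  exact: codom_f.
by rewrite size_iota size_codom ltnn.
Qed.

Lemma start_preflow : preflow (fun v => - w v) (fun _ _ => 0) (fun=> 0%N).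
Proof.
split=> //= [v|u v]; last by rewrite ltxx.
by rewrite !big1 // subr0 addr0.
Qed.

Lemma start_potential :
  (potential (fun v => - w v) (fun _ _ => 0%R) (fun=> 0) = (2 * N * N.+1 + 2) * (N * N))%N.
Proof.
rewrite /potential big1 // big1; last by move=> x _; rewrite big1 // => y _; rewrite ltxx.
by rewrite muln0 !add0n sum_nat_const subn0.
Qed.

End PushRelabel.

(** * Popular maximum matchings and level certificates *)

Section Popular.
Variable G : instance.
Notation A := 'I_(nA G).
Notation B := 'I_(nB G).
Implicit Types (M N : {set edge G}) (a : A) (b : B).

Definition mA M a : option B := [pick b | (a, b) \in M].
Definition mB M b : option A := [pick a | (a, b) \in M].

Lemma mAP M a b : matching M -> (mA M a == Some b) = ((a, b) \in M).
Proof.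
move=> [_ uM]; rewrite /mA; case: pickP => [b' h|none]; last by rewrite none.
apply/eqP/idP => [[<-] //|h']; congr Some.
by have [] := uM _ _ h h' (or_introl erefl).
Qed.

Lemma mBP M a b : matching M -> (mB M b == Some a) = ((a, b) \in M).
Proof.
move=> [_ uM]; rewrite /mB; case: pickP => [a' h|none]; last by rewrite none.
apply/eqP/idP => [[<-] //|h']; congr Some.
by have [] := uM _ _ h h' (or_intror erefl).
Qed.

Lemma mAB M a b : matching M -> (mA M a == Some b) = (mB M b == Some a).
Proof. by move=> mM; rewrite mAP // mBP. Qed.

Definition ra a b : nat := index b (prefA a).
Definition rb b a : nat := index a (prefB b).

Lemma ra_inj a b b' : (a, b) \in edges G -> (a, b') \in edges G ->
  ra a b = ra a b' -> b = b'.
Proof.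
rewrite -!prefA_edges => h h' e.
by rewrite -(nth_index b h) -(nth_index b h') -/(ra a b') -e.
Qed.

Lemma rb_inj b a a' : (a, b) \in edges G -> (a', b) \in edges G ->
  rb b a = rb b a' -> a = a'.
Proof.
rewrite -!prefB_edges => h h' e.
by rewrite -(nth_index a h) -(nth_index a h') -/(rb b a') -e.
Qed.

Definition pa M a b : bool := if mA M a is Some b' then ra a b < ra a b' else true.
Definition pb M b a : bool := if mB M b is Some a' then rb b a < rb b a' else true.

Lemma matchedA M a : matching M -> matched M (inl a) = (mA M a != None).
Proof.
move=> mM; apply/existsP/idP => [[[//|b] /=]|]; first by rewrite -mAP // => /eqP->.
by case e: (mA M a) => [b|//] _; exists (inr b); rewrite /= -mAP // e.
Qed.

Lemma matchedB M b : matching M -> matched M (inr b) = (mB M b != None).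
Proof.
move=> mM; apply/existsP/idP => [[[a|//] /=]|]; first by rewrite -mBP // => /eqP->.
by case e: (mB M b) => [a|//] _; exists (inl a); rewrite /= -mBP // e.
Qed.

Lemma prefersA N M a : matching N -> matching M ->
  prefers (inl a) N M = if mA N a is Some b then pa M a b else false.
Proof.
move=> mN mM; rewrite /prefers !matchedA // /pa.
case eN: (mA N a) => [b|] /=.
  case eM: (mA M a) => [b'|//] /=; apply/existsP/idP.
    case=> -[c|c] /existsP[[c'|c'] //=]; rewrite ?andbF // => /and3P[].
    by rewrite -!mAP // eN eM => /eqP[<-] /eqP[<-].
  move=> lt; exists (inr b); apply/existsP; exists (inr b') => /=.
  by rewrite -!mAP // eN eM !eqxx.
apply/negbTE/negP => /existsP[[c|c] /existsP[[c'|c'] //=]]; rewrite ?andbF // => /and3P[].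
by rewrite -!mAP // eN.
Qed.

Lemma prefersB N M b : matching N -> matching M ->
  prefers (inr b) N M = if mB N b is Some a then pb M b a else false.
Proof.
move=> mN mM; rewrite /prefers !matchedB // /pb.
case eN: (mB N b) => [a|] /=.
  case eM: (mB M b) => [a'|//] /=; apply/existsP/idP.
    case=> -[c|c] /existsP[[c'|c'] //=]; rewrite ?andbF // => /and3P[].
    by rewrite -!mBP // eN eM => /eqP[<-] /eqP[<-].
  move=> lt; exists (inl a); apply/existsP; exists (inl a') => /=.
  by rewrite -!mBP // eN eM !eqxx.
apply/negbTE/negP => /existsP[[c|c] /existsP[[c'|c'] //=]]; rewrite ?andbF // => /and3P[].
by rewrite -!mBP // eN.
Qed.

Local Open Scope ring_scope.

(** Half the sum of the votes of [a] and [b] for each other against their partners in [M]: votes of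
    the form 2x - 1 with x in {0, 1} average to [pa + pb - 1]. *)
Definition wt M a b : int :=
  if (a, b) \in M then 0 else (pa M a b)%:Z + (pb M b a)%:Z - 1.

Definition lostA M N : {set A} := [set a | (mA M a != None) && (mA N a == None)].
Definition lostB M N : {set B} := [set b | (mB M b != None) && (mB N b == None)].

Lemma voteA N M a : matching N -> matching M ->
  (prefers (inl a) N M)%:Z - (prefers (inl a) M N)%:Z =
  (if mA N a is Some b then if (a, b) \in M then 0 else (pa M a b)%:Z * 2 - 1 else 0)
  - (a \in lostA M N)%:Z.
Proof.
move=> mN mM; rewrite !prefersA // inE /pa.
case eN: (mA N a) => [b|]; case eM: (mA M a) => [b'|] //=; last first.
  by rewrite -mAP // eM.
rewrite -mAP // eM.
have [hb hb'] : (a, b) \in edges G /\ (a, b') \in edges G.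
  by split; [have [/subsetP h _] := mN|have [/subsetP h _] := mM];
     apply: h; rewrite -mAP // ?eN ?eM eqxx.
case: (eqVneq (Some b') (Some b)) => [[->]|ne]; first by rewrite ltnn.
have : ra a b != ra a b' by apply: contra_neq ne => /(ra_inj hb hb') ->.
by case: ltngtP.
Qed.

Lemma voteB N M b : matching N -> matching M ->
  (prefers (inr b) N M)%:Z - (prefers (inr b) M N)%:Z =
  (if mB N b is Some a then if (a, b) \in M then 0 else (pb M b a)%:Z * 2 - 1 else 0)
  - (b \in lostB M N)%:Z.
Proof.
move=> mN mM; rewrite !prefersB // inE /pb.
case eN: (mB N b) => [a|]; case eM: (mB M b) => [a'|] //=; last first.
  by rewrite -mBP // eM.
rewrite -mBP // eM.
have [hb hb'] : (a, b) \in edges G /\ (a', b) \in edges G.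
  by split; [have [/subsetP h _] := mN|have [/subsetP h _] := mM];
     apply: h; rewrite -mBP // ?eN ?eM eqxx.
case: (eqVneq (Some a') (Some a)) => [[->]|ne]; first by rewrite ltnn.
have : rb b a != rb b a' by apply: contra_neq ne => /(rb_inj hb hb') ->.
by case: ltngtP.
Qed.

Lemma sumA (S : nmodType) N (F : A -> B -> S) : matching N ->
  \sum_(e in N) F e.1 e.2 = \sum_a (if mA N a is Some b then F a b else 0).
Proof.
move=> mN; rewrite (eq_bigl (fun e : edge G => true && ((e.1, e.2) \in N))); last first.
  by case.
rewrite -(pair_big_dep xpredT (fun a b => (a, b) \in N) F) /=.
apply: eq_bigr => a _; case e: (mA N a) => [b|].
  by rewrite (eq_bigl (pred1 b)) ?big_pred1_eq // => c; rewrite -mAP // e eq_sym.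
by rewrite big_pred0 // => c; rewrite -mAP // e.
Qed.

Lemma sumB (S : nmodType) N (F : A -> B -> S) : matching N ->
  \sum_(e in N) F e.1 e.2 = \sum_b (if mB N b is Some a then F a b else 0).
Proof.
move=> mN; rewrite (eq_bigl (fun e : edge G => true && ((e.1, e.2) \in N))); last first.
  by case.
rewrite -(pair_big_dep xpredT (fun a b => (a, b) \in N) F) /=.
rewrite (exchange_big_dep xpredT) //=.
apply: eq_bigr => b _; case e: (mB N b) => [a|].
  by rewrite (eq_bigl (pred1 a)) ?big_pred1_eq // => c; rewrite -mBP // e eq_sym.
by rewrite big_pred0 // => c; rewrite -mBP // e.
Qed.

Lemma phi_sum N M : ((phi N M)%:Z = \sum_(u : node G) (prefers u N M)%:Z)%R.
Proof.
rewrite /phi -sum1dep_card big_mkcond /= (big_morph Posz PoszD erefl).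
by apply: eq_bigr => u _; case: prefers.
Qed.

Lemma card_int (T : finType) (S : {set T}) : (#|S|%:Z = \sum_x (x \in S)%:Z)%R.
Proof.
rewrite -sum1_card big_mkcond /= (big_morph Posz PoszD erefl).
by apply: eq_bigr => u _; case: (u \in S).
Qed.

(** Each edge of [N] collects the votes of its two ends; the remaining votes are those of nodes
    matched only in [M], each -1. *)
Lemma Delta_wt N M : matching N -> matching M ->
  Delta N M = (\sum_(e in N) wt M e.1 e.2) * 2 - #|lostA M N|%:Z - #|lostB M N|%:Z.
Proof.
move=> mN mM; rewrite /Delta !phi_sum -sumrB big_sumType /=.
under eq_bigr => a _ do rewrite voteA //.
under [X in _ + X]eq_bigr => b _ do rewrite voteB //.
rewrite !sumrB -!card_int.
rewrite -(sumA (fun a b => if (a, b) \in M then 0 else (pa M a b)%:Z * 2 - 1)) //.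
rewrite -(sumB (fun a b => if (a, b) \in M then 0 else (pb M b a)%:Z * 2 - 1)) //.
rewrite mulr_suml [RHS](_ : _ = \sum_(e in N) ((if (e.1, e.2) \in M then 0 else (pa M e.1 e.2)%:Z * 2 - 1) + (if (e.1, e.2) \in M then 0 else (pb M e.2 e.1)%:Z * 2 - 1)) - #|lostA M N|%:Z - #|lostB M N|%:Z); first by rewrite big_split /=; ring.
congr (_ - _ - _); apply: eq_bigr => -[a b] _ /=; rewrite /wt.
by case: ifP => // _; ring.
Qed.

Lemma DeltaC N M : Delta N M = - Delta M N.
Proof. by rewrite /Delta opprB. Qed.

End Popular.

(** * Certificates imply maximum cardinality and popularity *)

Section Certificate.
Variable G : instance.
Notation A := 'I_(nA G).
Notation B := 'I_(nB G).
Implicit Types (M N : {set edge G}) (a : A) (b : B) (l : A -> nat).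

(** Larger than the length of any simple path, so that a path starting at level 0 cannot overtake
    the unmatched nodes of A; also large enough for some level to be missed. *)
Definition top : nat := (nA G + nB G).+1.

Definition lvB M l b : nat := if mB M b is Some a then l a else 0.

(* Half of a dual solution of the linear program for max-matchings of maximum
   Delta( . , M): - l on A and lvB on B. *)
Definition certificate M l : Prop :=
  [/\ matching M, forall a, l a <= top, forall a, mA M a = None -> l a = top
    & forall a b, (a, b) \in edges G -> (wt M a b <= (lvB M l b)%:Z - (l a)%:Z)%R].

Lemma wt_ge M a b : (-1 <= wt M a b)%R.
Proof. by rewrite /wt; case: ifP => // _; case: pa; case: pb. Qed.

(** With [tau] missed by [l], the cover consists of the matched [a] below [tau] and of the partners
    of those above [tau]: exactly one end of every edge of [M]. *)
Lemma certificate_max M l : certificate M l ->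
  forall N, matching N -> #|N| <= #|M|.
Proof.
move=> [mM lT lN ce] N mN.
have [tau tT tau_gap] : exists2 tau, tau <= top & forall a, mA M a != None -> l a != tau.
  have [|no] := pselect (exists2 tau, tau <= top & forall a, l a != tau).
    by case=> t h1 h2; exists t.
  have : size (iota 0 top.+1) <= size (codom l).
    apply: uniq_leq_size; first exact: iota_uniq.
    move=> k; rewrite mem_iota /= add0n ltnS => kT.
    apply: contrapT => kl; apply: no; exists k => // a.
    by apply/eqP => e; apply: kl; rewrite -e codom_f.
  by rewrite size_iota size_codom card_ord /top; lia.
pose viaA (e : edge G) := (mA M e.1 != None) && (l e.1 < tau).
(* Weights are at least -1, so the level of [b] is at least [l a - 1], hence at least [tau], and
   [tau] itself is missed. An unmatched end makes the weight nonnegative and is settled by its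
   extreme level. *)
have viaB e : e \in N -> ~~ viaA e -> exists2 a, mB M e.2 = Some a & tau < l a.
  case: e => a b eN; rewrite /viaA /= => nv.
  have eE : (a, b) \in edges G by case: mN => /subsetP h _; apply: h.
  have := ce _ _ eE; have := wt_ge M a b; rewrite /lvB.
  have wA : mA M a = None -> (0 <= wt M a b)%R.
    move=> e; rewrite /wt -mAP // e /= /pa e; case: pb => //.
  have wB : mB M b = None -> (0 <= wt M a b)%R.
    move=> e; rewrite /wt -mBP // e /= /pb e; case: pa => //.
  case eB: (mB M b) => [a'|].
    have eA : mA M a' = Some b by apply/eqP; rewrite mAB // eB.
    move=> w1 w2; exists a' => //.
    have g' : l a' != tau by apply: tau_gap; rewrite eA.
    case eA2: (mA M a) => [b'|].
      have g : l a != tau by apply: tau_gap; rewrite eA2.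
      by move: nv; rewrite eA2 /=; lia.
    by have := wA eA2; have := lN _ eA2; have := lT a'; lia.
  move=> w1 w2; exfalso; have wB' := wB eB.
  have la : l a = 0 by lia.
  have eA : mA M a != None by apply/eqP => h; have := lN _ h; rewrite la.
  have := tau_gap _ eA; move: nv; rewrite eA la /=; lia.
pose f (e : edge G) : edge G :=
  if viaA e then (e.1, odflt e.2 (mA M e.1)) else (odflt e.1 (mB M e.2), e.2).
have fM e : e \in N -> f e \in M.
  move=> eN; rewrite /f; case: ifP => [/andP[]|/negbT/(viaB _ eN)[a ea _]].
    by case eA: (mA M e.1) => [b|//] _ _; rewrite -mAP // eA.
  by rewrite ea -mBP // ea.
(* The level of [f e] reveals at which end [e] was covered, so two edges of [N] with the same image
   share that end. *)
have l1 e : e \in N -> viaA e = (l (f e).1 < tau).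
  move=> eN; rewrite /f; case: (boolP (viaA e)) => [/andP[_ -> //]|/(viaB _ eN)[a -> /= h]].
  by apply/esym/negbTE; rewrite -leqNgt ltnW.
rewrite -(@card_in_imset _ _ f N); last first.
  move=> e e' eN e'N fe; have := l1 _ eN; rewrite fe -(l1 _ e'N) => vv.
  case: mN => _; apply=> //; move: fe; rewrite /f vv.
  by case: ifP => _ [] *; [left|right].
by apply/subset_leq_card/subsetP => _ /imsetP[e eN ->]; apply: fM.
Qed.

Lemma card_matching N : matching N -> #|N| = #|[set a | mA N a != None]|.
Proof.
move=> mN; have := sumA (fun _ _ => 1%N : nat) mN; rewrite sum1_card => ->.
rewrite -sum1dep_card [RHS]big_mkcond /=; apply: eq_bigr => a _.
by case: (mA N a).
Qed.

(** Weak duality. Unmatched [b] count 0, so the B-levels over [N] sum to at most the levels over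
    [M]. Both matchings leave equally many [a] unmatched, and those of [M] have the maximal level,
    so the A-levels over [N] sum to at least the levels over [M]. *)
Lemma certificate_popular M l : certificate M l -> popular_max_matching M.
Proof.
move=> ce; have mx := certificate_max ce; case: (ce) => mM lT lN cw.
split; first by split.
move=> N [mN mxN]; rewrite DeltaC Delta_wt //.
have cNM : #|N| = #|M| by apply/eqP; rewrite eqn_leq mx // mxN.
pose SA := \sum_(e in N) l e.1; pose SB := \sum_(e in N) lvB M l e.2.
have s1 : (\sum_(e in N) wt M e.1 e.2 <= SB%:Z - SA%:Z)%R.
  rewrite /SA /SB !(big_morph Posz PoszD erefl) -sumrB; apply: ler_sum => -[a b] eN.
  by apply: cw; case: mN => /subsetP h _; apply: h.
have s2 : SB <= \sum_(e in M) l e.1.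
  have -> : \sum_(e in M) l e.1 = \sum_b lvB M l b.
    have := sumB (fun a _ => l a) mM => /= ->.
    by apply: eq_bigr => b _; rewrite /lvB.
  rewrite /SB; have := sumB (fun _ b => lvB M l b) mN => /= ->.
  by apply: leq_sum => b _; case: (mB N b).
have split_sum N' : matching N' ->
    \sum_a l a = \sum_(e in N') l e.1 + \sum_(a | mA N' a == None) l a.
  move=> mN'; have := sumA (fun a _ => l a) mN' => /= ->.
  rewrite [X in (_ + X)%N]big_mkcond -big_split /=; apply: eq_bigr => a _.
  by case: (mA N' a) => [b|] /=; rewrite ?addn0 ?add0n.
have cN' N' : matching N' -> \sum_(a | mA N' a == None) top = (nA G - #|N'|) * top.
  move=> mN'; rewrite sum_nat_cond_const; congr (_ * _)%N.
  rewrite card_matching //; have := cardsC [set a | mA N' a != None].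
  rewrite card_ord (_ : ~: _ = [set a | mA N' a == None]); first by move: #|_| => k; lia.
  by apply/setP => a; rewrite !inE negbK.
have s3 : \sum_(e in M) l e.1 <= SA.
  have := split_sum M mM; rewrite (split_sum N mN).
  rewrite [X in _ = (_ + X)%N](eq_bigr (fun=> top)); last by move=> a /eqP /lN.
  rewrite cN' // -cNM -cN' //.
  have : \sum_(a | mA N a == None) l a <= \sum_(a | mA N a == None) top.
    by apply: leq_sum => a _.
  by rewrite -/SA; lia.
move: s1 s2 s3; move: (\sum_(e in M) l e.1) SA SB => S SA SB; lia.
Qed.

End Certificate.

Lemma map_next (T : eqType) (x : T) s : uniq (x :: s) ->
  [seq next (x :: s) u | u <- x :: s] = rcons s x.
Proof.
move=> un; apply: (@eq_from_nth _ x); first by rewrite size_map size_rcons.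
move=> i; rewrite size_map => si; rewrite (nth_map x) //.
rewrite next_nth mem_nth // index_uniq // nth_rcons.
case: ltnP => // h; rewrite nth_default //.
by have -> : i == size s; [move: si h; rewrite /=; lia|].
Qed.

(** * Levels of a popular matching from longest alternating paths *)

Section Popular_certificate.
Variable G : instance.
Notation A := 'I_(nA G).
Notation B := 'I_(nB G).
Variable M : {set edge G}.
Hypothesis popM : popular_max_matching M.
Let mM : matching M := popM.1.1.
Implicit Types (a : A) (b : B) (u v x : node G).

(* A node stands for the pair of a and its M-partner, or for an unmatched b; in
   a step from u to v, the A-end of u takes over the B-end of v. *)
Definition target v : option B :=
  match v with
  | inl a => mA M a
  | inr b => if mB M b is None then Some b else None
  end.

Definition step u v : bool :=
  match u, target v with
  | inl a, Some b => (a, b) \in edges G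
  | _, _ => false
  end.

Definition wstep u v : int :=
  match u, target v with
  | inl a, Some b => wt M a b
  | _, _ => 0%R
  end.

Definition base u : nat := if u is inl a then if mA M a is None then top G else 0 else 0.

Fixpoint walk x (s : seq (node G)) : int :=
  if s is y :: s' then (wstep x y + walk y s')%R else 0%R.

Lemma target_inj u v b : target u = Some b -> target v = Some b -> u = v.
Proof.
case: u v => [a|c] [a'|c'] /=.
- by move/eqP; rewrite mAB // => /eqP e /eqP; rewrite mAB // e => /eqP[->].
- by move/eqP; rewrite mAB // => /eqP e; case e': (mB M c') => // -[ec]; rewrite ec e in e'.
- by case e: (mB M c) => // -[ec] /eqP; rewrite mAB // -ec e.
- by case e: (mB M c) => // -[->]; case: (mB M c') => // -[->].
Qed.

Lemma wstep_le1 u v : (wstep u v <= 1)%R.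
Proof.
rewrite /wstep; case: u => // a; case: target => // b.
by rewrite /wt; case: ifP => // _; case: pa; case: pb.
Qed.

Lemma walk_le x s : (walk x s <= (size s)%:Z)%R.
Proof.
elim: s x => //= y s IH x; have := IH y; have := wstep_le1 x y; lia.
Qed.

Lemma walk_cat x s t : walk x (s ++ t) = (walk x s + walk (last x s) t)%R.
Proof. by elim: s x => [|y s IH] x /=; rewrite ?add0r // IH addrA. Qed.

Section Rewire.
Variables (x : node G) (s : seq (node G)).
Hypothesis us : uniq (x :: s).
Hypothesis ps : path step x s.
Hypothesis close : forall a b, last x s = inl a -> target x = Some b -> (a, b) \in edges G.

Let F u := next (x :: s) u.

(** The targets are shifted cyclically along [x :: s] and fixed elsewhere. This treats cycles and
    paths alike: on a path, the closing step from the last node back to [x] carries no edge when [x]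
    has no target or the last node is in B. *)
Definition rewired : {set edge G} :=
  [set e : edge G | target (F (inl e.1)) == Some e.2].

Lemma F_inj : injective F.
Proof.
by move=> u v e; rewrite -(prev_next us u) -(prev_next us v) -/(F u) e.
Qed.

Lemma F_out u : u \notin x :: s -> F u = u.
Proof. by move=> h; rewrite /F next_nth (negbTE h). Qed.

Lemma F_in u : u \in x :: s -> step u (F u) \/ (u = last x s /\ F u = x).
Proof.
rewrite /F => hu; have [i isz ui] : exists2 i, i < size (x :: s) & nth x (x :: s) i = u.
  by exists (index u (x :: s)); rewrite ?index_mem ?nth_index.
have Fu : next (x :: s) u = nth x s i.
  by rewrite next_nth hu -ui index_uniq.
rewrite Fu -ui; case: (ltnP i (size s)) => h.
  by left; move/(pathP x): ps; apply.
right; have -> : i = size s by move: isz h => /=; lia.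
by split; [rewrite (last_nth x)|rewrite nth_default].
Qed.

Lemma in_target v : v \in s -> target v != None.
Proof.
move: ps; elim: (s) (x) => //= y s' IH x' /andP[st ps'].
rewrite inE => /orP[/eqP->|]; last exact: IH ps'.
by move: st; rewrite /step; case: (x') => // a; case: (target y).
Qed.

Lemma rewired_edges a b : target (F (inl a)) = Some b -> (a, b) \in edges G.
Proof.
case: (boolP (inl a \in x :: s)) => [/F_in[|[e ->]]|/F_out->] /=.
- by rewrite /step => st e; move: st; rewrite e.
- by apply: close.
- by move/eqP; rewrite mAP //; case: mM => /subsetP h _; apply: h.
Qed.

Lemma rewired_matching : matching rewired.
Proof.
split; first by apply/subsetP => -[a b]; rewrite inE => /eqP; apply: rewired_edges.
move=> [a b] [a' b']; rewrite !inE /= => /eqP e /eqP e' [h|h].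
  by move: e; rewrite h e' => -[->].
by move: e; rewrite h => e; have [->] : inl a = inl a' :> node G
  by apply/F_inj/(target_inj e).
Qed.

Let mN := rewired_matching.

Lemma mA_rewired a : mA rewired a = target (F (inl a)).
Proof.
case e: (target (F (inl a))) => [b|].
  by apply/eqP; rewrite mAP // inE e.
case e': (mA rewired a) => [b|//].
by move/eqP: e'; rewrite mAP // inE e.
Qed.


Lemma inr_target b : target (F (inr b)) != None -> x != inr b -> mB M b = None.
Proof.
case: (boolP (inr b \in x :: s)) => [|/F_out-> /=]; last by case: (mB M b).
rewrite inE => /orP[/eqP<-|bs]; first by rewrite eqxx.
by move: (in_target bs) => /=; case: (mB M b).
Qed.

(** [F] permutes the nodes, so as many nodes receive a target after the shift as before. *)
Lemma card_rewired : #|rewired| + #|[set b | target (F (inr b)) != None]| =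
  #|M| + #|[set b | mB M b == None]|.
Proof.
have sumt (f : node G -> node G) :
    #|[set u | target (f u) != None]| = #|[set a | target (f (inl a)) != None]|
      + #|[set b | target (f (inr b)) != None]|.
  by rewrite -!sum1dep_card !(big_mkcond (fun _ => _ != None)) big_sumType.
have -> : #|M| = #|[set a | target (inl a) != None]| by apply: card_matching.
have -> : #|rewired| = #|[set a | target (F (inl a)) != None]|.
  by rewrite card_matching //; apply: eq_card => a; rewrite !inE mA_rewired.
have -> : #|[set b | mB M b == None]| = #|[set b | target (inr b) != None]|.
  by apply: eq_card => b; rewrite !inE /=; case: (mB M b).
rewrite -(sumt F) -(sumt id) -(card_imset _ F_inj) /=.
apply: eq_card => v; rewrite inE /=; apply/imsetP/idP => [[u]|h].
  by rewrite inE => ? ->.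
by exists (prev (x :: s) v); rewrite ?inE /F next_prev.
Qed.

Lemma rewired_walk : (\sum_(e in rewired) wt M e.1 e.2 =
  walk x s + wstep (last x s) x)%R.
Proof.
have -> : (\sum_(e in rewired) wt M e.1 e.2 = \sum_u wstep u (F u))%R.
  rewrite sumA // big_sumType /= [X in (_ + X)%R]big1 ?addr0 //.
  by apply: eq_bigr => a _; rewrite mA_rewired.
rewrite (bigID (mem (x :: s))) /= [X in (_ + X)%R]big1 ?addr0; last first.
  move=> u /F_out ->; rewrite /wstep; case: u => //= a.
  by case e: (mA M a) => [b|//]; rewrite /wt -mAP // e eqxx.
rewrite -big_uniq //=.
have -> : (\sum_(u <- x :: s) wstep u (F u) =
    \sum_(p <- zip (x :: s) (rcons s x)) wstep p.1 p.2)%R.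
  rewrite -(map_next us) -/F; elim: (x :: s) => [|y s' IH]; first by rewrite !big_nil.
  by rewrite /= !big_cons IH.
suff H s' y z : (\sum_(p <- zip (y :: s') (rcons s' z)) wstep p.1 p.2 =
    walk y s' + wstep (last y s') z)%R by apply: H.
elim: s' y => [|y' s' IH] y /=; first by rewrite big_cons big_nil addr0 add0r.
by rewrite big_cons IH addrA.
Qed.

Hypothesis x_end : forall b, x = inr b -> mB M b = None.

Lemma inr_subset : [set b | target (F (inr b)) != None] \subset [set b | mB M b == None].
Proof.
apply/subsetP => b; rewrite !inE => h; apply/eqP.
case: (eqVneq x (inr b)) => xb; [exact: x_end | exact: inr_target h xb].
Qed.

Lemma rewired_max : max_matching rewired.
Proof.
split=> // N' mN'; apply: leq_trans (popM.1.2 _ mN') _.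
by have := card_rewired; have := subset_leq_card inr_subset; lia.
Qed.

(* The swap costs at most one vote of a node that loses its partner, and the
   weights are counted twice, so the weight of the swap itself is at most 0. *)
Lemma rewired_le0 : (walk x s + wstep (last x s) x <= 0)%R.
Proof.
have := popM.2 _ rewired_max; rewrite DeltaC Delta_wt // rewired_walk.
suff : #|lostA M rewired| + #|lostB M rewired| <= 1 by lia.
(* If [x] has a target, only that target can lose its partner; otherwise only the node of A that [F]
   sends to [x] can. *)
case tx: (target x) => [bx|].
  have -> : lostA M rewired = set0.
    apply/setP => a; rewrite !inE mA_rewired; apply/negbTE.
    case: (boolP (inl a \in x :: s)) => [h|/F_out-> /=]; last by case: (mA M a).
    case: (F_in h) => [|[_ ->]]; last by rewrite tx andbF.
    move=> st; apply/negP => /andP[_ /eqP e]; by move: st; rewrite /step e.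
  rewrite cards0 add0n; apply: (@leq_trans #|[set bx]|); last by rewrite cards1.
  apply/subset_leq_card/subsetP => b; rewrite !inE => /andP[].
  case eb: (mB M b) => [a|//] _ /eqP nb.
  have ta : target (inl a) = Some b by apply/eqP; rewrite /= mAB // eb.
  pose u := prev (x :: s) (inl a).
  have Fu : F u = inl a by rewrite /F next_prev.
  have : u \in x :: s.
    apply: contraT => /F_out ua; move: nb; rewrite -Fu ua in ta.
    have uu : u = inl a by rewrite -ua.
    have : mA rewired a = Some b by rewrite mA_rewired -uu ua.
    by move/eqP; rewrite mAB // => /eqP ->.
  case: u Fu => [a'|b'] Fu h.
    have : mA rewired a' = Some b by rewrite mA_rewired Fu.
    by move/eqP; rewrite mAB // nb.
  by case: (F_in h) => [//|[_ Fx]]; move: tx; rewrite -Fx Fu ta => -[->].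
have -> : lostB M rewired = set0.
  apply/setP => b; rewrite !inE; apply/negbTE/negP => /andP[].
  case eb: (mB M b) => [a|//] _ /eqP nb.
  have ta : target (inl a) = Some b by apply/eqP; rewrite /= mAB // eb.
  pose u := prev (x :: s) (inl a).
  have Fu : F u = inl a by rewrite /F next_prev.
  case: (boolP (u \in x :: s)) => [h|/F_out ua]; last first.
    have uu : u = inl a by rewrite -ua.
    have : mA rewired a = Some b by rewrite mA_rewired -uu ua uu.
    by move/eqP; rewrite mAB // nb.
  case: u Fu h => [a'|b'] Fu h.
    have : mA rewired a' = Some b by rewrite mA_rewired Fu.
    by move/eqP; rewrite mAB // nb.
  by case: (F_in h) => [//|[_ Fx]]; move: tx; rewrite -Fx Fu ta.
rewrite cards0 addn0.
case: (pickP (mem (lostA M rewired))) => [a0 h0|none]; last first.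
  by rewrite (_ : #|_| = 0) //; apply: eq_card0.
apply: (@leq_trans #|[set a0]|); last by rewrite cards1.
have Fx a : a \in lostA M rewired -> F (inl a) = x.
  rewrite inE mA_rewired => /andP[h1 h2].
  case: (boolP (inl a \in x :: s)) => [h|/F_out e]; last by move: h2 h1; rewrite e /= => ->.
  by case: (F_in h) => [|[_ ->//]]; rewrite /step; case: (target (F (inl a))) h2.
apply/subset_leq_card/subsetP => a ha; rewrite inE.
by apply/eqP; have [] : inl a = inl a0 :> node G by apply: F_inj; rewrite !Fx.
Qed.

(** A path from a node without target to an unmatched [b] is augmenting: [b] passes its target on
    and receives none, so the rewired matching would be larger than [M]. *)
Lemma no_augmenting b : last x s = inr b -> x != inr b -> target x != None.
Proof.
move=> lb xb; apply/eqP => tx.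
have bs : inr b \in s by move: xb; rewrite -lb; case: (s) => [|y s'] /=; rewrite ?eqxx // mem_last.
have : [set b | target (F (inr b)) != None] \proper [set b | mB M b == None].
  apply/properP; split; first exact: inr_subset.
  exists b; rewrite !inE.
    by move: (in_target bs) => /=; case: (mB M b).
  have hb : inr b \in x :: s by rewrite inE bs orbT.
  by case: (F_in hb) => [//|[_ ->]]; rewrite tx.
move/proper_card; have := card_rewired; have := popM.1.2 _ mN; lia.
Qed.

End Rewire.

Lemma inr_path b s : path step (inr b) s -> s = [::].
Proof. by case: s. Qed.

Lemma step_inr u b : step u (inr b) -> mB M b = None.
Proof. by rewrite /step /=; case: u => // a; case: (mB M b). Qed.

Lemma cycle_le0 x s : uniq (x :: s) -> path step x s -> step (last x s) x ->
  (walk x s + wstep (last x s) x <= 0)%R.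
Proof.
move=> us ps cl; apply: rewired_le0 => //.
  by move=> a b e tx; move: cl; rewrite e /step tx.
by move=> b xb; move: cl; rewrite {2}xb; apply: step_inr.
Qed.

Lemma unmatched_start_le0 a s : mA M a = None -> uniq (inl a :: s) ->
  path step (inl a) s -> (walk (inl a) s <= 0)%R.
Proof.
move=> ea us ps; have := @rewired_le0 (inl a) s us ps.
have -> : wstep (last (inl a) s) (inl a) = 0%R.
  by rewrite /wstep /= ea; case: (last _ _).
by rewrite addr0; apply=> //= a' b' _; rewrite ea.
Qed.

(** This is what gives an unmatched [b] level 0: its paths cannot start at an unmatched node of A,
    so their base is 0, and rewiring along them gains nothing. *)
Lemma sink_le0 x s b : uniq (x :: s) -> path step x s -> last x s = inr b ->
  mB M b = None -> ((base x)%:Z + walk x s <= 0)%R.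
Proof.
move=> us ps ls eb; case: (eqVneq x (inr b)) => [xb|xb].
  by move: ps; rewrite xb => /inr_path ->.
have cl a b' : last x s = inl a -> target x = Some b' -> (a, b') \in edges G by rewrite ls.
have xe b' : x = inr b' -> mB M b' = None.
  by move=> e; move: ps ls; rewrite e => /inr_path -> /= -[->].
have tx := no_augmenting us ps cl xe ls xb.
have -> : base x = 0 by move: tx; rewrite /base; case: (x) => //= a; case: (mA M a).
have := rewired_le0 us ps cl xe; rewrite ls.
by have -> : wstep (inr b) x = 0%R by []; rewrite addr0 add0r.
Qed.

Definition reach u (k : int) : Prop := exists x s,
  [/\ uniq (x :: s), path step x s, last x s = u & ((base x)%:Z + walk x s = k)%R].

Lemma reach_top u k : reach u k -> (k <= (top G)%:Z)%R.
Proof.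
move=> [x [s [us ps ls <-]]].
have sz : size s < nA G + nB G.
  have := max_card (mem (x :: s)); rewrite (card_uniqP us) card_sum !card_ord; exact.
have := walk_le x s; rewrite /base; case: x us ps ls => [a|b] us ps ls.
  case ea: (mA M a) => [b|]; rewrite /top; first by lia.
  by rewrite gerDl => _; apply: unmatched_start_le0 ps.
by rewrite /top; lia.
Qed.

Lemma reach_base u : reach u (base u)%:Z.
Proof. by exists u, [::]; split; rewrite //= addr0. Qed.

Lemma reach_ex u : exists k : nat, `[< reach u k%:Z >].
Proof. by exists (base u); apply/asboolP; apply: reach_base. Qed.

Lemma reach_bound u (k : nat) : `[< reach u k%:Z >] -> k <= top G.
Proof. by move/asboolP/reach_top. Qed.

Definition level u : nat := ex_maxn (reach_ex u) (@reach_bound u).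

Lemma level_reach u : reach u (level u)%:Z.
Proof. by rewrite /level; case: ex_maxnP => k /asboolP. Qed.

Lemma reach_le u k : reach u k -> (k <= (level u)%:Z)%R.
Proof.
rewrite /level; case: ex_maxnP => m _ h; case: k => // k rk.
by have /h : `[< reach u k%:Z >] by apply/asboolP.
Qed.

(** A heaviest path to [u] extends to [v] unless it already visits [v]. In that case the part from
    [v] to [u] and the step back form a cycle of weight at most 0, and cutting it off leaves a path
    to [v] that is heavy enough. *)
Lemma level_step u v : step u v -> ((level u)%:Z + wstep u v <= (level v)%:Z)%R.
Proof.
move=> st; have [x [s [us ps ls vs]]] := level_reach u.
case: (boolP (v \in x :: s)) => [vin|vout]; last first.
  apply: reach_le; exists x, (rcons s v); split.
  - by rewrite -rcons_cons rcons_uniq vout.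
  - by rewrite rcons_path ps ls.
  - by rewrite last_rcons.
  - by rewrite -vs -cats1 walk_cat ls /= addr0 addrA.
case/splitPl: vin us ps ls vs => s1 s2 l1; rewrite -cat_cons cat_uniq cat_path.
move=> /and3P[u1 dis u2] /andP[p1 p2]; rewrite last_cat walk_cat l1 in p2 * => l2 vs.
have u2' : uniq (v :: s2).
  rewrite /= u2 andbT; apply: contra dis => vs2; apply/hasP; exists v => //=.
  by rewrite -l1 mem_last.
have st' : step (last v s2) v by rewrite l2.
have := cycle_le0 u2' p2 st'; rewrite l2.
have : reach v ((base x)%:Z + walk x s1)%R by exists x, s1.
by move/reach_le; lia.
Qed.

Lemma popular_certificate : exists l, certificate M l.
Proof.
exists (fun a => level (inl a)); split=> //.
- by move=> a; have := reach_top (level_reach (inl a)).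
- move=> a ea; have := reach_top (level_reach (inl a)).
  by have := reach_le (reach_base (inl a)); rewrite /= ea; lia.
move=> a b eab.
have [v tv vl] : exists2 v, target v = Some b &
    level v = lvB M (fun a => level (inl a)) b.
  rewrite /lvB; case eb: (mB M b) => [a'|].
    by exists (inl a') => //=; apply/eqP; rewrite mAB // eb.
  exists (inr b); first by rewrite /= eb.
  have [x [s [us ps ls vs]]] := level_reach (inr b).
  by have := sink_le0 us ps ls eb; rewrite vs; lia.
have st : step (inl a) v by rewrite /step tv.
by have := level_step st; rewrite vl /wstep tv; lia.
Qed.

End Popular_certificate.

(** * Level certificates as stable proposal vectors *)

Section Levels.
Variable G : instance.
Notation A := 'I_(nA G).
Notation B := 'I_(nB G).
Implicit Types (M : {set edge G}) (a : A) (b : B) (p : nat -> nat) (l : A -> nat).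

Definition levels : nat := (top G).+1.
Notation n := levels.
Definition positions : nat := n * n.
Notation K := positions.

(* Position k stands for level k %/ n and rank k %% n: a man goes through his
   list once per level, and women prefer proposals of higher levels. *)
Definition woman_at (a k : nat) : nat :=
  if k %% n < input_ints G 1 a 0 then input_ints G 2 a (k %% n) else n.

Definition rank_of (b a : nat) : nat :=
  oapp (fun b' => index a (map val (prefB b'))) 0 (insub b : option B).

(** Adding [k %% n] and subtracting [k] takes off [n] times the level. The result orders proposals
    by decreasing level and then by rank, without a multiplication. *)
Definition score_at (a k : nat) : nat := K + k %% n + rank_of (woman_at a k) a - k.

Lemma woman_atE a k : woman_at a k =
  if k %% n < size (prefA a) then nth 0 (map val (prefA a)) (k %% n) else n.
Proof. by rewrite /woman_at /= valK /= muln1. Qed.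

Lemma woman_at_out (a k : nat) : nA G <= a -> woman_at a k = n.
Proof. by move=> h; rewrite /woman_at /= insubF // ltnNge h. Qed.

Lemma woman_atP a b k : woman_at a k = b <-> (a, b) \in edges G /\ k %% n = ra a b.
Proof.
rewrite woman_atE -prefA_edges; split.
  case: ltnP => [h|_ e]; last by have := ltn_ord b; rewrite -e /n /top; lia.
  rewrite (nth_map b) // => /val_inj e; split; first by rewrite -e mem_nth.
  by rewrite /ra -e index_uniq // prefA_uniq.
move=> [h e]; rewrite e /ra index_mem h (nth_map b) ?index_mem //.
by rewrite nth_index.
Qed.

Lemma woman_at_lt (a k : nat) : woman_at a k < n -> exists (a' : A) (b : B),
  [/\ a = a', woman_at a' k = b & (a', b) \in edges G].
Proof.
move=> lt; have [h|h] := ltnP a (nA G); last by move: lt; rewrite woman_at_out ?ltnn.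
pose a' := Ordinal h; rewrite -[a]/(val a') in lt *.
move: (lt); rewrite woman_atE; case: (ltnP (k %% n) (size (prefA a'))) => [hs _|]; last by rewrite ltnn.
have [b0 b0in] : exists b, b \in prefA a'.
  by case: (prefA a') hs => // b s _; exists b; rewrite inE eqxx.
exists a', (nth b0 (prefA a') (k %% n)); split=> //.
  by rewrite woman_atE hs (nth_map b0).
by rewrite -prefA_edges mem_nth.
Qed.

Lemma size_prefA a : size (prefA a) <= nB G.
Proof. by have := max_card (mem (prefA a)); rewrite (card_uniqP (prefA_uniq a)) card_ord. Qed.

Lemma size_prefB b : size (prefB b) <= nA G.
Proof. by have := max_card (mem (prefB b)); rewrite (card_uniqP (prefB_uniq b)) card_ord. Qed.

Lemma ra_lt a b : (a, b) \in edges G -> ra a b < n.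
Proof.
rewrite -prefA_edges -index_mem => h; apply: (leq_trans h).
by apply: (leq_trans (size_prefA a)); rewrite /n /top; lia.
Qed.

Lemma rb_lt a b : (a, b) \in edges G -> rb b a < n.
Proof.
rewrite -prefB_edges -index_mem => h; apply: (leq_trans h).
by apply: (leq_trans (size_prefB b)); rewrite /n /top; lia.
Qed.

Lemma last_div : K.-1 %/ n = n.-1 /\ K.-1 %% n = n.-1.
Proof.
have -> : K.-1 = n.-1 * n + n.-1 by rewrite /K /n; nia.
by rewrite modnMDl modn_small // divnMDl // divn_small // addn0.
Qed.

Lemma woman_last (a : nat) : a < n -> woman_at a K.-1 = n.
Proof.
move=> _; have [h|h] := ltnP a (nA G); last exact: woman_at_out.
rewrite -[a]/(val (Ordinal h)) woman_atE (last_div.2) ifF //.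
by have := size_prefA (Ordinal h); rewrite /n /top; lia.
Qed.

Lemma scoreE a b k : woman_at a k = b -> k < K ->
  score_at a k = (n - k %/ n) * n + rb b a.
Proof.
move=> e kK; rewrite /score_at e /rank_of valK /=.
rewrite (index_map val_inj) -/(rb b a); have ek := divn_eq k n.
have xn : k %/ n < n by rewrite ltn_divLR.
have := leq_mul (ltnW xn) (leqnn n); rewrite mulnBl /K.
move: ek; move: (k %/ n * n) (k %% n) (rb b a) (n * n) => x y z t; lia.
Qed.

Lemma digits_inj x r x' r' : r < n -> r' < n -> x * n + r = x' * n + r' ->
  x = x' /\ r = r'.
Proof.
move=> h h' e; split.
  by have := congr1 (divn^~ n) e; rewrite !divnMDl // (divn_small h) (divn_small h') !addn0.
by have := congr1 (modn^~ n) e; rewrite !modnMDl (modn_small h) (modn_small h').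
Qed.

Lemma score_inj (a a' k k' : nat) : a < n -> a' < n -> k < K -> k' < K ->
  woman_at a k < n -> woman_at a k = woman_at a' k' ->
  score_at a k = score_at a' k' -> a = a' /\ k = k'.
Proof.
move=> _ _ kK k'K lt eW; have lt' := lt; rewrite eW in lt'.
have [x [b [ax eb xb]]] := woman_at_lt lt; have [x' [b' [ax' eb' xb']]] := woman_at_lt lt'.
rewrite ax ax' in eW *; have bb : b = b' by apply: ord_inj; rewrite -eb -eb'.
rewrite -bb in eb' xb'; rewrite (scoreE eb kK) (scoreE eb' k'K) => es.
have h : k %/ n < n by rewrite ltn_divLR.
have h' : k' %/ n < n by rewrite ltn_divLR.
have r := rb_lt xb; have r' := rb_lt xb'.
have [dk rr] : n - k %/ n = n - k' %/ n /\ rb b x = rb b x'.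
  exact: digits_inj.
have xx := rb_inj xb xb' rr; split; first by rewrite xx.
have [_ m1] := (woman_atP x b k).1 eb; have [_ m2] := (woman_atP x' b k').1 eb'.
by rewrite (divn_eq k n) (divn_eq k' n) m1 m2 xx; congr (_ * _ + _); lia.
Qed.

Notation stableG := (stable n K woman_at score_at).

Definition vector_matching p : {set edge G} :=
  [set e : edge G | woman_at e.1 (p e.1) == e.2 :> nat].

Lemma ordA_lt a : a < n. Proof. by have := ltn_ord a; rewrite /n /top; lia. Qed.
Lemma ordB_lt b : b < n. Proof. by have := ltn_ord b; rewrite /n /top; lia. Qed.

Lemma vector_matchingP p : stableG p -> matching (vector_matching p).
Proof.
move=> [st _]; split.
  by apply/subsetP => -[a b]; rewrite inE => /eqP /woman_atP[].
move=> [a b] [a' b']; rewrite !inE /= => /eqP e /eqP e' [h|h].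
  by congr pair => //; apply: ord_inj; rewrite -e -e' h.
congr pair => //; apply: ord_inj.
apply: (settled_inj woman_last score_inj st); rewrite ?ordA_lt ?e ?e' ?h //.
exact: ordB_lt.
Qed.

(** If [a] prefers [b] to his partner, he has proposed to her at his own level; in any case he has
    done so at the level below. Stability then bounds the level of her holder from below, with the
    rank deciding ties. *)
Lemma stable_certificate p : stableG p ->
  certificate (vector_matching p) (fun a => p a %/ n).
Proof.
move=> sp; have mM := vector_matchingP sp; set M := vector_matching p in mM *.
have pK a : p a < K by case: (sp.1 a (ordA_lt a)).
have inM a b : (a, b) \in M = (woman_at a (p a) == b :> nat) by rewrite inE.
have unm a : mA M a = None -> p a = K.-1.
  move=> e; case: (ltnP (woman_at a (p a)) n) => [/woman_at_lt[a' [b [/ord_inj aa ew _]]]|].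
    by move/eqP: ew; rewrite -aa -inM -mAP // e.
  rewrite leqNgt (settled_matched woman_last sp.1 (ordA_lt a)) => h.
  by have := pK a; lia.
split=> //.
- by move=> a; rewrite -ltnS -/n ltn_divLR.
- by move=> a /unm ->; rewrite last_div.1.
move=> a b eab.
have fact j : j < n -> j * n + ra a b <= p a ->
    exists2 a1, mB M b = Some a1 &
      (j < p a1 %/ n) || ((p a1 %/ n == j) && (rb b a1 <= rb b a)).
  move=> jn le; have r := ra_lt eab.
  have ew : woman_at a (j * n + ra a b) = b.
    by apply/woman_atP; rewrite modnMDl modn_small.
  have lt : woman_at a (j * n + ra a b) < n by rewrite ew ordB_lt.
  have [x [xn ex sc]] := stable_best woman_last sp (ordA_lt a) le lt.
  have [a1 [b1 [xa ea1 ab1]]] : exists a1 b1, [/\ x = val (a1 : A),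
      woman_at a1 (p x) = val (b1 : B) & (a1, b1) \in edges G].
    by apply: woman_at_lt; rewrite ex.
  rewrite xa in ex sc ea1; rewrite ew in ex.
  exists a1; first by apply/eqP; rewrite mBP // inM ex.
  have kK : j * n + ra a b < K by apply: leq_ltn_trans le _.
  move: sc; rewrite (scoreE ex (pK a1)) (scoreE ew kK) divnMDl // (divn_small r) addn0.
  have h : p a1 %/ n < n by rewrite ltn_divLR.
  have eb1 : (a1, b) \in edges G by case/woman_atP: ex.
  have := rb_lt eab; have := rb_lt eb1; move: (p a1 %/ n) h => y yn.
  case: (ltngtP j y) => //= [yj|->]; last by rewrite leq_add2l.
  have : (n - y) * n >= (n - j).+1 * n by rewrite leq_mul2r; apply/orP; right; lia.
  by rewrite mulSn; lia.
have lpa : p a %/ n < n by rewrite ltn_divLR.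
rewrite /wt /lvB inM; case: ifP => [e|ne].
  have -> : mB M b = Some a by apply/eqP; rewrite mBP // inM.
  by rewrite subrr.
have hpa : pa M a b -> p a %/ n * n + ra a b <= p a.
  rewrite /pa; case e: (mA M a) => [b'|] h.
    move/eqP: e; rewrite mAP // inM => /eqP /woman_atP[_ e'].
    by rewrite {2}(divn_eq (p a) n) leq_add2l e' ltnW.
  rewrite (unm _ e) last_div.1 [leqRHS](_ : _ = n.-1 * n + n.-1).
    by rewrite leq_add2l -ltnS; apply: ra_lt.
  by rewrite /K /n; nia.
case: (boolP (pa M a b)) => /= [/hpa le|_].
  have [a1 e1 h1] := fact _ lpa le; rewrite e1 /pb e1.
  by case: ltnP => h2; lia.
(* At level 0 there is no earlier round, but a weight without the vote of [a] is at most 0. *)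
case l0: (p a %/ n) => [|j].
  by case: (mB M b) => [y|]; case: pb => //=; move: (p y %/ n) => z; lia.
have le : j * n + ra a b <= p a.
  rewrite (divn_eq (p a) n) l0 mulSn; have := ra_lt eab; lia.
have [|a1 e1 h1] := fact j _ le; first by lia.
by rewrite e1 /pb e1; case: ltnP => h2; lia.
Qed.

(** Men are numbered up to [n]; the numbers from [nA G] on have no neighbours and are parked at the
    last position, as are unmatched men. *)
Definition certificate_vector M l (a : nat) : nat :=
  oapp (fun a' : A => l a' * n + (if mA M a' is Some b then ra a' b else n.-1))
       K.-1 (insub a).

Lemma certificate_stable M l : certificate M l ->
  stableG (certificate_vector M l) /\ vector_matching (certificate_vector M l) = M.
Proof.
move=> [mM lT lN ce]; set p := certificate_vector M l.
have Mab a b : mA M a = Some b -> (a, b) \in edges G.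
  by move/eqP; rewrite mAP //; case: mM => /subsetP h _; apply: h.
have pE a : p a = l a * n + (if mA M a is Some b then ra a b else n.-1).
  by rewrite /p /certificate_vector valK.
have rem a : (if mA M a is Some b then ra a b else n.-1) < n.
  by case e: (mA M a) => [b|//]; apply/ra_lt/Mab.
have pdiv a : p a %/ n = l a by rewrite pE divnMDl // divn_small ?addn0.
have pN a : mA M a = None -> p a = K.-1.
  by move=> e; rewrite pE e (lN _ e) /K /n; nia.
have ln a : l a < n by rewrite ltnS.
have pK a : p a < K by rewrite -ltn_divLR // pdiv.
have pw a : woman_at a (p a) = if mA M a is Some b then val b else n.
  case e: (mA M a) => [b|]; last by rewrite pN // woman_last // ordA_lt.
  apply/woman_atP; split; first exact: Mab.
  by rewrite pE e modnMDl modn_small // ra_lt // Mab.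
have vM : vector_matching p = M.
  apply/setP => -[a b]; rewrite inE /= pw -mAP //.
  case: (mA M a) => [b'|]; first by [].
  by apply/negbTE; rewrite neq_ltn ordB_lt orbT.
have pout (a : nat) : nA G <= a -> p a = K.-1.
  by move=> h; rewrite /p /certificate_vector insubF // ltnNge h.
split=> //; split.
  move=> a an; have [h|h] := ltnP a (nA G); last first.
    by rewrite /rejected pout //; split=> [|[]]; [rewrite /K /n; nia|rewrite ltnn].
  suff H (x : A) : p x < K /\ ~ rejected n K woman_at score_at p x by exact: (H (Ordinal h)).
  move=> {a an h}; rename x into a; split=> // -[ltK]; rewrite pw.
  case e: (mA M a) => [b|]; last by move: ltK; rewrite pN // ltnn.
  case=> [|[a' [k' [a'n k'p ew lW]]]]; first by rewrite leqNgt ordB_lt.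
  have [x [b' [xa xw xe]]] : exists (x : A) (b' : B), [/\ a' = x, woman_at x k' = b'
      & (x, b') \in edges G].
    by apply: woman_at_lt; rewrite ew ordB_lt.
  rewrite xa in ew lW k'p; have bb : b' = b by apply: ord_inj; rewrite -xw -ew.
  rewrite {}bb in xw xe.
  have k'K : k' < K by apply: leq_ltn_trans k'p _.
  have aw : woman_at a (p a) = b by rewrite pw e.
  have eb : mB M b = Some a by apply/eqP; rewrite -mAB // e.
  have := ce _ _ xe; rewrite /lvB eb.
  move: lW; rewrite (scoreE xw k'K) (scoreE aw (pK a)) pdiv => lW.
  have jl : k' %/ n <= l x by rewrite -(pdiv x) leq_div2r.
  have hj : k' %/ n < n by rewrite ltn_divLR.
  have r1 := rb_lt xe; have r2 := rb_lt (Mab _ _ e).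
  (* Decodes the score: the rejecting proposal has a higher level than [a], or the same level and a
     better rank. *)
  have cmp : (l a < k' %/ n) || ((l a == k' %/ n) && (rb b x < rb b a)).
    move: lW; have := ln a; move: (k' %/ n) hj (l a) => y yn z zn.
    case: (ltngtP z y) => //= [yz|->]; last by rewrite ltn_add2l.
    have : (n - y) * n >= (n - z).+1 * n by rewrite leq_mul2r; apply/orP; right; lia.
    by rewrite mulSn; lia.
  rewrite /wt; case: ifP => [xM|xM].
    have xa' : x = a by move: xM; rewrite -mBP // eb => /eqP[].
    by rewrite xa' ltnn andbF orbF in cmp jl *; lia.
  (* Within his current level, [x] has only reached ranks up to that of his partner. *)
  have hpa : k' %/ n = l x -> pa M x b.
    move=> ej; have [_ rk] := (woman_atP x b k').1 xw.
    move: k'p; rewrite (divn_eq k' n) ej rk pE leq_add2l /pa.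
    case ex: (mA M x) => [b2|//] le; rewrite ltn_neqAle le andbT.
    apply/eqP => /(ra_inj xe (Mab _ _ ex)) b2b.
    by move: xM; rewrite -mAP // ex b2b eqxx.
  rewrite /pb eb; case: (boolP (pa M x b)) => pab.
    move: cmp jl; move: (k' %/ n) => j.
    by case: (ltnP (rb b x)) => h; rewrite ?andbF ?andbT /=; lia.
  have : k' %/ n != l x by apply/eqP => /hpa; rewrite (negbTE pab).
  move: cmp jl; move: (k' %/ n) => j.
  by case: (ltnP (rb b x)) => h; rewrite ?andbF ?andbT /=; lia.
move=> a k an kp lt; have [x [b [ax xw xe]]] := woman_at_lt lt.
rewrite ax in kp *; rewrite xw.
case eb: (mB M b) => [a1|].
  exists (val a1); first exact: ordA_lt.
  by rewrite pw; move/eqP: eb; rewrite -mAB // => /eqP ->.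
(* An unmatched woman votes for [x], so the certificate forces [l x = 0] and that [x] does not
   prefer her; then he has not proposed to her yet. *)
exfalso; have := ce _ _ xe; rewrite /lvB eb /wt -mBP // eb /= /pb eb.
case: (boolP (pa M x b)) => hpa; first by lia.
move=> h; have lx : l x = 0 by lia.
move: hpa; rewrite /pa; case ex: (mA M x) => [b'|//]; rewrite -leqNgt => le.
have [_ rk] := (woman_atP x b k).1 xw.
move: kp; rewrite pE ex lx mul0n add0n => kp.
have kr : k = ra x b by rewrite -rk modn_small // (leq_ltn_trans kp) // ra_lt // Mab.
have bb : b = b' by apply: (ra_inj xe (Mab _ _ ex)); apply/eqP; rewrite eqn_leq le -kr kp.
by move: ex; rewrite -bb => /eqP; rewrite mAB // eb.
Qed.

Section Cost.
Local Open Scope ring_scope.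
Variables (R : realType) (c : edge G -> R).

Definition cost_at (a k : nat) : R :=
  if (woman_at a k < n)%N then input_reals c 0 a (woman_at a k) else 0.

Lemma vcost_cost p : stableG p -> vcost n cost_at p = cost c (vector_matching p).
Proof.
move=> sp; have mM := vector_matchingP sp.
rewrite /vcost /cost (eq_bigr (fun e : edge G => c (e.1, e.2))); last by case.
rewrite (sumA (fun a b => c (a, b))) //.
rewrite (bigID (fun a : 'I_n => (a < nA G)%N)) /= [X in _ + X]big1 ?addr0; last first.
  by move=> a; rewrite -leqNgt => h; rewrite /cost_at woman_at_out // ltnn.
rewrite -(big_ord_widen n (fun a : nat => cost_at a (p a))); last by rewrite /n /top; lia.
apply: eq_bigr => a _; case e: (mA _ a) => [b|].
  move/eqP: e; rewrite mAP // inE /= => /eqP e; rewrite /cost_at e ordB_lt /= !valK /=.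
  by case/woman_atP: e => ->.
rewrite /cost_at; case: ifP => // lt.
have [a' [b [/ord_inj aa ew _]]] := woman_at_lt lt.
have : (a, b) \in vector_matching p by rewrite inE /= {1}aa ew.
by rewrite -mAP // e.
Qed.

Lemma optimal_vector p : stableG p ->
  (forall q, stableG q -> vcost n cost_at p <= vcost n cost_at q) ->
  min_cost_popular_max_matching c (vector_matching p).
Proof.
move=> sp opt; split; first exact: certificate_popular (stable_certificate sp).
move=> N popN; have [l ce] := popular_certificate popN.
have [sq eN] := certificate_stable ce.
by rewrite -eN -!vcost_cost //; apply: opt.
Qed.

End Cost.
End Levels.

(** * The program *)

Fixpoint ireads (e : iexp) : seq nat :=
  match e with
  | ICst _ => [::]
  | IGet x i j => x :: ireads i ++ ireads j
  | IAdd e1 e2 | ISub e1 e2 => ireads e1 ++ ireads e2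
  end.

Fixpoint rreads (e : rexp) : seq nat :=
  match e with
  | RGet _ i j => ireads i ++ ireads j
  | RAdd e1 e2 | RSub e1 e2 => rreads e1 ++ rreads e2
  end.

Fixpoint treads (t : htest) : seq nat :=
  match t with
  | TBase (ILe e1 e2) => ireads e1 ++ ireads e2
  | TBase (RLe e1 e2) => rreads e1 ++ rreads e2
  | TAnd t1 t2 => treads t1 ++ treads t2
  | TNot t1 => treads t1
  | TEx l t1 => l :: treads t1
  end.

Definition nop : cmd := CSet 99 (ICst 0) (ICst 0) (ICst 0).
Definition setc (x : nat) (e : iexp) : cmd := CSet x (ICst 0) (ICst 0) e.
(** The last witness survives in [r]. With [r] preset to the limit, [r] below the limit afterwards
    means success. *)
Definition search (l x r : nat) (t : htest) : cmd :=
  CFor l x (CIf t (setc r (cell x)) nop).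

(** * Frame properties and a potential rule for counted loops *)

Section Semantics.
Variable R : realType.
Implicit Types (s : state R).

Lemma ieval_reads s s' e :
  (forall y i j, y \in ireads e -> ints s y i j = ints s' y i j) -> ieval s e = ieval s' e.
Proof.
elim: e => //= [x i Ii j Ij|e1 I1 e2 I2|e1 I1 e2 I2] h.
- rewrite h ?inE ?eqxx // Ii ?Ij // => y ? ? yi; apply: h; rewrite inE mem_cat yi ?orbT //.
- by rewrite I1 ?I2 // => y ? ? yi; apply: h; rewrite mem_cat yi ?orbT.
- by rewrite I1 ?I2 // => y ? ? yi; apply: h; rewrite mem_cat yi ?orbT.
Qed.

Lemma reval_reads s s' e :
  (forall y i j, y \in rreads e -> ints s y i j = ints s' y i j) ->
  (forall y i j, rels s y i j = rels s' y i j) -> reval s e = reval s' e.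
Proof.
move=> h hr; elim: e h => //= [x i j|e1 I1 e2 I2|e1 I1 e2 I2] h.
- rewrite hr; congr (rels s' x _ _); apply: ieval_reads => y ? ? yi;
    by apply: h; rewrite mem_cat yi ?orbT.
- by rewrite I1 ?I2 // => y ? ? yi; apply: h; rewrite mem_cat yi ?orbT.
- by rewrite I1 ?I2 // => y ? ? yi; apply: h; rewrite mem_cat yi ?orbT.
Qed.

Lemma heval_reads k t s s' :
  (forall y i j, y \in treads t -> ints s y i j = ints s' y i j) ->
  (forall y i j, rels s y i j = rels s' y i j) -> heval k s t = heval k s' t.
Proof.
elim: t k s s' => [[e1 e2|e1 e2]|t1 I1 t2 I2|t1 I1|l t1 I1] k s s' h hr /=.
- rewrite !(@ieval_reads s s') // => y ? ? yi; apply: h; rewrite /= mem_cat yi ?orbT //.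
- rewrite !(@reval_reads s s') // => y ? ? yi; apply: h; rewrite /= mem_cat yi ?orbT //.
- by rewrite (I1 k s s') ?(I2 k s s') // => y ? ? yi; apply: h; rewrite /= mem_cat yi ?orbT.
- by rewrite (I1 k s s').
- rewrite (h l) ?inE ?eqxx //; apply: eq_has => i; apply: I1 => // y i' j' yi /=.
  by rewrite /update; case: ifP => // _; apply: h; rewrite inE yi orbT.
Qed.


Lemma run_search l x r t s : [&& x != r, x != 99, r != 99, r \notin treads t & 99 \notin treads t] ->
  (forall i, i < ints s l 0 0 -> ~~ heval 100 (set_int s x 0 0 i) t) /\
    ints (run (search l x r t) s) r 0 0 = ints s r 0 0
  \/ exists i, [/\ i < ints s l 0 0, heval 100 (set_int s x 0 0 i) t &
    ints (run (search l x r t) s) r 0 0 = i].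
Proof.
case/and5P=> xr x99 r99 rt t99; set m := ints s l 0 0.
pose P i := heval 100 (set_int s x 0 0 i) t.
pose Q i s' := (forall i', i' < i -> ~~ P i') /\ ints s' r 0 0 = ints s r 0 0
   \/ exists i', [/\ i' < m, P i' & ints s' r 0 0 = i'].
pose I i s' := [/\ forall y i' j', (y \notin [:: x; r; 99]) || (i' != 0) || (j' != 0) ->
    ints s' y i' j' = ints s y i' j',
  forall y i' j', rels s' y i' j' = rels s y i' j' & Q i s'].
suff : Q m (run (search l x r t) s) by [].
apply: (@run_for _ l x _ s I (Q m)); rewrite -/m.
- by split=> //; left.
- move=> i s' im [hi hr h].
  have e : heval 100 (set_int s' x 0 0 i) t = P i.
    apply: heval_reads => // y i' j' yt /=; rewrite /update.
    case: (boolP [&& _, _ & _]) => // nxy; apply: hi.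
    rewrite -orbA -negb_and; case: (boolP (_ && _)) => [/andP[i0 j0]|]; last by rewrite orbT.
    rewrite orbF !inE !negb_or; move: nxy; rewrite i0 j0 !andbT => -> /=.
    by apply/andP; split; [apply: contraNneq rt => <-|apply: contraNneq t99 => <-].
  have hi' z c v y i' j' : c \in [:: r; 99] -> (y \notin [:: x; r; 99]) || (i' != 0) || (j' != 0) ->
      ints (set_int (set_int s' x 0 0 z) c 0 0 v) y i' j' = ints s y i' j'.
    move=> cr cond; rewrite -(hi _ _ _ cond) /= /update.
    case: and3P => [[/eqP yc /eqP i0 /eqP j0]|_].
      by move: cond; rewrite i0 j0 yc inE cr orbT.
    case: and3P => [[/eqP yc /eqP i0 /eqP j0]|//].
    by move: cond; rewrite i0 j0 yc inE eqxx.
  rewrite [run _ _]/= e; case: (boolP (P i)) => Pi.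
    split=> //; first by move=> y i' j' cond; apply: hi' cond; rewrite !inE eqxx.
    by right; exists i; split=> //; rewrite get_set /= /update !eqxx.
  split=> //; first by move=> y i' j' cond; apply: hi' cond; rewrite !inE eqxx orbT.
  have rr : ints (set_int (set_int s' x 0 0 i) 99 0 0 0) r 0 0 = ints s' r 0 0.
    by rewrite !get_set_neq // eq_sym.
  case: h => [[h1 h2]|[i' [h1 h2 h3]]]; [left|right].
    split; last by rewrite -h2 -rr.
    by move=> i'; rewrite ltnS leq_eqVlt => /orP[/eqP->//|]; apply: h1.
  by exists i'; split=> //; rewrite -h3 -rr.
- move=> s' [_ _ h]; rewrite /Q get_set_neq; last by rewrite eq_sym.
  exact: h.
Qed.

Section Advance.
Variables (Good done : state R -> Prop) (mu : state R -> nat).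

(** Replaces reasoning about termination: a round either leaves the goal reached or lowers [mu] by
    [T], so more rounds than the initial value of [mu] must reach it. Nested loops multiply [T]. *)
Definition advances (c : cmd) (T : nat) : Prop := forall s, Good s ->
  [/\ Good (run c s), done s -> done (run c s)
    & done (run c s) \/ mu (run c s) + T <= mu s].

Definition insensitive (x : nat) : Prop := forall s i, Good s ->
  [/\ Good (set_int s x 0 0 i), done (set_int s x 0 0 i) <-> done s
    & mu (set_int s x 0 0 i) = mu s].

Lemma advances_for l x c m T : insensitive x -> (forall s, Good s -> ints s l 0 0 = m) ->
  advances c T -> advances (CFor l x c) (m * T).
Proof.
move=> ins lm ad s gs.
pose Q i s' := [/\ Good s', done s -> done s' & done s' \/ mu s' + i * T <= mu s].
apply: (@run_for _ l x c s Q (Q m)); rewrite ?lm //.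
- by split=> //; right; rewrite mul0n addn0.
- move=> i s' im [g' d' m']; have [g1 d1 m1] := ins s' i g'.
  have [g2 d2 m2] := ad _ g1; split=> //.
    by move/d'/d1/d2.
  case: m' => [/d1/d2|m']; first by left.
  by case: m2 => [|m2]; [left|right; move: m2; rewrite m1 mulSn; lia].
- move=> s' [g' d' m']; have [g1 d1 m1] := ins s' m g'; split=> //.
    by move/d'/d1.
  by rewrite m1; case: m' => [/d1|]; [left|right].
Qed.

End Advance.
End Semantics.

Definition at1 (x : nat) (i : iexp) : iexp := IGet x i (ICst 0).
Definition ile (e1 e2 : iexp) : htest := TBase (ILe e1 e2).
Definition ilt (e1 e2 : iexp) : htest := TBase (ILe (IAdd e1 (ICst 1)) e2).
Definition ieq (e1 e2 : iexp) : htest := TAnd (ile e1 e2) (ile e2 e1).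
Definition tor (t1 t2 : htest) : htest := TNot (TAnd (TNot t1) (TNot t2)).
(** The machine has no real constants, so 0 is read from an untouched cell. *)
Definition rpos (e : rexp) : htest := TNot (TBase (RLe e (RGet 4 (ICst 0) (ICst 0)))).

(* Integer arrays: 6, 7, 8 the numbers n, m = n^3, K = n^2; 9 the ranks of the
   women; 10 woman_at and 11 score_at; 12 and 13 the man and the position of a
   node; 14 the least settled vectors J; 15 whether J v is stable; 16 the
   heights; 17 the gap; 18 the final vector; 20-29 loop variables; 30-33
   auxiliary variables.  Real arrays: 1 cost_at, 2 the excesses, 3 the flow,
   4 is never written.  The quantified variables of tests are 101, 103, ... *)
Definition set_levels : cmd :=
  setc 6 (IAdd (IAdd (IGet 0 (ICst 0) (ICst 0)) (IGet 0 (ICst 0) (ICst 1))) (ICst 2)).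

(** Products are obtained by counting, in loops limited by [n] alone. *)
Definition set_sizes : cmd :=
  CFor 6 20 (CFor 6 21 (CSeq (setc 8 (IAdd (cell 8) (ICst 1)))
    (CFor 6 22 (setc 7 (IAdd (cell 7) (ICst 1)))))).

Definition set_ranks : cmd :=
  CFor 6 20 (CFor 6 21
    (CIf (ilt (cell 21) (at1 3 (cell 20)))
      (CSet 9 (cell 20) (IGet 4 (cell 20) (cell 21)) (cell 21)) nop)).

Definition fill_entry : cmd :=
  CSeq (CSet 12 (cell 32) (ICst 0) (cell 20))
  (CSeq (CSet 13 (cell 32) (ICst 0) (cell 33))
  (CSeq (CIf (ilt (cell 22) (at1 1 (cell 20)))
    (CSeq (CSet 10 (cell 20) (cell 33) (IGet 2 (cell 20) (cell 22)))
    (CSeq (CSet 11 (cell 20) (cell 33)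
       (ISub (IAdd (IAdd (cell 8) (cell 22))
                   (IGet 9 (IGet 2 (cell 20) (cell 22)) (cell 20))) (cell 33)))
       (CRSet 1 (cell 20) (cell 33) (RGet 0 (cell 20) (IGet 2 (cell 20) (cell 22))))))
    (CSeq (CSet 10 (cell 20) (cell 33) (cell 6))
       (CRSet 1 (cell 20) (cell 33) (RGet 4 (ICst 0) (ICst 0)))))
  (CSeq (setc 33 (IAdd (cell 33) (ICst 1))) (setc 32 (IAdd (cell 32) (ICst 1)))))).

Definition set_table : cmd :=
  CFor 6 20 (CSeq (setc 33 (ICst 0)) (CFor 6 21 (CFor 6 22 fill_entry))).

Definition row_at (a : iexp) : iexp := IGet 14 (cell 20) a.
Definition rejected_test : htest :=
  TAnd (ile (IAdd (row_at (cell 22)) (ICst 2)) (cell 8))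
   (tor (ile (cell 6) (IGet 10 (cell 22) (row_at (cell 22))))
     (TEx 6 (TEx 8
       (TAnd (ile (cell 103) (row_at (cell 101)))
       (TAnd (ieq (IGet 10 (cell 101) (cell 103)) (IGet 10 (cell 22) (row_at (cell 22))))
             (ilt (IGet 11 (cell 101) (cell 103)) (IGet 11 (cell 22) (row_at (cell 22))))))))).

Definition propose : cmd :=
  CSeq (setc 30 (cell 6)) (CSeq (search 6 22 30 rejected_test)
    (CIf (ilt (cell 30) (cell 6))
      (CSet 14 (cell 20) (cell 30) (IAdd (row_at (cell 30)) (ICst 1))) nop)).

Definition jilted_test : htest :=
  TEx 6 (TEx 8
    (TAnd (ile (cell 103) (row_at (cell 101)))
    (TAnd (ilt (IGet 10 (cell 101) (cell 103)) (cell 6))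
          (TNot (TEx 6 (ieq (IGet 10 (cell 105) (row_at (cell 105)))
                            (IGet 10 (cell 101) (cell 103)))))))).

Definition set_row : cmd :=
  CSeq (CSet 14 (cell 20) (at1 12 (cell 20)) (at1 13 (cell 20)))
  (CSeq (CFor 7 21 propose)
        (CIf jilted_test nop (CSet 15 (cell 20) (ICst 0) (ICst 1)))).

Definition set_rows : cmd := CFor 7 20 set_row.

Definition excess (v : iexp) : rexp := RGet 2 v (ICst 0).
Definition set_excess : cmd :=
  CFor 7 20 (CIf (TAnd (ile (ICst 1) (at1 15 (cell 20)))
                       (ilt (IGet 14 (ICst 0) (at1 12 (cell 20))) (at1 13 (cell 20))))
    (CRSet 2 (cell 20) (ICst 0)
       (RSub (RGet 1 (at1 12 (cell 20)) (ISub (at1 13 (cell 20)) (ICst 1)))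
             (RGet 1 (at1 12 (cell 20)) (at1 13 (cell 20))))) nop).

Definition arc_test (u v : iexp) : htest :=
  TAnd (ile (ICst 1) (at1 15 u)) (ile (at1 13 v) (IGet 14 u (at1 12 v))).
Definition active_test : htest :=
  TAnd (ilt (at1 16 (cell 26)) (cell 7)) (rpos (excess (cell 26))).
Definition admissible_test : htest :=
  TAnd (ieq (at1 16 (cell 30)) (IAdd (at1 16 (cell 27)) (ICst 1)))
       (tor (arc_test (cell 30) (cell 27)) (rpos (RGet 3 (cell 27) (cell 30)))).

(** The amount pushed is read from a cell that itself changes, so the cell is overwritten last, by a
    difference equal to 0. *)
Definition push : cmd :=
  let e u := CRSet 2 u (ICst 0) in let u := cell 30 in let v := cell 31 in
  CIf (arc_test u v)
    (CSeq (e v (RAdd (excess v) (excess u)))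
    (CSeq (CRSet 3 u v (RAdd (RGet 3 u v) (excess u)))
          (e u (RSub (excess u) (excess u)))))
    (CIf (TBase (RLe (excess u) (RGet 3 v u)))
      (CSeq (e v (RAdd (excess v) (excess u)))
      (CSeq (CRSet 3 v u (RSub (RGet 3 v u) (excess u)))
            (e u (RSub (excess u) (excess u)))))
      (CSeq (e v (RAdd (excess v) (RGet 3 v u)))
      (CSeq (e u (RSub (excess u) (RGet 3 v u)))
            (CRSet 3 v u (RSub (RGet 3 v u) (RGet 3 v u)))))).

Definition relabel : cmd :=
  CSet 16 (cell 30) (ICst 0) (IAdd (at1 16 (cell 30)) (ICst 1)).

Definition flow_step : cmd :=
  CSeq (setc 30 (cell 7)) (CSeq (search 7 26 30 active_test)
    (CIf (ilt (cell 30) (cell 7))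
      (CSeq (setc 31 (cell 7)) (CSeq (search 7 27 31 admissible_test)
        (CIf (ilt (cell 31) (cell 7)) push relabel))) nop)).

(** The initial potential is of order [m] to the fourth, so [m] to the fifth steps suffice. *)
Definition flow : cmd :=
  CFor 7 21 (CFor 7 22 (CFor 7 23 (CFor 7 24 (CFor 7 25 flow_step)))).

Definition find_gap : cmd :=
  CSeq (setc 17 (cell 7))
       (search 7 20 17 (TNot (TEx 7 (ieq (at1 16 (cell 101)) (cell 20))))).

Definition set_vector : cmd :=
  CSeq (CFor 6 21 (CSet 18 (cell 21) (ICst 0) (IGet 14 (ICst 0) (cell 21))))
  (CFor 7 20 (CIf (TAnd (ile (ICst 1) (at1 15 (cell 20))) (ilt (cell 17) (at1 16 (cell 20))))
    (CFor 6 21 (CIf (ilt (at1 18 (cell 21)) (IGet 14 (cell 20) (cell 21)))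
       (CSet 18 (cell 21) (ICst 0) (IGet 14 (cell 20) (cell 21))) nop)) nop)).

Definition write_output : cmd :=
  CFor 6 20 (CIf (ilt (IGet 10 (cell 20) (at1 18 (cell 20))) (cell 6))
    (CSet 5 (cell 20) (IGet 10 (cell 20) (at1 18 (cell 20))) (ICst 1)) nop).

Definition solve : cmd :=
  CSeq set_ranks (CSeq set_table (CSeq set_rows (CSeq set_excess
  (CSeq flow (CSeq find_gap (CSeq set_vector write_output)))))).

Lemma set_sizes_wf : cmd_wf [:: 6] set_sizes. Proof. by []. Qed.
Lemma solve_wf : cmd_wf [:: 6; 7; 8] solve. Proof. by []. Qed.

(** * Correctness of the phases *)

Section Phases.
Variables (R : realType) (G : instance) (c : edge G -> R).
Implicit Types (s : state R).
Notation n := (levels G).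
Notation K := (positions G).
Notation m := (n * K).

Lemma run_seq c1 c2 s : run (CSeq c1 c2) s = run c2 (run c1 s).
Proof. by []. Qed.

Lemma run_if t c1 c2 s :
  run (CIf t c1 c2) s = if heval 100 s t then run c1 s else run c2 s.
Proof. by []. Qed.

Lemma set_levels_run : ints (run set_levels (input c)) 6 0 0 = n.
Proof. by rewrite /= /update /= !muln1 addn2. Qed.

Lemma set_sizes_run s : ints s 6 0 0 = n -> ints s 7 0 0 = 0 -> ints s 8 0 0 = 0 ->
  [/\ ints (run set_sizes s) 7 0 0 = m & ints (run set_sizes s) 8 0 0 = K].
Proof.
move=> h6 h7 h8.
have inner s' : ints s' 6 0 0 = n ->
    ints (run (CFor 6 22 (setc 7 (IAdd (cell 7) (ICst 1)))) s') 7 0 0 = ints s' 7 0 0 + n.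
  move=> e6; apply: (@run_for _ 6 22 _ _ (fun i s2 => ints s2 7 0 0 = ints s' 7 0 0 + i)
    (fun s2 => ints s2 7 0 0 = ints s' 7 0 0 + n)).
  - by rewrite addn0.
  - by move=> i s2 _ /= e; rewrite /update /= e addn1 addnS.
  - by rewrite e6.
pose I k s' := [/\ ints s' 6 0 0 = n, ints s' 8 0 0 = k & ints s' 7 0 0 = k * n].
have body k s' : I k s' -> I k.+1 (run (CSeq (setc 8 (IAdd (cell 8) (ICst 1)))
    (CFor 6 22 (setc 7 (IAdd (cell 7) (ICst 1))))) s').
  move=> [e6 e8 e7]; split.
  - by rewrite run_frame.
  - by rewrite run_seq run_frame //= /update /= e8 addn1.
  - by rewrite run_seq inner //= /update /= e7 mulSn addnC.
have : I K (run set_sizes s); last by case=> _ -> ->; rewrite mulnC.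
apply: (@run_for _ 6 20 _ _ (fun i s' => I (i * n) s') (I K)).
- by [].
- move=> i s' _ Is; apply: (@run_for _ 6 21 _ _ (fun j s' => I (i * n + j) s') (I (i.+1 * n))).
  + by rewrite addn0.
  + by move=> j s2 _ h; rewrite addnS; apply: body.
  + by case: (Is) => /= e6 _ _ s2; rewrite /update /= e6 mulSn addnC.
- by rewrite h6.
Qed.

Definition keeps_input s : Prop :=
  [/\ ints s 1 =2 input_ints G 1, ints s 2 =2 input_ints G 2,
      ints s 3 =2 input_ints G 3 & ints s 4 =2 input_ints G 4] /\
  rels s 0 =2 input_reals c 0.

Lemma set_ranks_run s : keeps_input s -> ints s 6 0 0 = n ->
  forall (a : 'I_(nA G)) (b : 'I_(nB G)), (a, b) \in edges G ->
  ints (run set_ranks s) 9 b a = rank_of G b a.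
Proof.
move=> [[_ _ ki3 ki4] _] h6.
have rkE (a : 'I_(nA G)) (b : 'I_(nB G)) : rank_of G b a = rb b a.
  by rewrite /rank_of valK /= (index_map val_inj).
pose I i j s' := [/\ ints s' 3 =2 input_ints G 3, ints s' 4 =2 input_ints G 4,
  ints s' 6 0 0 = n &
  forall (a : 'I_(nA G)) (b : 'I_(nB G)), (a, b) \in edges G ->
    (b < i) || (b == i :> nat) && (rb b a < j) -> ints s' 9 b a = rb b a].
suff : I n 0 (run set_ranks s).
  by move=> [_ _ _ h] a b e; rewrite rkE h // ordB_lt.
apply: (@run_for _ 6 20 _ _ (fun i s' => I i 0 s') (I n 0)).
- by split=> // a b _; rewrite ltn0 ltn0 andbF.
- move=> i s' iL Is.
  pose I' j s' := I i j s' /\ ints s' 20 0 0 = i.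
  suff : I i n (run (CFor 6 21 (CIf (ilt (cell 21) (at1 3 (cell 20)))
      (CSet 9 (cell 20) (IGet 4 (cell 20) (cell 21)) (cell 21)) nop)) (set_int s' 20 0 0 i)).
    case=> h1 h1' h2 h3; split=> // a b e; rewrite ltnS leq_eqVlt ltn0 andbF orbF => h.
    by apply: h3 => //; rewrite (rb_lt e) andbT orbC.
  apply: (@run_for _ 6 21 _ _ I' (I i n)); last first.
  + have -> : ints (set_int s' 20 0 0 i) 6 0 0 = n by case: Is.
    by move=> s2 [].
  + move=> j s2 _ [[h1 h1' h2 h3] h20].
    have dE := h1 i 0.
    rewrite /= /update /= h20 dE addn1; case: ifP => [lt|ge].
      split=> //; split=> //= a b e; rewrite /update /= h1' /=.
      move: lt; rewrite /=; case: insubP => [b' b'n bi|]; last by rewrite mul0n.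
      rewrite /= muln1 => lt.
      rewrite -bi; case: (eqVneq (b : nat) b') => [/ord_inj bb|nb] /=; last first.
        by move=> h; apply: h3 => //; move: h; rewrite -bi (negbTE nb) !orbF.
      rewrite (nth_map a) // bb ltnn /= => rl.
      case: eqP => [/ord_inj aa|na].
        by rewrite aa /rb index_uniq // prefB_uniq.
      apply: h3; first by rewrite -bb.
      rewrite -bi eqxx /= ltnn /=; move: rl; rewrite ltnS leq_eqVlt => /orP[/eqP rj|//].
      case: na; congr val; rewrite -rj /rb nth_index //.
      by rewrite prefB_edges -bb.
    split=> //; split=> //= a b e; rewrite [rb b a < _]ltnS [rb b a <= _]leq_eqVlt => h.
    apply: h3 => //; move: h => /orP[-> //|/andP[/eqP bi /orP[/eqP rj|->]]]; last by rewrite bi eqxx orbT.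
    exfalso; move: ge; rewrite -bi /= valK /= muln1 -rj => /negP; apply.
    by rewrite /rb index_mem prefB_edges.
  + by split.
- by rewrite h6.
Qed.

Definition filled s (a k : nat) : Prop :=
  [/\ ints s 10 a k = woman_at G a k,
      woman_at G a k < n -> ints s 11 a k = score_at G a k
    & rels s 1 a k = cost_at c a k].

Definition tables s : Prop :=
  [/\ [/\ ints s 6 0 0 = n, ints s 7 0 0 = m & ints s 8 0 0 = K],
      forall a k, a < n -> k < K -> filled s a k,
      forall v, v < m -> ints s 12 v 0 = man K v,
      forall v, v < m -> ints s 13 v 0 = pos K v
    & rels s 4 0 0 = 0%R].

Definition table_pre s : Prop :=
  [/\ keeps_input s, [/\ ints s 6 0 0 = n, ints s 7 0 0 = m & ints s 8 0 0 = K],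
    (forall (a : 'I_(nA G)) (b : 'I_(nB G)), (a, b) \in edges G ->
      ints s 9 b a = rank_of G b a)
  & rels s 4 0 0 = 0%R].

Definition table_inv (k : nat) s : Prop :=
  [/\ table_pre s, ints s 32 0 0 = k,
      forall a i, i < K -> a * K + i < k -> filled s a i
    & forall v, v < k -> ints s 12 v 0 = man K v /\ ints s 13 v 0 = pos K v].

Lemma fill_entry_run s a l r : a < n -> l < n -> r < n ->
  table_inv (a * K + (l * n + r)) s ->
  ints s 20 0 0 = a -> ints s 22 0 0 = r -> ints s 33 0 0 = l * n + r ->
  [/\ table_inv (a * K + (l * n + r)).+1 (run fill_entry s),
      ints (run fill_entry s) 20 0 0 = a
    & ints (run fill_entry s) 33 0 0 = (l * n + r).+1].
Proof.
move=> an ln rn [[[[k1 k2 k3 k4] kr] [h6 h7 h8] h9 hz] h32 hf hv] h20 h22 h33.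
have pK : l * n + r < K by rewrite /K -ltn_divLR // divnMDl // divn_small // addn0.
have wE : woman_at G a (l * n + r) =
    if r < input_ints G 1 a 0 then input_ints G 2 a r else n.
  by rewrite /woman_at modnMDl modn_small.
have sp : [/\ table_pre (run fill_entry s), filled (run fill_entry s) a (l * n + r),
    forall a' i, (a' != a) || (i != l * n + r) -> filled s a' i -> filled (run fill_entry s) a' i,
    forall v, ints (run fill_entry s) 12 v 0 =
      if v == a * K + (l * n + r) then a else ints s 12 v 0 &
    forall v, ints (run fill_entry s) 13 v 0 =
      if v == a * K + (l * n + r) then l * n + r else ints s 13 v 0].
  rewrite /fill_entry !run_seq run_if.
  have -> : heval 100 (run (CSet 13 (cell 32) (ICst 0) (cell 33))
     (run (CSet 12 (cell 32) (ICst 0) (cell 20)) s)) (ilt (cell 22) (at1 1 (cell 20))) =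
     (r < input_ints G 1 a 0).
    by rewrite /= /update /= h22 h20 k1 addn1.
  case: ifP => lt.
    have we : woman_at G a (l * n + r) = input_ints G 2 a r by rewrite wE lt.
    have wn : woman_at G a (l * n + r) < n.
      move: lt we; rewrite /=; case: insubP => [a' _ <-|//] /=.
      rewrite muln1 => lt ->; have sz := size_map val (prefA a').
      have : nth 0 [seq val i | i <- prefA a'] r \in [seq val i | i <- prefA a'].
        by rewrite mem_nth // sz.
      by case/mapP=> b _ ->; apply: ordB_lt.
    split.
    - by split=> //; split.
    - split.
      + by rewrite /= /update /= h20 h33 h22 k2 !eqxx.
      + move=> _; rewrite /= /update /= h20 h33 h22 h8 k2 !eqxx /=.
        have [x [b [ax xw xe]]] := woman_at_lt wn.
        have e9 : ints s 9 (woman_at G a (l * n + r)) a = rank_of G (woman_at G a (l * n + r)) a.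
          by rewrite ax xw h9.
        by rewrite /score_at modnMDl modn_small // -e9 we.
      + by rewrite /= /update /= h20 h33 h22 k2 !eqxx /= kr /cost_at wn we.
    - move=> a' i ne [f1 f2 f3]; split.
      + by rewrite /= /update /= h20 h33; case: andP ne => [[-> ->]|].
      + by rewrite /= /update /= h20 h33; case: andP ne => [[-> ->]|].
      + by rewrite /= /update /= h20 h33; case: andP ne => [[-> ->]|].
    - by move=> v; rewrite /= /update /= h32 h20; case: eqP; rewrite ?andbT ?andbF.
    - by move=> v; rewrite /= /update /= h32 h33; case: eqP; rewrite ?andbT ?andbF.
  have we : woman_at G a (l * n + r) = n by rewrite wE lt.
  split.
  - by split=> //; split.
  - split.
    + by rewrite /= /update /= h20 h33 h6 !eqxx.
    + by rewrite we ltnn.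
    + by rewrite /= /update /= h20 h33 !eqxx /= hz /cost_at we ltnn.
  - move=> a' i ne [f1 f2 f3]; split.
    + by rewrite /= /update /= h20 h33; case: andP ne => [[-> ->]|].
    + exact: f2.
    + by rewrite /= /update /= h20 h33; case: andP ne => [[-> ->]|].
  - by move=> v; rewrite /= /update /= h32 h20; case: eqP; rewrite ?andbT ?andbF.
  - by move=> v; rewrite /= /update /= h32 h33; case: eqP; rewrite ?andbT ?andbF.
case: sp => sp1 sp2 sp3 sp4 sp5; split.
- split=> //.
  + rewrite /fill_entry !run_seq run_if; case: ifP => _; by rewrite /= /update /= h32 addn1.
  + move=> a' i iK; rewrite ltnS leq_eqVlt => /orP[/eqP e|lt].
      have [-> ->] : a' = a /\ i = l * n + r.
        have h1 := congr1 (divn^~ K) e; have h2 := congr1 (modn^~ K) e.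
        by move: h1 h2; rewrite /= !divnMDl // (divn_small iK) (divn_small pK) !addn0
          !modnMDl (modn_small iK) (modn_small pK).
      exact: sp2.
    apply: sp3; last exact: hf.
    by rewrite -negb_and; apply/negP => /andP[/eqP ea /eqP ei]; rewrite ea ei ltnn in lt.
  + move=> v; rewrite ltnS leq_eqVlt sp4 sp5; case: eqP => [-> _|_ /= /hv //].
    by rewrite /man /pos divnMDl // divn_small // addn0 modnMDl modn_small.
- by rewrite run_frame.
- by rewrite /fill_entry !run_seq run_if; case: ifP => _; rewrite /= /update /= h33 addn1.
Qed.

Lemma set_table_run s : table_pre s -> ints s 32 0 0 = 0 -> tables (run set_table s).
Proof.
move=> pre h32.
suff : table_inv m (run set_table s).
  case=> [[_ h678 _ hz] _ hf hv]; split=> //.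
  - move=> a k an kK; apply: hf => //; apply: (@leq_trans (a.+1 * K)).
      by rewrite mulSn addnC ltn_add2r.
    by rewrite leq_mul2r an orbT.
  - by move=> v /hv[].
  - by move=> v /hv[].
have h6 s' k : table_inv k s' -> ints s' 6 0 0 = n by case=> [[_ []]].
apply: (@run_for _ 6 20 _ _ (fun i s' => table_inv (i * K) s') (table_inv m)).
- by split.
- move=> a s' an Is; rewrite run_seq.
  have an' : a < n by case: pre an => _ [-> _ _].
  pose I k s' := table_inv (a * K + k) s' /\ ints s' 20 0 0 = a /\ ints s' 33 0 0 = k.
  have : I K (run (CFor 6 21 (CFor 6 22 fill_entry))
      (run (setc 33 (ICst 0)) (set_int s' 20 0 0 a))); last by rewrite mulSn addnC => -[].
  apply: (@run_for _ 6 21 _ _ (fun l s' => I (l * n) s') (I K)).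
  + by rewrite /I addn0.
  + move=> l s2 ln Il; have ln' : l < n by rewrite -(h6 _ _ Is); exact: ln.
    apply: (@run_for _ 6 22 _ _ (fun r s' => I (l * n + r) s') (I (l.+1 * n))).
    * by rewrite addn0.
    * move=> r s3 rn [I1 [I2 I3]]; have rn' : r < n by rewrite -(h6 _ _ Il.1); exact: rn.
      have [] := @fill_entry_run (set_int s3 22 0 0 r) a l r an' ln' rn' I1 I2 erefl I3.
      by rewrite -!addnS.
    * have -> : ints (set_int s2 21 0 0 l) 6 0 0 = n := h6 _ _ Il.1.
      by rewrite mulSn addnC.
  + have -> : ints (run (setc 33 (ICst 0)) (set_int s' 20 0 0 a)) 6 0 0 = n := h6 _ _ Is.
    by [].
- by case: pre => _ [-> _ _] _ _.
Qed.

Lemma tables_frame cm s :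
  ~~ has (mem (iwrites cm)) [:: 6; 7; 8; 10; 11; 12; 13] ->
  ~~ has (mem (rwrites cm)) [:: 1; 4] -> tables s -> tables (run cm s).
Proof.
rewrite /= !negb_or => /and5P[w6 w7 w8 w10 /and4P[w11 w12 w13 _]] /and3P[r1 r4 _].
move=> [[h6 h7 h8] hf h12 h13 hz]; split.
- by split; rewrite run_frame.
- by move=> a k an kK; have [f1 f2 f3] := hf _ _ an kK; split; rewrite ?run_frame ?run_framer.
- by move=> v vm; rewrite run_frame // h12.
- by move=> v vm; rewrite run_frame // h13.
- by rewrite run_framer.
Qed.

End Phases.

(** * Computing the least settled vectors *)

Section Rows.
Variables (R : realType) (G : instance) (c : edge G -> R).
Implicit Types (s : state R).
Notation n := (levels G).
Notation K := (positions G).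
Notation m := (n * K).
Notation E := (woman_at G).
Notation W := (score_at G).

Lemma mem_iota0 i k : (i \in iota 0 k) = (i < k).
Proof. by rewrite mem_iota. Qed.

Lemma K_gt0 : 0 < K. Proof. by rewrite muln_gt0. Qed.

Lemma rejected_testP s v a : tables c s -> ints s 20 0 0 = v ->
  (forall x, x < n -> ints s 14 v x < K) -> a < n ->
  heval 100 (set_int s 22 0 0 a) rejected_test <-> rejected n K E W (ints s 14 v) a.
Proof.
move=> [[h6 h7 h8] hf _ _ _] h20 hK an.
rewrite /rejected_test /tor /= /update /= h20 h6 h8 negb_and !negbK.
set q := ints s 14 v.
have [fa1 fa2 _] := hf a (q a) an (hK a an).
rewrite fa1; split.
  move=> /andP[qK h]; split; first by move: qK; lia.
  case/orP: h => [|/hasP[a']]; first by left.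
  rewrite mem_iota0 => a'n /hasP[k']; rewrite mem_iota0 => k'K.
  have [f1 f2 _] := hf a' k' a'n k'K; rewrite f1.
  case/and3P=> k'q e lW; have eE : E a' k' = E a (q a) by apply/eqP; rewrite eqn_leq.
  (* Where both entries are [n], no scores are tabulated; the first alternative applies there. *)
  case: (ltnP (E a (q a)) n) => En; [right|by left].
  exists a', k'; split=> //; move: lW; rewrite addn1 f2 ?fa2 // eE //.
move=> [qK h]; apply/andP; split; first by move: qK; lia.
case: (leqP n (E a (q a))) => // En; apply/orP; right; case: h => [|[a' [k' [a'n k'q eE lW]]]].
  by rewrite leqNgt En.
have k'K : k' < K by apply: leq_ltn_trans k'q (hK _ a'n).
apply/hasP; exists a'; first by rewrite mem_iota0.
apply/hasP; exists k'; first by rewrite mem_iota0.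
have [f1 f2 _] := hf a' k' a'n k'K.
by rewrite f1 eE leqnn k'q /= f2 ?eE // fa2 // addn1.
Qed.

Lemma jilted_testP s v : tables c s -> ints s 20 0 0 = v ->
  settled n K E W (ints s 14 v) ->
  ~~ heval 100 s jilted_test <-> stable n K E W (ints s 14 v).
Proof.
move=> [[h6 h7 h8] hf _ _ _] h20 st.
rewrite /jilted_test /= /update /= h20 h6 h8.
set q := ints s 14 v in st *; split.
  move=> h; split=> // a k an kq En.
  have kK : k < K by apply: leq_ltn_trans kq (st a an).1.
  have [f1 _ _] := hf a k an kK.
  apply: contrapT => ne; move/negP: h; apply.
  apply/hasP; exists a; first by rewrite mem_iota0.
  apply/hasP; exists k; first by rewrite mem_iota0.
  apply/and3P; split=> //; first by rewrite f1 addn1.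
  rewrite f1; apply/hasPn => a'; rewrite mem_iota0 => a'n.
  have [f2 _ _] := hf a' (q a') a'n (st a' a'n).1.
  rewrite f2 -eqn_leq; apply/eqP => e; apply: ne; by exists a'.
move=> [_ en]; apply/hasPn => a; rewrite mem_iota0 => an.
apply/hasPn => k; rewrite mem_iota0 => kK.
have [f1 _ _] := hf a k an kK; rewrite f1 addn1; apply/negP => /and3P[kq En /hasPn h].
have [a' a'n e] := en a k an kq En.
have := h a'; rewrite mem_iota0 a'n => /(_ isT).
have [f2 _ _] := hf a' (q a') a'n (st a' a'n).1.
by rewrite f2 e leqnn.
Qed.

Section Row.
Variables (v : nat) (J0 : nat -> nat -> nat) (ok0 : nat -> nat -> nat).
Hypothesis vm : v < m.

Definition row_good s : Prop :=
  [/\ [/\ tables c s, ints s 20 0 0 = v, forall v' a, v' != v -> ints s 14 v' a = J0 v' a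
        & ints s 15 =2 ok0],
      forall a, a < n -> ints s 14 v a < K, pos K v <= ints s 14 v (man K v)
    & forall q, settled n K E W q -> pos K v <= q (man K v) -> below n (ints s 14 v) q].

Definition row_done s : Prop := settled n K E W (ints s 14 v).
Definition row_mu s : nat := \sum_(a < n) (K - ints s 14 v a).

(** A settled vector above the current one contains all its proposals, so a man rejected now cannot
    still be at the same position there. Advancing him therefore preserves minimality. *)
Lemma propose_advances : advances row_good row_done row_mu propose 1.
Proof.
move=> s [[tb h20 hJ hok] hK hv hq].
have [h6 h7 h8] : [/\ ints s 6 0 0 = n, ints s 7 0 0 = m & ints s 8 0 0 = K] by case: tb.
rewrite /propose !run_seq run_if.
set s1 := run (setc 30 (cell 6)) s.
have tb1 : tables c s1 by apply: tables_frame.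
have h20' : ints s1 20 0 0 = v by [].
have hK' : forall x, x < n -> ints s1 14 v x < K by [].
have fr y i j : y \notin [:: 22; 30; 99] ->
    ints (run (search 6 22 30 rejected_test) s1) y i j = ints s y i j.
  move=> ny; rewrite run_frame; last by apply: contra ny; rewrite /= !inE.
  rewrite /s1 run_frame //; apply: contra ny; rewrite /= !inE => ->; by rewrite orbT.
have tb2 : tables c (run (search 6 22 30 rejected_test) s1) by apply: tables_frame.
have SR := @run_search _ 6 22 30 rejected_test s1 isT.
move: (run (search 6 22 30 rejected_test) s1) fr tb2 SR => s2 fr tb2 SR.
have t2 : heval 100 s2 (ilt (cell 30) (cell 6)) = (ints s2 30 0 0 < n).
  by rewrite /= (fr 6) // h6 addn1.
case: SR => [[no r30]|[a [an rj r30]]].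
  have nr : row_done s.
    move=> a an; split; first exact: hK.
    by move/(rejected_testP tb1 h20' hK' an); apply/negP; apply: no; rewrite /s1 /= /update /= h6.
  rewrite t2 (_ : ints s2 30 0 0 = n) ?ltnn; last by rewrite r30 /s1 /= /update /= h6.
  have e14 : ints (run nop s2) 14 = ints s 14.
    by apply: funext => i; apply: funext => j; rewrite /= /update /= fr.
  have dn : row_done (run nop s2) by rewrite /row_done e14.
  split=> //; last by left.
  split; rewrite ?e14 //; split.
  - by apply: tables_frame.
  - by rewrite /= /update /= fr.
  - exact: hJ.
  - by move=> i j; rewrite /= /update /= fr // hok.
have an' : a < n by move: an; rewrite /s1 /= /update /= h6.
rewrite t2 r30 an'.
set s3 := run _ s2; have e14 : ints s3 14 v = (fun x => if x == a then (ints s 14 v a).+1 else ints s 14 v x).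
  apply: funext => x; rewrite /s3 /= /update /= r30 !fr // h20 eqxx /=.
  by case: eqP => [_|//]; rewrite addn1.
have rj' : rejected n K E W (ints s 14 v) a by apply/(rejected_testP tb1 h20' hK' an').
have [lK _] := rj'; have aK := hK a an'.
have K1 : (ints s 14 v a).+1 < K by move: lK; have := K_gt0; lia.
split.
- split.
  + split; first by apply: tables_frame.
    * by rewrite /s3 /= /update /= fr.
    * move=> v' x ne; rewrite /s3 /= /update /= r30 !fr // h20 (negbTE ne) /=; exact: hJ.
    * by move=> i j; rewrite /s3 /= /update /= fr // hok.
  + by move=> x xn; rewrite e14; case: eqP => // _; apply: hK.
  + by rewrite e14; case: eqP => [e|//]; rewrite -e; apply: leqW.
  + move=> q sq pq x xn; rewrite e14; case: eqP => [->|_]; last exact: hq.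
    have le := hq q sq pq; rewrite ltn_neqAle le // andbT; apply/eqP => e.
    have [_ nr] := sq a an'; apply: nr; case: rj' => _ h; split; first by rewrite -e.
    rewrite -e; case: h => [h|[a' [k' [a'n k'q eE lW]]]]; [by left|right].
    by exists a', k'; split=> //; apply: leq_trans k'q (le _ a'n).
- by move=> /(_ a an')[_ []].
right; rewrite /row_mu e14 addn1 (bigD1 (Ordinal an')) //= [leqRHS](bigD1 (Ordinal an')) //=.
rewrite eqxx -addSn; apply: leq_add; first by lia.
by apply: leq_sum => x xa; rewrite (_ : (val x == a) = false) //; apply: negbTE xa.
Qed.

Lemma row_loop s : row_good s -> row_good (run (CFor 7 21 propose) s) /\
  row_done (run (CFor 7 21 propose) s).
Proof.
move=> gs.
have ad := @advances_for _ row_good row_done row_mu 7 21 propose m 1.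
have [||g _ [//|le]] := ad _ _ propose_advances s gs.
- by move=> s' i g.
- by move=> s' [[[[]]]].
exfalso; case: (gs) => _ hK _ _; case: g => _ hK' _ _.
have u : row_mu s <= m.
  rewrite /row_mu -[n in n * K](card_ord n) -sum_nat_const; apply: leq_sum => a _.
  exact: leq_subr.
(* Positions stay below [K], so the potential never vanishes; as it is at most [m] initially, [m]
   rounds cannot all have lowered it. *)
have l : 0 < row_mu (run (CFor 7 21 propose) s).
  have n0 : 0 < n by [].
  rewrite /row_mu (bigD1 (Ordinal n0)) //= ltn_addr // subn_gt0.
  exact: hK'.
by move: le; rewrite muln1; lia.
Qed.

End Row.

Definition rows_done s : Prop := forall v, v < m ->
  [/\ settled n K E W (ints s 14 v), pos K v <= ints s 14 v (man K v),
      forall q, settled n K E W q -> pos K v <= q (man K v) -> below n (ints s 14 v) q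
    & 0 < ints s 15 v 0 <-> stable n K E W (ints s 14 v)].

Lemma set_rows_run s : tables c s -> (forall i j, ints s 14 i j = 0) ->
  (forall i j, ints s 15 i j = 0) -> rows_done (run set_rows s).
Proof.
move=> tb h14 h15.
have m7 : ints s 7 0 0 = m by case: tb => [[]].
pose I k s' := [/\ tables c s',
  forall v, v < k -> [/\ settled n K E W (ints s' 14 v), pos K v <= ints s' 14 v (man K v),
      forall q, settled n K E W q -> pos K v <= q (man K v) -> below n (ints s' 14 v) q
    & 0 < ints s' 15 v 0 <-> stable n K E W (ints s' 14 v)] &
  forall v i, k <= v -> ints s' 14 v i = 0 /\ ints s' 15 v i = 0].
suff : I m (run set_rows s) by case.
apply: (@run_for _ 7 20 _ _ I (I m)).
- by split.
- move=> v s0; rewrite m7 => vm [tb0 hd0 hz0].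
  rewrite /set_row !run_seq run_if; set s1 := set_int s0 20 0 0 v.
  have tb1 : tables c s1 by [].
  set s2 := run (CSet 14 _ _ _) s1.
  have tb2 : tables c s2 by apply: tables_frame.
  have [[_ _ _] _ h12 h13 _] := tb0.
  have pK : pos K v < K by rewrite /pos ltn_mod K_gt0.
  have e2 v' x : ints s2 14 v' x =
      if (v' == v) && (x == man K v) then pos K v else ints s0 14 v' x.
    by rewrite /s2 /= /update /= h12 // h13.
  have g2 : @row_good v (ints s0 14) (ints s0 15) s2.
    split.
    + split=> //; move=> v' x ne; by rewrite e2 (negbTE ne).
    + move=> x xn; rewrite e2 eqxx /=; case: ifP => // _.
      by have [-> _] := hz0 v x (leqnn _); apply: K_gt0.
    + by rewrite e2 !eqxx.
    + move=> q sq pq x xn; rewrite e2 eqxx /=; case: eqP => [->//|_].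
      by have [-> _] := hz0 v x (leqnn _).
  have [g3 d3] := row_loop vm g2.
  move: (run (CFor 7 21 propose) s2) g3 d3 => s3 g3 d3.
  have [[tb3 h20 hJ hok] hK hv hq] := g3.
  have jt := jilted_testP tb3 h20 d3.
  set s4 := if _ then _ else _.
  have e14 v' : ints s4 14 v' = ints s3 14 v' by rewrite /s4; case: ifP.
  have e15 v' i : ints s4 15 v' i =
      if (v' == v) && (i == 0) && ~~ heval 100 s3 jilted_test then 1 else ints s0 15 v' i.
    rewrite /s4 -hok; case: ifP => h /=; first by rewrite andbF.
    by rewrite /update /= h20 andbT.
  split.
  + by rewrite /s4; case: ifP => _; apply: tables_frame.
  + move=> v'; rewrite ltnS leq_eqVlt e14 e15; case: (eqVneq v' v) => [-> _|ne /= lt].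
      split; [exact: d3|exact: hv|exact: hq|rewrite !eqxx !andTb].
      split=> [h|/jt -> //]; apply/jt; case: ifP h => // _.
      by have [_ ->] := hz0 v 0 (leqnn _).
    have -> : ints s3 14 v' = ints s0 14 v' by apply: funext => x; apply: hJ.
    exact: hd0.
  + move=> v' i vv'; have ne : v' != v by rewrite neq_ltn vv' orbT.
    by rewrite e14 e15 (negbTE ne) /= hJ //; apply: hz0; apply: ltnW.
- by rewrite m7.
Qed.

End Rows.

(** * The flow computation and the output *)

Section Flow.
Variables (R : realType) (G : instance) (c : edge G -> R).
Variables (J : nat -> nat -> nat) (okn : nat -> nat).
Implicit Types (s : state R).
Notation n := (levels G).
Notation K := (positions G).
Notation m := (n * K).
Notation ok := (fun v => 0 < okn v).
Notation V := 'I_m.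

Definition static s : Prop :=
  [/\ tables c s, ints s 14 = J & forall v, ints s 15 v 0 = okn v].

Lemma static_frame cm s :
  ~~ has (mem (iwrites cm)) [:: 6; 7; 8; 10; 11; 12; 13; 14; 15] ->
  ~~ has (mem (rwrites cm)) [:: 1; 4] -> static s -> static (run cm s).
Proof.
move=> wi wr [tb h14 h15]; move: (wi); rewrite /= !negb_or.
move=> /and5P[w6 w7 w8 w10 /and5P[w11 w12 w13 w14 /andP[w15 _]]]; split.
- by apply: tables_frame => //; rewrite /= !negb_or w6 w7 w8 w10 w11 w12 w13.
- by apply: funext => i; apply: funext => j; rewrite run_frame // h14.
- by move=> v; rewrite run_frame.
Qed.

Lemma node_bounds v : v < m -> man K v < n /\ pos K v < K.
Proof.
move=> vm; have K0 := K_gt0 G; split; last by rewrite /pos ltn_mod.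
by rewrite /man ltn_divLR.
Qed.

Definition weight (v : V) : R := gain K (cost_at c) J ok v.
Definition arcV : rel V := fun u v => arc K J ok u v.

Lemma set_excess_run s : static s -> (forall i, rels s 2 i 0 = 0%R) ->
  forall v : V, rels (run set_excess s) 2 v 0 = (- weight v)%R.
Proof.
move=> st r2 v.
have m7 : ints s 7 0 0 = m by case: st => [[[]]].
pose I k s' := [/\ static s', forall v : V, v < k -> rels s' 2 v 0 = (- weight v)%R
  & forall i, k <= i -> rels s' 2 i 0 = 0%R].
suff [_ h _] : I m (run set_excess s) by apply: h.
apply: (@run_for _ 7 20 _ _ I (I m)).
- by split.
- move=> k s0; rewrite m7 => km [st0 hd hz]; have [mk pk] := node_bounds km.
  have [[_ hf h12 h13 _] h14 h15] := st0.
  rewrite run_if; set t := heval _ _ _.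
  have tE : t = (0 < okn k) && (J 0 (man K k) < pos K k).
    by rewrite /t /= /update /= h15 h14 h12 // h13 // addn1.
  rewrite tE; case: ifP => cond.
    split.
    + by apply: static_frame.
    + move=> v'; rewrite ltnS leq_eqVlt /= /update /=.
      case: eqP => [e _|ne /= lt]; last exact: hd.
      rewrite /= h12 // h13 // /weight /gain e cond subn1.
      have [_ _ ->] := hf _ _ mk pk.
      have [|_ _ ->] := hf (man K k) (pos K k).-1 mk; last by rewrite opprB.
      exact: leq_ltn_trans (leq_pred _) pk.
    + move=> i ki; rewrite /= /update /= (_ : i == k = false) /=; first exact/hz/ltnW.
      by apply/negbTE; rewrite neq_ltn ki orbT.
  split.
  + by apply: static_frame.
  + move=> v'; rewrite ltnS leq_eqVlt => /orP[/eqP e|]; last exact: hd.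
    rewrite /= e hz // /weight /gain e cond oppr0 //.
  + by move=> i ki; apply/hz/ltnW.
- by rewrite m7.
Qed.

Definition exc s (v : V) : R := rels s 2 v 0.
Definition flw s (u v : V) : R := rels s 3 u v.
Definition hgt s (v : V) : nat := ints s 16 v 0.

Definition flow_good s : Prop :=
  static s /\ preflow arcV weight (exc s) (flw s) (hgt s).
Definition flow_done s : Prop := forall v, ~~ active (exc s) (hgt s) v.
Definition flow_mu s : nat := potential (exc s) (flw s) (hgt s).

Lemma active_testE s (u : V) : static s ->
  heval 100 (set_int s 26 0 0 u) active_test = active (exc s) (hgt s) u.
Proof.
move=> [[[_ h7 _] _ _ _ hz] _ _].
by rewrite /active_test /= /update /= h7 hz -ltNge addn1 /active card_ord.
Qed.

Lemma arc_testE s (u v : V) eu ev : static s -> ieval s eu = u -> ieval s ev = v ->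
  heval 100 s (arc_test eu ev) = arcV u v.
Proof.
move=> [[_ _ h12 h13 _] h14 h15] e1 e2.
by rewrite /= e1 e2 h15 h14 h12 // h13.
Qed.

Lemma admissible_testE s (u v : V) : static s -> ints s 30 0 0 = u ->
  heval 100 (set_int s 27 0 0 v) admissible_test = admissible arcV (flw s) (hgt s) u v.
Proof.
move=> st h30; have [[_ _ h12 h13 hz] h14 h15] := st.
rewrite /admissible_test /tor /= /update /= h30 hz h15 h14 h12 // h13 //.
rewrite negb_and !negbK -ltNge -eqn_leq addn1 /admissible /residual.
by [].
Qed.

Lemma push_run s (u v : V) : flow_good s -> ints s 30 0 0 = u -> ints s 31 0 0 = v ->
  active (exc s) (hgt s) u -> admissible arcV (flw s) (hgt s) u v ->
  flow_good (run push s) /\ flow_mu (run push s) < flow_mu s.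
Proof.
move=> [st pf] h30 h31 /andP[hN eu] /andP[/eqP huv res].
have uv : u != v by apply: contra_eq_neq huv => ->; lia.
have uvn : (u == v :> nat) = false := negbTE uv.
have vun : (v == u :> nat) = false by rewrite eq_sym.
have ah : ints (run push s) 16 = ints s 16.
  by apply: funext => i; apply: funext => j; rewrite run_frame.
have hh : hgt (run push s) = hgt s by apply: funext => z; rewrite /hgt ah.
have st' : static (run push s) by apply: static_frame.
rewrite /flow_good /flow_mu hh.
have at' : heval 100 s (arc_test (cell 30) (cell 31)) = arcV u v by apply: arc_testE.
have rt : heval 100 s (TBase (RLe (excess (cell 30)) (RGet 3 (cell 31) (cell 30)))) =
  (exc s u <= flw s v u)%R by rewrite /= h30 h31.
have nE (a b : V) : (a == b :> nat) = (a == b) by [].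
rewrite nE in uvn; rewrite nE in vun.
case: (boolP (arcV u v)) at' => au at'.
  have e'E z : exc (run push s) z = (exc s z + exc s u *+ (z == v) - exc s u *+ (z == u))%R.
    rewrite /push run_if at' /exc /= /update /= h30 h31 !nE uvn /= !andbT.
    case: (eqVneq z u) => [->|zu]; first by rewrite uvn mulr0n mulr1n addr0.
    by case: (eqVneq z v) => [->|zv]; rewrite ?mulr1n ?mulr0n subr0 ?addr0.
  have g'E z z' : flw (run push s) z z' = (flw s z z' + exc s u *+ ((z == u) && (z' == v)))%R.
    rewrite /push run_if at' /flw /exc /= /update /= h30 h31 !nE uvn /=.
    by case: ifP => [/andP[/eqP-> /eqP->]|_]; rewrite ?mulr1n ?mulr0n ?addr0.
  split; first (split=> //).
    exact: (push_preflow pf huv eu (lexx _) (or_introl (And4 erefl erefl erefl au))).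
  apply: (push_all_potential pf huv eu).
  - by rewrite e'E eqxx uvn mulr0n mulr1n addr0 subrr.
  - by move=> z zu zv; rewrite e'E (negbTE zu) (negbTE zv) !mulr0n addr0 subr0.
  - move=> x y hxy; rewrite g'E; case: (boolP (_ && _)); last by rewrite mulr0n addr0.
    by case/andP=> /eqP ex /eqP ey; move: hxy; rewrite ex ey huv; lia.
have gvu : (0 < flw s v u)%R by move: res; rewrite /residual (negbTE au).
case: (leP (exc s u) (flw s v u)) rt => [le|lt] rt.
  have e'E z : exc (run push s) z = (exc s z + exc s u *+ (z == v) - exc s u *+ (z == u))%R.
    rewrite /push run_if at' run_if rt /exc /= /update /= h30 h31 !nE uvn /= !andbT.
    case: (eqVneq z u) => [->|zu]; first by rewrite uvn mulr0n mulr1n addr0.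
    by case: (eqVneq z v) => [->|zv]; rewrite ?mulr1n ?mulr0n subr0 ?addr0.
  have g'E z z' : flw (run push s) z z' = (flw s z z' + - exc s u *+ ((z == v) && (z' == u)))%R.
    rewrite /push run_if at' run_if rt /flw /exc /= /update /= h30 h31 !nE uvn /=.
    by case: ifP => [/andP[/eqP-> /eqP->]|_]; rewrite ?mulr1n ?mulr0n ?addr0.
  split; first (split=> //).
    exact: (push_preflow pf huv eu (lexx _) (or_intror (And4 erefl erefl erefl le))).
  apply: (push_all_potential pf huv eu).
  - by rewrite e'E eqxx uvn mulr0n mulr1n addr0 subrr.
  - by move=> z zu zv; rewrite e'E (negbTE zu) (negbTE zv) !mulr0n addr0 subr0.
  - move=> x y hxy; rewrite g'E; case: (boolP (_ && _)); last by rewrite mulr0n addr0.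
    by case/andP=> /eqP-> /eqP->.
have e'E z : exc (run push s) z = (exc s z + flw s v u *+ (z == v) - flw s v u *+ (z == u))%R.
  rewrite /push run_if at' run_if rt /flw /exc /= /update /= h30 h31 !nE uvn /= !andbT.
  case: (eqVneq z u) => [->|zu]; first by rewrite uvn mulr0n mulr1n addr0.
  by case: (eqVneq z v) => [->|zv]; rewrite ?mulr1n ?mulr0n subr0 ?addr0.
have g'E z z' : flw (run push s) z z' = (flw s z z' + - flw s v u *+ ((z == v) && (z' == u)))%R.
  rewrite /push run_if at' run_if rt /flw /exc /= /update /= h30 h31 !nE /=.
  by case: ifP => [/andP[/eqP-> /eqP->]|_]; rewrite ?mulr1n ?mulr0n ?addr0.
split; first (split=> //).
  exact: (push_preflow pf huv gvu (ltW lt) (or_intror (And4 erefl erefl erefl (lexx _)))).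
apply: (push_sat_potential pf huv _ gvu).
- move=> z zv; rewrite e'E (negbTE zv) mulr0n addr0.
  by case: (z == u); rewrite ?mulr0n ?subr0 // mulr1n subr_gt0; apply: lt_trans.
- move=> x y; rewrite g'E; case: ifP => [/andP[/eqP-> /eqP->]|_]; last by rewrite mulr0n addr0.
  by rewrite mulr1n subrr.
Qed.

Lemma relabel_run s (u : V) : flow_good s -> ints s 30 0 0 = u ->
  active (exc s) (hgt s) u -> (forall v, ~~ admissible arcV (flw s) (hgt s) u v) ->
  flow_good (run relabel s) /\ flow_mu (run relabel s) < flow_mu s.
Proof.
move=> [st pf] h30 au na.
have hh : hgt (run relabel s) = upd (hgt s) u (hgt s u).+1.
  apply: funext => z; rewrite /hgt /upd /= /update /= h30 andbT.
  by rewrite addn1.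
rewrite /flow_good /flow_mu hh; split; last exact: (relabel_potential pf au).
by split; [apply: static_frame | exact: (relabel_preflow pf au na)].
Qed.

(** Without an active node the step touches only auxiliary cells; otherwise it is one push or,
    failing an admissible arc, one relabel. *)
Lemma flow_step_advances : advances flow_good flow_done flow_mu flow_step 1.
Proof.
move=> s [st pf].
have m7 : ints s 7 0 0 = m by case: st => [[[]]].
rewrite /flow_step !run_seq run_if; set s1 := run (setc 30 (cell 7)) s.
have SR := @run_search _ 7 26 30 active_test s1 isT.
have fr y : y \notin [:: 26; 30; 99] -> ints (run (search 7 26 30 active_test) s1) y = ints s y.
  move=> ny; apply: funext => i; apply: funext => j; rewrite run_frame.
    rewrite /s1 run_frame //; apply: contra ny; rewrite /= !inE => ->; by rewrite orbT.
  by apply: contra ny; rewrite /= !inE.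
have frr : rels (run (search 7 26 30 active_test) s1) = rels s.
  by apply: funext => x; apply: funext => i; apply: funext => j; rewrite run_framer.
have st2 : static (run (search 7 26 30 active_test) s1).
  by apply: static_frame => //; apply: static_frame.
have st1 : static s1 by apply: static_frame.
move: (run (search 7 26 30 active_test) s1) SR fr frr st2 => s2 SR fr frr st2.
have e2 : exc s2 = exc s by apply: funext => z; rewrite /exc frr.
have f2 : flw s2 = flw s by apply: funext => z; apply: funext => z'; rewrite /flw frr.
have h2 : hgt s2 = hgt s by apply: funext => z; rewrite /hgt fr.
have g2 : flow_good s2 by split=> //; rewrite e2 f2 h2.
have m7' : ints s2 7 0 0 = m by rewrite fr.
have t2 : heval 100 s2 (ilt (cell 30) (cell 7)) = (ints s2 30 0 0 < m).
  by rewrite /= m7' addn1.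
rewrite t2; case: SR => [[no r30]|[ku [kum ac r30]]].
  have -> : ints s2 30 0 0 = m by rewrite r30 /s1 /= /update /= m7.
  rewrite ltnn.
  have dn : flow_done s.
    move=> v; rewrite -(active_testE v st1); apply: no; rewrite /s1 /= /update /= m7.
    exact: ltn_ord.
  have dn2 : flow_done s2 by rewrite /flow_done e2 h2.
  by split=> //; left.
have um : ku < m by move: kum; rewrite /s1 /= /update /= m7.
rewrite r30 um; pose u : V := Ordinal um.
have act : active (exc s) (hgt s) u by rewrite -(active_testE u st1).
have h30 : ints s2 30 0 0 = u by [].
have nd : ~ flow_done s by move/(_ u); rewrite act.
rewrite !run_seq run_if; set s3 := run (setc 31 (cell 7)) s2.
have SR := @run_search _ 7 27 31 admissible_test s3 isT.
have st3 : static s3 by apply: static_frame.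
have h303 : ints s3 30 0 0 = u by [].
have fr4 y : y \notin [:: 27; 31; 99] -> ints (run (search 7 27 31 admissible_test) s3) y = ints s2 y.
  move=> ny; apply: funext => i; apply: funext => j; rewrite run_frame.
    rewrite /s3 run_frame //; apply: contra ny; rewrite /= !inE => ->; by rewrite orbT.
  by apply: contra ny; rewrite /= !inE.
have frr4 : rels (run (search 7 27 31 admissible_test) s3) = rels s2.
  by apply: funext => x; apply: funext => i; apply: funext => j; rewrite run_framer.
have st4 : static (run (search 7 27 31 admissible_test) s3) by apply: static_frame.
move: (run (search 7 27 31 admissible_test) s3) SR fr4 frr4 st4 => s4 SR fr4 frr4 st4.
have e4 : exc s4 = exc s by rewrite -e2; apply: funext => z; rewrite /exc frr4.
have f4 : flw s4 = flw s.
  by rewrite -f2; apply: funext => z; apply: funext => z'; rewrite /flw frr4.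
have h4 : hgt s4 = hgt s by rewrite -h2; apply: funext => z; rewrite /hgt fr4.
have g4 : flow_good s4 by split=> //; rewrite e4 f4 h4.
have mu4 : flow_mu s4 = flow_mu s by rewrite /flow_mu e4 f4 h4.
have h304 : ints s4 30 0 0 = u by rewrite fr4.
have act4 : active (exc s4) (hgt s4) u by rewrite e4 h4.
have t4 : heval 100 s4 (ilt (cell 31) (cell 7)) = (ints s4 31 0 0 < m).
  by rewrite /= [ints s4 7]fr4 // m7' addn1.
have adE (v : V) : heval 100 (set_int s3 27 0 0 v) admissible_test =
    admissible arcV (flw s4) (hgt s4) u v.
  rewrite (admissible_testE v st3 h303) f4 h4 -f2 -h2; by [].
rewrite t4 -mu4; case: SR => [[no r31]|[kv [kvm ad r31]]].
  have -> : ints s4 31 0 0 = m by rewrite r31 /s3 /= /update /= m7'.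
  rewrite ltnn; have [|g5 mu5] := relabel_run g4 h304 act4.
    move=> v; rewrite -adE; apply: no; rewrite /s3 /= /update /= m7'; exact: ltn_ord.
  by split=> //; right; rewrite addn1.
have vm : kv < m by move: kvm; rewrite /s3 /= /update /= m7'.
rewrite r31 vm; have h31 : ints s4 31 0 0 = Ordinal vm by [].
have [|g5 mu5] := push_run g4 h304 h31 act4; first by rewrite -adE.
by split=> //; right; rewrite addn1.
Qed.

Lemma flow_run s : flow_good s -> flow_mu s < m * (m * (m * (m * m))) ->
  flow_good (run flow s) /\ flow_done (run flow s).
Proof.
move=> gs mu.
have h7 s' : flow_good s' -> ints s' 7 0 0 = m by case=> [[[[]]]].
have ad : advances flow_good flow_done flow_mu flow (m * (m * (m * (m * (m * 1))))).
  by do 5!(apply: advances_for => //); exact: flow_step_advances.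
have [g _ [//|le]] := ad s gs.
by exfalso; move: le mu; rewrite muln1; lia.
Qed.

Lemma flow_start s : static s -> (forall v : V, rels s 2 v 0 = (- weight v)%R) ->
  (forall i j, rels s 3 i j = 0%R) -> (forall i j, ints s 16 i j = 0) ->
  flow_good s /\ flow_mu s < m * (m * (m * (m * m))).
Proof.
move=> st h2 h3 h16.
have e0 : exc s = (fun v => - weight v)%R by apply: funext.
have f0 : flw s = (fun _ _ => 0%R) by apply: funext => u; apply: funext => v; apply: h3.
have g0 : hgt s = (fun=> 0) by apply: funext => u; apply: h16.
rewrite /flow_good /flow_mu e0 f0 g0; split; first by split=> //; apply: start_preflow.
rewrite start_potential card_ord.
(* [m] is the cube of a number at least 2; this lets [m] to the fifth dominate the potential with
   its constants. *)
have m8 : 8 <= m.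
  have n2 : 2 <= n by [].
  by have := leq_mul n2 (leq_mul n2 n2).
move: (m) m8 => k k8; have -> : k * (k * (k * (k * k))) = (k * k * k) * (k * k) by ring.
rewrite ltn_mul2r; apply/andP; split; first by rewrite muln_gt0; lia.
have k1 : 8 * (k * k) <= k * (k * k) by rewrite leq_mul2r k8 orbT.
have k2 : 8 * k <= k * k by rewrite leq_mul2r k8 orbT.
by rewrite mulnS -mulnA -[k * k * k]mulnA; lia.
Qed.

Lemma find_gap_run s : static s -> exists2 k, ints (run find_gap s) 17 0 0 = k &
  k <= m /\ forall v : V, hgt s v != k.
Proof.
move=> st; have m7 : ints s 7 0 0 = m by case: st => [[[]]].
rewrite /find_gap run_seq; set s1 := run (setc 17 (cell 7)) s.
set t := TNot _; have SR := @run_search _ 7 20 17 t s1 isT.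
have tE k : reflect (exists v : V, hgt s v = k) (~~ heval 100 (set_int s1 20 0 0 k) t).
  rewrite /t /= negbK /update /= m7; apply: (iffP hasP) => [[v]|[v e]].
    rewrite mem_iota0 => vm e; exists (Ordinal vm); apply/eqP; rewrite eqn_leq; exact: e.
  by exists (val v); rewrite ?mem_iota0 //= -/(hgt s v) e leqnn.
have m71 : ints s1 7 0 0 = m by [].
case: SR => [[all r17]|[k [km nt r17]]].
  exists m; first by rewrite r17 /s1 /= /update /= m7.
  split=> // v; have := @gap_top V (hgt s); rewrite card_ord; apply=> k km.
  by apply/tE; apply: all; rewrite m71.
exists k => //; split; first by rewrite -m71 ltnW.
move=> v; apply/eqP => e; have /tE : exists v : V, hgt s v = k by exists v.
by rewrite nt.
Qed.

Section Vector.
Variable X : pred nat.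

Lemma set_vector_run s : static s ->
  (forall v, v < m -> (ints s 17 0 0 < ints s 16 v 0) = X v) ->
  forall a, a < n -> ints (run set_vector s) 18 a 0 = join J ok X m a.
Proof.
move=> st hX.
have n6 : ints s 6 0 0 = n by case: st => [[[]]].
have m7 : ints s 7 0 0 = m by case: st => [[[]]].
rewrite /set_vector run_seq.
pose pre s' := [/\ static s', ints s' 16 = ints s 16 & ints s' 17 0 0 = ints s 17 0 0].
have pre6 s' : pre s' -> ints s' 6 0 0 = n by case=> [[[[]]]].
have st1 : pre (run (CFor 6 21 (CSet 18 (cell 21) (ICst 0) (IGet 14 (ICst 0) (cell 21)))) s) /\
  forall a, a < n -> ints (run (CFor 6 21 (CSet 18 (cell 21) (ICst 0) (IGet 14 (ICst 0) (cell 21)))) s) 18 a 0 = J 0 a.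
  pose I k s' := pre s' /\ forall a, a < k -> ints s' 18 a 0 = J 0 a.
  apply: (@run_for _ 6 21 _ _ I (I n)); [by split|move=> k s' _ [p h]|by rewrite n6].
  case: (p) => [[tb h14 h15] h16 h17]; split; first by split=> //; apply: static_frame.
  move=> a; rewrite ltnS leq_eqVlt /= /update /= h14 andbT.
  by case: eqP => [->|_ /= /h].
move: (run _ s) st1 => s1 [p1 h1].
have m71 : ints s1 7 0 0 = m by case: p1 => [[[[]]]].
pose I k s' := pre s' /\ forall a, a < n -> ints s' 18 a 0 = join J ok X k a.
have : I m (run (CFor 7 20 (CIf (TAnd (ile (ICst 1) (at1 15 (cell 20))) (ilt (cell 17) (at1 16 (cell 20))))
    (CFor 6 21 (CIf (ilt (at1 18 (cell 21)) (IGet 14 (cell 20) (cell 21)))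
       (CSet 18 (cell 21) (ICst 0) (IGet 14 (cell 20) (cell 21))) nop)) nop)) s1);
  last by case.
apply: (@run_for _ 7 20 _ _ I (I m)); [by split| |by rewrite m71].
move=> k s2; rewrite m71 => km [p2 h2]; case: (p2) => [[tb h14 h15] h16 h17].
rewrite run_if; set t := heval _ _ _.
have -> : t = ok k && X k.
  by rewrite /t /= /update /= h15 h16 h17 addn1 hX.
case: ifP => cond; last first.
  split; first by split=> //; apply: static_frame.
  by move=> a an; rewrite joinS cond /= /update /= h2.
pose I' i s' := [/\ pre s', ints s' 20 0 0 = k & forall a, a < n ->
  ints s' 18 a 0 = if a < i then join J ok X k.+1 a else join J ok X k a].
suff : I' n (run (CFor 6 21 (CIf (ilt (at1 18 (cell 21)) (IGet 14 (cell 20) (cell 21)))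
       (CSet 18 (cell 21) (ICst 0) (IGet 14 (cell 20) (cell 21))) nop)) (set_int s2 20 0 0 k)).
  by case=> p _ h; split=> // a an; rewrite h // an.
apply: (@run_for _ 6 21 _ _ I' (I' n)).
- by split.
- move=> i s3; rewrite [X in _ < X](_ : _ = n); last exact: (pre6 s2).
  move=> iln [p3 h20 h3]; case: (p3) => [[tb3 h143 h153] h163 h173].
  rewrite run_if; set t' := heval _ _ _.
  have -> : t' = (join J ok X k i < J k i).
    by rewrite /t' /= /update /= h143 h20 h3 // ltnn addn1.
  split.
  + by case: ifP => _; split=> //; apply: static_frame.
  + by case: ifP.
  + move=> a an; rewrite [a < i.+1]ltnS [a <= i]leq_eqVlt.
    case: (ltnP (join J ok X k i)) => hJ.
      rewrite /= /update /= h143 h20 ?andbT; case: eqP => [->|_] /=; last exact: h3.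
      by rewrite joinS cond (maxn_idPr (ltnW hJ)).
    rewrite /= /update /= h3 //; case: eqP => [->|//] /=.
    by rewrite ltnn joinS cond (maxn_idPl hJ).
- by rewrite (_ : ints _ 6 0 0 = n); last exact: (pre6 s2).
Qed.

Lemma write_output_run s q : static s -> (forall i j, ints s 5 i j = 0) ->
  (forall a, a < n -> q a < K) -> (forall a, a < n -> ints s 18 a 0 = q a) ->
  forall s', (forall i j, ints s' 5 i j = ints (run write_output s) 5 i j) ->
  output G s' = vector_matching G q.
Proof.
move=> st h5 hK h18 s' es'.
have n6 : ints s 6 0 0 = n by case: st => [[[]]].
pose I k s1 := [/\ static s1, forall a, a < n -> ints s1 18 a 0 = q a &
  forall a b, b < n -> (ints s1 5 a b == 1) = (a < k) && (woman_at G a (q a) == b)].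
have [_ _ h] : I n (run write_output s).
  apply: (@run_for _ 6 20 _ _ I (I n)); last by rewrite n6.
    by split=> // a b _; rewrite h5.
  move=> k s1; rewrite n6 => kn [st1 h1 h2].
  have [[[e6 _ _] hf _ _ _] _ _] := st1.
  have [f10 _ _] := hf k (q k) kn (hK k kn).
  rewrite run_if; set t := heval _ _ _.
  have -> : t = (woman_at G k (q k) < n).
    by rewrite /t /= /update /= h1 // f10 e6 addn1.
  case: ifP => lt; split; try by [apply: static_frame|].
    move=> a b bn; rewrite /= /update /= h1 // f10 ltnS leq_eqVlt.
    case: (eqVneq a k) => [->|ak] /=; last exact: h2.
    case: (eqVneq b (woman_at G k (q k))) => [//|ne].
    by rewrite h2 // ltnn.
  move=> a b bn; rewrite /= /update /= ltnS leq_eqVlt h2 //.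
  case: (eqVneq a k) => [->|ak] //=; rewrite ltnn /=; apply/esym/negbTE.
  by apply/eqP => e; move: lt; rewrite e bn.
apply/setP => -[a b]; rewrite !inE /= es' h ?ordB_lt //.
by rewrite ordA_lt.
Qed.

End Vector.
End Flow.

(** * Composition of the phases and the time bound *)

Section Main.
Variables (R : realType) (G : instance) (c : edge G -> R).
Notation n := (levels G).
Notation K := (positions G).
Notation m := (n * K).

Definition sized : state R := run set_sizes (run set_levels (input c)).

Lemma sized_ints x i j : x \notin [:: 6; 7; 8; 20; 21; 22] ->
  ints sized x i j = input_ints G x i j.
Proof.
rewrite !inE !negb_or => /and5P[x6 x7 x8 x20 /andP[x21 x22]].
by rewrite /sized !run_frame //= !inE ?negb_or ?x6 ?x7 ?x8 ?x20 ?x21 ?x22.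
Qed.

Lemma sized_rels x i j : rels sized x i j = input_reals c x i j.
Proof. by rewrite /sized !run_framer. Qed.

Lemma sized_limits :
  [/\ ints sized 6 0 0 = n, ints sized 7 0 0 = m & ints sized 8 0 0 = K].
Proof.
have e6 := set_levels_run c.
have [//|//|e7 e8] := set_sizes_run e6.
by split=> //; rewrite /sized run_frame.
Qed.

Lemma solve_correct (s' : state R) :
  (forall i j, ints s' 5 i j = ints (run solve sized) 5 i j) ->
  min_cost_popular_max_matching c (output G s').
Proof.
have [h6 h7 h8] := sized_limits.
have ki : keeps_input c sized.
  by split; [split|]=> i j; rewrite ?sized_rels // sized_ints.
rewrite /solve 7!run_seq.
set s1 := run set_ranks sized.
have pre1 : table_pre c s1.
  split.
  - case: ki => [[k1 k2 k3 k4] kr]; split; first by split=> i j; rewrite /s1 run_frame.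
    by move=> i j; rewrite /s1 run_framer.
  - by split; rewrite /s1 run_frame.
  - exact: set_ranks_run ki h6.
  - by rewrite /s1 run_framer // sized_rels.
have fr1 x i j : x \notin [:: 6; 7; 8; 20; 21; 22; 9; 99] -> ints s1 x i j = input_ints G x i j.
  move=> h; rewrite /s1 run_frame ?sized_ints //; apply: contra h; rewrite /= !inE.
    by move/or4P=> [||| /or3P[]] /eqP ->.
  by move/or4P=> [|||] /eqP->.
have rr1 x i j : rels s1 x i j = input_reals c x i j by rewrite /s1 run_framer // sized_rels.
have tb2 : tables c (run set_table s1) by apply: set_table_run => //; rewrite fr1.
move: (run set_table s1) tb2 (fun x i j => @run_frame R set_table s1 x i j)
  (fun x i j => @run_framer R set_table s1 x i j) => s2 tb2 fr2 rr2.
have rd := set_rows_run tb2.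
have {}rd : rows_done G (run set_rows s2).
  by apply: rd => i j; rewrite fr2 // fr1.
have tb3 : tables c (run set_rows s2) by apply: tables_frame.
move: (run set_rows s2) rd tb3 (fun x i j => @run_frame R set_rows s2 x i j)
  (fun x i j => @run_framer R set_rows s2 x i j) => s3 rd tb3 fr3 rr3.
pose J := ints s3 14; pose okn v := ints s3 15 v 0.
have st3 : static c J okn s3 by [].
have ex4 := set_excess_run st3.
have {}ex4 (v : 'I_m) : rels (run set_excess s3) 2 v 0 = (- weight c J okn v)%R.
  by apply: ex4 => i; rewrite rr3 // rr2 // rr1.
have st4 : static c J okn (run set_excess s3) by apply: static_frame.
have [||g4 mu4] := flow_start st4 ex4.
- by move=> i j; rewrite run_framer // rr3 // rr2 // rr1.
- by move=> i j; rewrite run_frame // fr3 // fr2 // fr1.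
move: (run set_excess s3) g4 mu4 (fun x i j => @run_frame R set_excess s3 x i j) => s4 g4 mu4 fr4.
have [[st5 pf5] dn5] := flow_run g4 mu4.
move: (run flow s4) st5 pf5 dn5 (fun x i j => @run_frame R flow s4 x i j) => s5 st5 pf5 dn5 fr5.
have [k e17 [km gap]] := find_gap_run st5.
have st6 : static c J okn (run find_gap s5) by apply: static_frame.
move: (run find_gap s5) e17 st6 (fun x i j => @run_frame R find_gap s5 x i j) => s6 e17 st6 fr6.
pose X : pred nat := fun v => k < ints s5 16 v 0.
have vec := @set_vector_run R G c J okn X s6 st6.
have {}vec : forall a, a < n -> ints (run set_vector s6) 18 a 0 = join J (fun v => 0 < okn v) X m a.
  by apply: vec => v _; rewrite e17 fr6.
have st7 : static c J okn (run set_vector s6) by apply: static_frame.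
move: (run set_vector s6) vec st7 (fun x i j => @run_frame R set_vector s6 x i j) => s7 vec st7 fr7.
have K0 := K_gt0 G; have n0 : 0 < n by [].
have Js v : v < m -> settled n K (woman_at G) (score_at G) (J v) by case/rd.
have Jg v : v < m -> pos K v <= J v (man K v) by case/rd.
have Jl v q : v < m -> settled n K (woman_at G) (score_at G) q ->
  pos K v <= q (man K v) -> below n (J v) q by case/rd => _ _ h _; apply: h.
have okP v : v < m -> (0 < okn v) <-> stable n K (woman_at G) (score_at G) (J v) by case/rd.
set ok := fun v => 0 < okn v in vec okP.
have sj := join_stable (@woman_last G) (@score_inj G) n0 K0 Js Jl okP X (leqnn m).
(* The arcs between node numbers are those of the flow network, so the gap makes [X] closed. *)
have arcX : arc_closed n K J ok X.
  move=> u v um vm Xu a.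
  exact: (gap_closed pf5 gap (u := Ordinal um) (v := Ordinal vm)).
move=> es'; rewrite (write_output_run st7 _ _ vec es'); last first.
- by move=> a an; case: (sj.1 a an).
- by move=> i j; rewrite fr7 // fr6 // fr5 // fr4 // fr3 // fr2 // fr1.
apply: optimal_vector => //.
apply: (join_optimal (@woman_last G) (@score_inj G) n0 K0 Js Jg Jl okP arcX) => X' clX'.
rewrite !big_mkord.
have := gap_optimal pf5 dn5 _ gap; rewrite card_ord => /(_ km (fun v => X' v)); apply.
by move=> u v; apply: clX'.
Qed.

End Main.

Theorem theorem1 (R : realType) :
  exists (P : program) (p : {poly nat}),
    forall (G : instance) (c : edge G -> R),
      exists (t : nat) (s : state R),
        [/\ exec P (input c) t s,
            t <= (p.[gsize G])%R
          & min_cost_popular_max_matching c (output G s)].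
Proof.
(* [levels G] is |A| + |B| + 2, at most the size plus 2; its cube [b] bounds all three loop
   limits. *)
pose l := ('X + 2%:P : {poly nat})%R; pose b := (l * (l * l))%R.
(* Three separate compilations, because the limits 6, then 7 and 8, must be computed before they can
   count as constant. *)
exists (Seq (compile set_levels) (Seq (compile set_sizes) (compile solve))).
exists (cmd_time set_levels b + (cmd_time set_sizes b + cmd_time solve b))%R => G c.
set g := gsize G.
have lg : (l.[g])%R = g + 2 by rewrite /l hornerDn hornerX hornerC.
have bE : (b.[g])%R = (g + 2) * ((g + 2) * (g + 2)) by rewrite /b !hornerMn lg.
have nb : levels G <= g + 2 by rewrite /levels /top /g /gsize; lia.
have mb : levels G * positions G <= (b.[g])%R by rewrite bE; do 2!apply: leq_mul => //.
have Kb : positions G <= (b.[g])%R by apply: leq_trans mb; rewrite leq_pmull.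
have nb' : levels G <= (b.[g])%R by apply: leq_trans Kb; rewrite leq_pmull.
have [|s1 [ex1 ag1]] := @exec_compile R b g [::] set_levels (input c) (input c) isT isT (agree_refl _ _).
  by [].
have [|s2 [ex2 ag2]] := exec_compile (b := b) (g := g) (ls := [:: 6]) isT set_sizes_wf ag1.
  by move=> x; rewrite inE => /eqP ->; rewrite set_levels_run.
have [h6 h7 h8] := sized_limits c.
have [|s3 [ex3 ag3]] := exec_compile (b := b) (g := g) (ls := [:: 6; 7; 8]) isT solve_wf ag2.
  by move=> x; rewrite !inE => /or3P[] /eqP ->; rewrite -/(sized c) ?h6 ?h7 ?h8.
have [t ex le] := exec_le_seq ex1 (exec_le_seq ex2 ex3).
exists t, s3; split=> //; first by rewrite 2!hornerDn.
by apply: solve_correct => i j; case: ag3 => h _ _; apply: h.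
Qed.
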